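(* Assume that the Orlicz function $\Psi$ satisfies, for some $A>1$, the condition $$\limsup_{x\to\infty}\frac{\Psi(Ax)}{[\Psi(x)]^2}>0.$$ Then, for every $p>2$, there exists an analytic self-map $\phi\colon\mathbb{D}\to\mathbb{D}$ such that $C_\phi\colon H^2\to H^2$ is in the Schatten class $S_p$, but $C_\phi\colon H^\Psi\to H^\Psi$ is not compact.
   Context: $\mathbb{D}$ is the open unit disk of $\mathbb{C}$, $\mathbb{T}=\partial\mathbb{D}$, and $m$ is normalized Lebesgue measure on $\mathbb{T}$. $H^p$ denotes the classical Hardy space on $\mathbb{D}$. For an analytic self-map $\phi\colon\mathbb{D}\to\mathbb{D}$, $C_\phi$ is the composition operator $f\mapsto f\circ\phi$. $S_p$ ($p>0$) is the Schatten class of compact operators on the Hilbert space $H^2$ whose singular numbers are in $\ell_p$. An Orlicz function is a non-decreasing convex function $\Psi\colon[0,\infty]\to[0,\infty]$ with $\Psi(0)=0$, $\Psi(\infty)=\infty$, which is moreover assumed to be continuous at $0$, strictly convex on $[0,\infty)$ (hence finite and increasing there), and such that $\Psi(x)/x\to\infty$ as $x\to\infty$. $L^\Psi(\mathbb{T})$ is the space of (classes of) measurable $f\colon\mathbb{T}\to\mathbb{C}$ for which there is $C>0$ with $\int_{\mathbb{T}}\Psi(|f|/C)\,dm<+\infty$; the Luxemburg norm $\|f\|_\Psi$ is the infimum of the constants $C>0$ such that this integral is $\le 1$. The Hardy-Orlicz space $H^\Psi$ is the space of all $f\in H^1$ whose boundary function $f^*$ lies in $L^\Psi(\mathbb{T})$,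 normed by $\|f^*\|_\Psi$. Every composition operator is bounded on every $H^p$ and on every $H^\Psi$. *)

(* Defs.v *)
From HB Require Import structures.
From mathcomp Require Import all_boot all_order all_algebra.
From mathcomp Require Import all_classical all_reals all_analysis.
From mathcomp Require Import complex.

Set Warnings "-notation-overridden,-ambiguous-paths,-notation-incompatible-prefix".
Set Implicit Arguments.
Unset Strict Implicit.
Unset Printing Implicit Defensive.

Import Order.TTheory GRing.Theory Num.Theory.
Import numFieldNormedType.Exports.

Local Open Scope classical_set_scope.
Local Open Scope ring_scope.
Local Open Scope complex_scope.

(* MathComp-Analysis attaches the topology to the carriers of numeric field
   structures, hence this packed copy of R[i]. *)
Definition Cplx (R : realType) : numClosedFieldType := R[i].

(* The real-valued modulus: `|z| has type Cplx R. *)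
Definition cmod (R : realType) (z : Cplx R) : R := Normc.normc z.

Definition disk (R : realType) : Type := {z : Cplx R | `|z| < 1}.

Section AbstractOperators.
Variables (R : realType) (V : lmodType (Cplx R)).
Implicit Types (H W : set V) (T S : V -> V).

(* A space of functions is a subset H of V with an extended-real norm nrm, and
   T is meant to map H to itself (as composition operators do). *)
Definition compact_operator H (nrm : V -> \bar R) T : Prop :=
  forall f : nat -> V,
    (forall n, H (f n)) ->
    (exists M : R, forall n, (nrm (f n) <= M%:E)%E) ->
    exists k : nat -> nat, {homo k : m n / (m < n)%N} /\
      exists g : V, H g /\
        nrm (T (f (k n)) - g) @[n --> \oo] --> (0%E : \bar R).

Definition has_dim W (d : nat) : Prop :=
  exists e : 'I_d -> V,
    [/\ forall i, W (e i),
        forall c : 'I_d -> Cplx R,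
          \sum_(i < d) c i *: e i = 0 -> forall i, c i = 0
      & forall v, W v -> exists c : 'I_d -> Cplx R,
          v = \sum_(i < d) c i *: e i].

Definition eigenspace_in H T (a : Cplx R) : set V :=
  [set v | H v /\ T v = a *: v].

Definition is_adjoint H (ip : V -> V -> Cplx R) T S : Prop :=
  (forall v, H v -> H (S v)) /\
  (forall u v, H u -> H v -> ip (T u) v = ip u (S v)).

(* s lists in decreasing order the eigenvalues of (T^* T)^(1/2), each t > 0 as
   many times as the dimension of the eigenspace of T^* T for t ^ 2; s is
   completed by zeros when there are finitely many of them. *)
Definition singular_numbers H (ip : V -> V -> Cplx R) T (s : nat -> R) : Prop :=
  [/\ forall n, 0 <= s n,
      nonincreasing_seq s
    & exists S, is_adjoint H ip T S /\
        forall t : R, 0 < t -> exists d : nat,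
          has_dim (eigenspace_in H (S \o T) (t ^+ 2)%:C) d /\
          ([set n | s n = t] #= `I_d)%card].

Definition schatten H (ip : V -> V -> Cplx R) (nrm : V -> \bar R)
    (p : R) T : Prop :=
  compact_operator H nrm T /\
  exists s : nat -> R, singular_numbers H ip T s /\
    (\sum_(0 <= n <oo) (s n `^ p)%:E < +oo)%E.

End AbstractOperators.

Section Hardy.
Variable R : realType.
Local Notation C := (Cplx R).
Implicit Types (f g : disk R -> C) (u : R -> C) (Psi : \bar R -> \bar R).

Lemma two_pi_gt0 : 0 < 2 * pi :> R.
Proof. by rewrite mulr_gt0 ?pi_gt0. Qed.

(* The circle is parametrized by t |-> e^(it), and m is the uniform
   probability for t in [0, 2 pi]; functions on the circle are functions of t. *)
Definition expi (t : R) : C := cos t +i* sin t.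

Local Notation m := (uniform_prob two_pi_gt0).

(* Extension by zero outside the disk. *)
Definition ext f (z : C) : C := oapp f 0 (insub z).

(* Complex differentiability at every point of the disk. *)
Definition analytic f : Prop := forall z : disk R, derivable (ext f) (val z) 1.

Definition hardy_mean (p : R) f (r : R) : \bar R :=
  ('N[m]_(p%:E)[(fun t => (cmod (ext f (r%:C * expi t)))%:E)])%E.

Definition hardy_norm (p : R) f : \bar R :=
  ereal_sup [set hardy_mean p f r | r in `[0, 1[].

Definition hardy (p : R) : set (disk R -> C) :=
  [set f | analytic f /\ (hardy_norm p f < +oo)%E].

(* The boundary function f^*: radial limits. They exist almost everywhere for f
   in H^1; elsewhere lim is the default point. *)
Definition boundary f (t : R) : C :=
  lim (ext f (r%:C * expi t) @[r --> (1 : R)^'-]).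

Definition circle_integral u : C :=
  (\int[m]_t complex.Re (u t))%R +i* (\int[m]_t complex.Im (u t))%R.

Definition hardy2_ip f g : C :=
  circle_integral (fun t => boundary f t * (boundary g t)^*).

Definition comp_op (phi : disk R -> disk R) f : disk R -> C := f \o phi.

(* Only the values of Psi on [0, +oo] matter. *)
Record orlicz_function Psi : Prop := OrliczFunction {
  orlicz_ge0 : forall x, (0 <= x)%E -> (0 <= Psi x)%E ;
  orlicz_0 : Psi 0%E = 0%E ;
  orlicz_oo : Psi +oo%E = +oo%E ;
  orlicz_nondecreasing : forall x y, (0 <= x)%E -> (x <= y)%E ->
    (Psi x <= Psi y)%E ;
  orlicz_convex : forall (x y : \bar R) (t : R),
    (0 <= x)%E -> (0 <= y)%E -> 0 <= t <= 1 ->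
    (Psi (t%:E * x + (1 - t)%:E * y)
       <= t%:E * Psi x + (1 - t)%:E * Psi y)%E ;
  orlicz_continuous_0 : Psi x%:E @[x --> (0 : R)^'+] --> (0%E : \bar R) ;
  orlicz_strictly_convex : forall x y t : R,
    0 <= x -> 0 <= y -> x != y -> 0 < t < 1 ->
    (Psi (t * x + (1 - t) * y)%:E
       < t%:E * Psi x%:E + (1 - t)%:E * Psi y%:E)%E ;
  orlicz_superlinear :
    (Psi x%:E / x%:E)%E @[x --> +oo%R] --> (+oo%E : \bar R) }.

Definition modular Psi (c : R) u : \bar R :=
  (\int[m]_t Psi (cmod (u t) / c)%:E)%E.

Definition orlicz_space Psi : set (R -> C) :=
  [set u | [/\ measurable_fun setT (fun t => complex.Re (u t)),
               measurable_fun setT (fun t => complex.Im (u t))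
             & exists c : R, 0 < c /\ (modular Psi c u < +oo)%E]].

Definition luxemburg_norm Psi u : \bar R :=
  ereal_inf [set c%:E | c in [set c : R | 0 < c /\ (modular Psi c u <= 1)%E]].

Definition hardy_orlicz Psi : set (disk R -> C) :=
  [set f | hardy 1 f /\ orlicz_space Psi (boundary f)].

Definition hardy_orlicz_norm Psi f : \bar R := luxemburg_norm Psi (boundary f).

End Hardy.

(* Main.v *)
(** Take phi z = 1 - sqrt (1 - z) / 2. With w = sqrt (1 - z) one has |Im w| <= Re w and
    1 - |phi|^2 >= Re w / 2, so 1 / (1 - |phi|^2) is dominated by 1 / |w|, whose circular
    means are at most 2 Re (1 / w)(0) = 2. Hence sum_n ||phi^n||^2 is finite: the operator
    is Hilbert-Schmidt on H^2, so it is in S_p for p >= 2. Its singular vectors are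
    obtained by maximizing ||T v|| successively over orthogonal complements.

    On H^Psi one tests the operator on f = y (h / (1 - (1 - h) z))^2 with h = 1 / Psi(y),
    whose norm is at most 1. The functions f o phi tend to 0 on the circle away from 1, so
    a limit of a subsequence would vanish. But |f o phi| >= y / 4 on an arc of length of
    order h^2 at 1, and along heights y with Psi(A y) >= delta Psi(y)^2 this keeps the
    norms of f o phi away from 0. *)
Require Import Defs.
From HB Require Import structures.
From mathcomp Require Import all_boot all_order all_algebra.
From mathcomp Require Import all_classical all_reals all_analysis measurable_realfun.
From mathcomp Require Import complex ring lra.

Set Implicit Arguments.
Unset Strict Implicit.
Unset Printing Implicit Defensive.

Import Order.TTheory GRing.Theory Num.Theory.
Import numFieldNormedType.Exports.

Local Open Scope classical_set_scope.
Local Open Scope ring_scope.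

(** The square root is what fits the hypothesis. It folds the half-plane [re (1 - z) > 0] into a
    sector, so [phi] meets the circle only at 1, non-tangentially, and [1 - |phi|] has the order of
    [|1 - z|^(1/2)]. The inverse of this is integrable, yet the points sent within [h] of 1 have
    measure of order [h^2], and [h = 1 / Psi(y)] turns this into the [Psi(y)^2] of the hypothesis.
    The factor 1/2 keeps [phi] in the disk: [1 - |1 - w / 2|^2 = Re w - |w|^2 / 4], where
    [|w|^2 <= 2 Re w]. The obstacle is the limit [g] in the compactness argument. It is only known
    to lie in H^1, and the norm of [f o phi - g] is that of one boundary function, defined by radial
    limits. Splitting it into the boundary functions of [f o phi] and of [g] takes Fatou's theorem
    for H^1, hence the path from Goursat's lemma through Poisson integrals. There an H^1 function is
    written as a bounded function times the fourth power of an H^2 function, by means of a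
    holomorphic majorant. *)

Lemma normr_sq (R : realType) (x : R) : `|x| ^+ 2 = x ^+ 2.
Proof. by rewrite real_normK ?num_real. Qed.

(** * Complex arithmetic with a real modulus, differentiability, the square root *)

Section ComplexBasics.
Variable R : realType.
Local Notation C := (Cplx R).
Local Notation re := (@complex.Re R).
Local Notation im := (@complex.Im R).
Implicit Types (z w : C) (F G q : C -> C).

Definition rc (x : R) : C := real_complex R x.
Definition cj (z : C) : C := conjc z.

Lemma cE z w : re z = re w -> im z = im w -> z = w.
Proof. by case: z w => [a b] [c d] /= -> ->. Qed.

Lemma reD z w : re (z + w) = re z + re w. Proof. by case: z w => [a b] [c d]. Qed.
Lemma imD z w : im (z + w) = im z + im w. Proof. by case: z w => [a b] [c d]. Qed.
Lemma reN z : re (- z) = - re z. Proof. by case: z => [a b]. Qed.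
Lemma imN z : im (- z) = - im z. Proof. by case: z => [a b]. Qed.
Lemma reM z w : re (z * w) = re z * re w - im z * im w.
Proof. by case: z w => [a b] [c d]. Qed.
Lemma imM z w : im (z * w) = re z * im w + im z * re w.
Proof. by case: z w => [a b] [c d]. Qed.
Lemma re_rc x : re (rc x) = x. Proof. by []. Qed.
Lemma im_rc x : im (rc x) = 0. Proof. by []. Qed.
Lemma re_cj z : re (cj z) = re z. Proof. by case: z. Qed.
Lemma im_cj z : im (cj z) = - im z. Proof. by case: z. Qed.
Lemma re0 : re (0 : C) = 0. Proof. by []. Qed.
Lemma im0 : im (0 : C) = 0. Proof. by []. Qed.
Lemma re1 : re (1 : C) = 1. Proof. by []. Qed.
Lemma im1 : im (1 : C) = 0. Proof. by []. Qed.

Definition reimE := (reD, imD, reN, imN, reM, imM, re_rc, im_rc, re_cj, im_cj,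
  re0, im0, re1, im1).

Lemma rcD x y : rc (x + y) = rc x + rc y.
Proof. by apply: cE; rewrite !reimE ?addr0. Qed.
Lemma rcN x : rc (- x) = - rc x.
Proof. by apply: cE; rewrite !reimE ?oppr0. Qed.
Lemma rcM x y : rc (x * y) = rc x * rc y.
Proof. by apply: cE; rewrite !reimE ?mulr0 ?mul0r ?subr0 ?addr0. Qed.
Lemma rc0 : rc 0 = 0. Proof. by []. Qed.
Lemma rc1 : rc 1 = 1. Proof. by []. Qed.
Lemma rcX x n : rc (x ^+ n) = rc x ^+ n.
Proof. by elim: n => [|n IH]; rewrite ?expr0 // !exprS rcM IH. Qed.

Lemma cjD z w : cj (z + w) = cj z + cj w.
Proof. by apply: cE; rewrite !reimE // opprD. Qed.
Lemma cjN z : cj (- z) = - cj z.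
Proof. by apply: cE; rewrite !reimE. Qed.
Lemma cjM z w : cj (z * w) = cj z * cj w.
Proof. by apply: cE; rewrite !reimE; ring. Qed.
Lemma cjK z : cj (cj z) = z.
Proof. by apply: cE; rewrite !reimE ?opprK. Qed.
Lemma cj_rc x : cj (rc x) = rc x.
Proof. by apply: cE; rewrite !reimE ?oppr0. Qed.
Lemma cjX z n : cj (z ^+ n) = cj z ^+ n.
Proof. by elim: n => [|n IH]; rewrite ?expr0 ?exprS ?cjM ?IH //; exact: cj_rc 1. Qed.
Lemma cj0 : cj 0 = 0. Proof. exact: cj_rc 0. Qed.

Lemma cmod_sqE z : cmod z ^+ 2 = re z ^+ 2 + im z ^+ 2.
Proof. by case: z => a b; rewrite /cmod /= sqr_sqrtr // addr_ge0 // sqr_ge0. Qed.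
Lemma cmod_ge0 z : 0 <= cmod z.
Proof. by case: z => a b; rewrite /cmod /= sqrtr_ge0. Qed.
Lemma cmodM z w : cmod (z * w) = cmod z * cmod w. Proof. exact: Normc.normcM. Qed.
Lemma cmodV z : cmod z^-1 = (cmod z)^-1. Proof. exact: Normc.normcV. Qed.
Lemma cmodN z : cmod (- z) = cmod z. Proof. by rewrite /cmod normcN. Qed.
Lemma cmodD z w : cmod (z + w) <= cmod z + cmod w. Proof. exact: le_normcD. Qed.
Lemma cmod0 : cmod (0 : C) = 0. Proof. exact: Normc.normc0. Qed.
Lemma cmod1 : cmod (1 : C) = 1. Proof. exact: Normc.normc1. Qed.
Lemma cmod_eq0 z : cmod z = 0 -> z = 0. Proof. exact: Normc.eq0_normc. Qed.
Lemma cmod_gt0 z : z != 0 -> 0 < cmod z.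
Proof.
by move=> z0; rewrite lt_neqAle cmod_ge0 andbT eq_sym; apply: contra z0 => /eqP/cmod_eq0 ->.
Qed.
Lemma cmod_rc x : cmod (rc x) = `|x|.
Proof. by rewrite /cmod /= expr0n addr0 sqrtr_sqr. Qed.
Lemma cmodX z n : cmod (z ^+ n) = cmod z ^+ n.
Proof. by elim: n => [|n IH]; rewrite ?expr0 ?cmod1 // !exprS cmodM IH. Qed.
Lemma cmod_cj z : cmod (cj z) = cmod z.
Proof. by case: z => a b; rewrite /cmod /= sqrrN. Qed.
Lemma cmodBC z w : cmod (z - w) = cmod (w - z).
Proof. by rewrite -cmodN opprB. Qed.
Lemma cmodB z w : cmod (z - w) <= cmod z + cmod w.
Proof. by rewrite -(cmodN w) cmodD. Qed.
Lemma cmodB_ge z w : cmod z - cmod w <= cmod (z - w).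
Proof. by rewrite lerBlDr; apply: le_trans (cmodD _ _); rewrite subrK. Qed.
Lemma abs_re z : `|re z| <= cmod z.
Proof.
rewrite -(@ler_pXn2r _ 2) ?nnegrE ?cmod_ge0 // cmod_sqE normr_sq.
by rewrite lerDl sqr_ge0.
Qed.
Lemma abs_im z : `|im z| <= cmod z.
Proof.
rewrite -(@ler_pXn2r _ 2) ?nnegrE ?cmod_ge0 // cmod_sqE normr_sq.
by rewrite lerDr sqr_ge0.
Qed.
Lemma re_le z : re z <= cmod z. Proof. exact: le_trans (ler_norm _) (abs_re z). Qed.
Lemma cmod_le z : cmod z <= `|re z| + `|im z|.
Proof.
rewrite -(@ler_pXn2r _ 2) ?nnegrE ?cmod_ge0 ?addr_ge0 // cmod_sqE.
by rewrite sqrrD !normr_sq lerD2r lerDl mulrn_wge0 // mulr_ge0.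
Qed.
Lemma mul_cj z : z * cj z = rc (cmod z ^+ 2).
Proof. by apply: cE; rewrite !reimE ?cmod_sqE; ring. Qed.
Lemma norm_cmod z : `|z| = rc (cmod z).
Proof. by rewrite normc_def /cmod; case: z. Qed.
Lemma rc_lt x y : ((rc x : C) < rc y) = (x < y).
Proof. exact: ltcR. Qed.
Lemma cmod_sum (I : Type) (r : seq I) (P : pred I) (f : I -> C) :
  cmod (\sum_(i <- r | P i) f i) <= \sum_(i <- r | P i) cmod (f i).
Proof.
elim/big_ind2: _ => //; first by rewrite cmod0.
by move=> a b c d h1 h2; apply: le_trans (cmodD _ _) _; exact: lerD.
Qed.
Lemma re_sum (I : Type) (r : seq I) (P : pred I) (f : I -> C) :
  re (\sum_(i <- r | P i) f i) = \sum_(i <- r | P i) re (f i).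
Proof. by elim/big_ind2: _ => // a b c d <- <-; rewrite reD. Qed.
Lemma im_sum (I : Type) (r : seq I) (P : pred I) (f : I -> C) :
  im (\sum_(i <- r | P i) f i) = \sum_(i <- r | P i) im (f i).
Proof. by elim/big_ind2: _ => // a b c d <- <-; rewrite imD. Qed.

Definition ccts F z := forall e : R, 0 < e ->
  exists2 d : R, 0 < d & forall w, cmod (w - z) < d -> cmod (F w - F z) < e.

(** Caratheodory's form of complex differentiability: [q z] is the derivative, and sums, products
    and compositions become algebra on the factors [q]. *)
Definition cder F z := exists2 q, ccts q z & forall w, F w - F z = q w * (w - z).

Lemma gt0_rc z : 0 < z -> exists2 x : R, 0 < x & z = rc x.
Proof.
case: z => a b h; have := h; rewrite ltcE /= => /andP[/eqP b0 a0].
by exists a => //; rewrite /rc b0.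
Qed.

Lemma derivable_cder F z : derivable F z 1 -> cder F z.
Proof.
move=> /cvg_ex[l Hl].
pose q w := if w == z then l else (F w - F z) / (w - z).
exists q; last first.
  move=> w; rewrite /q; case: eqP => [->|/eqP wz]; first by rewrite !subrr mulr0.
  by rewrite divfK // subr_eq0.
move=> e e0.
have e0' : (0 : C) < rc e by rewrite -rc0 rc_lt.
move/cvgrPdist_lt: Hl => /(_ _ e0').
rewrite near_withinE near_simpl => /nbhs_ballP[d /=].
move=> /gt0_rc[x x0 ->] H.
exists x => // w wz; rewrite /q eqxx; case: eqP => [_|/eqP wz']; first by rewrite subrr cmod0.
have := H (w - z); rewrite /ball /= sub0r normrN norm_cmod rc_lt => /(_ wz).
rewrite subr_eq0 => /(_ wz'); rewrite norm_cmod rc_lt cmodBC.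
by rewrite /GRing.scale /= mulr1 subrK mulrC.
Qed.

Lemma cder_derivable F z : cder F z -> derivable F z 1.
Proof.
move=> [q qc qE]; apply/cvg_ex; exists (q z).
apply/cvgrPdist_lt => e /gt0_rc[x x0 ->].
have [d d0 H] := qc _ x0.
rewrite near_withinE near_simpl; apply/nbhs_ballP; exists (rc d) => /=.
  by rewrite -rc0 rc_lt.
move=> h; rewrite /ball /= sub0r normrN norm_cmod rc_lt => hd h0.
rewrite norm_cmod rc_lt cmodBC /GRing.scale /= mulr1 qE addrK mulrCA mulVf // mulr1.
by apply: H; rewrite addrK.
Qed.

Lemma ccts_cst c z : ccts (fun=> c) z.
Proof. by move=> e e0; exists 1 => // w _; rewrite subrr cmod0. Qed.
Lemma ccts_id z : ccts id z.
Proof. by move=> e e0; exists e. Qed.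
Lemma cctsD F G z : ccts F z -> ccts G z -> ccts (fun w => F w + G w) z.
Proof.
move=> hF hG e e0; have e2 : 0 < e / 2 by lra.
have [d d0 H] := hF _ e2; have [d' d0' H'] := hG _ e2.
exists (Num.min d d'); first by rewrite lt_min d0.
move=> w; rewrite lt_min => /andP[/H h1 /H' h2].
rewrite opprD addrACA; apply: le_lt_trans (cmodD _ _) _; lra.
Qed.
Lemma ccts_comp F G z : ccts G z -> ccts F (G z) -> ccts (fun w => F (G w)) z.
Proof.
move=> hG hF e e0; have [d d0 H] := hF _ e0; have [d' d0' H'] := hG _ d0.
by exists d' => // w /H' /H.
Qed.
Lemma cctsM F G z : ccts F z -> ccts G z -> ccts (fun w => F w * G w) z.
Proof.
move=> hF hG e e0; pose M := cmod (F z) + cmod (G z) + 1.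
have M1 : 0 < M by rewrite /M; have := cmod_ge0 (F z); have := cmod_ge0 (G z); lra.
have e2 : 0 < Num.min 1 (e / (2 * M)) by rewrite lt_min ltr01 divr_gt0 //; lra.
have [d d0 H] := hF _ e2; have [d' d0' H'] := hG _ e2.
exists (Num.min d d'); first by rewrite lt_min d0.
move=> w; rewrite lt_min => /andP[/H + /H']; rewrite !lt_min => /andP[h1 h2] /andP[h3 h4].
have -> : F w * G w - F z * G z = (F w - F z) * (G w) + F z * (G w - G z) by ring.
have gw : cmod (G w) <= 1 + cmod (G z).
  by rewrite -(subrK (G z) (G w)); apply: le_trans (cmodD _ _) _; rewrite lerD2r ltW.
apply: le_lt_trans (cmodD _ _) _; rewrite !cmodM.
have -> : e = e / (2 * M) * M + M * (e / (2 * M)).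
  by field; rewrite gt_eqF.
have k0 : 0 < e / (2 * M) by rewrite divr_gt0 //; lra.
apply: ltr_leD.
  apply: le_lt_trans (_ : _ <= cmod (F w - F z) * M) _.
    by apply: (ler_wpM2l (cmod_ge0 _)); apply: le_trans gw _; rewrite /M; have := cmod_ge0 (F z); lra.
  by rewrite ltr_pM2r.
apply: ler_pM; rewrite ?cmod_ge0 //; last exact: ltW.
by rewrite /M; have := cmod_ge0 (G z); lra.
Qed.
Lemma ccts_near F G z (e : R) : 0 < e -> (forall w, cmod (w - z) < e -> F w = G w) ->
  ccts F z -> ccts G z.
Proof.
move=> e0 FG hF k k0; have [d d0 H] := hF _ k0.
exists (Num.min d e); first by rewrite lt_min d0.
move=> w; rewrite lt_min => /andP[h1 h2].
by rewrite -!FG ?H // subrr cmod0.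
Qed.
Lemma ccts_inv z : z != 0 -> ccts GRing.inv z.
Proof.
move=> z0 e e0; have m0 := cmod_gt0 z0.
exists (Num.min (cmod z / 2) (e * cmod z ^+ 2 / 2)).
  by rewrite lt_min !divr_gt0 // mulr_gt0 // exprn_gt0.
move=> w; rewrite lt_min => /andP[h1 h2].
have wm : cmod z / 2 <= cmod w.
  by have := cmodB_ge z (z - w); rewrite subKr cmodBC; lra.
have w0 : w != 0 by apply/eqP => w0; move: wm; rewrite w0 cmod0; lra.
have -> : w^-1 - z^-1 = (z - w) / (w * z) by field; rewrite z0 w0.
rewrite cmodM cmodV cmodM cmodBC ltr_pdivrMr; last by rewrite mulr_gt0 // cmod_gt0.
apply: lt_le_trans h2 _; rewrite -mulrA ler_pM2l // expr2 mulrAC.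
by rewrite ler_pM2r.
Qed.

Lemma cder_ccts F z : cder F z -> ccts F z.
Proof.
move=> [q qc qE].
have : ccts (fun w => q w * (w - z) + F z) z.
  apply: cctsD (ccts_cst _ _); apply: cctsM => //.
  exact: cctsD (ccts_id _) (ccts_cst _ _).
by apply: (@ccts_near _ _ _ 1) => // w _; rewrite -qE subrK.
Qed.

Lemma cder_near F G z (e : R) : 0 < e -> (forall w, cmod (w - z) < e -> F w = G w) ->
  cder F z -> cder G z.
Proof.
move=> e0 FG [q qc qE].
exists (fun w => if cmod (w - z) < e then q w else (G w - G z) / (w - z)).
  by apply: (@ccts_near q _ z e) => // w ->.
move=> w; case: ifP => h; first by rewrite -qE !FG // subrr cmod0.
rewrite divfK // subr_eq0; apply/eqP => wz; move: h; by rewrite wz subrr cmod0 e0.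
Qed.

Lemma cder_cst c z : cder (fun=> c) z.
Proof. by exists (fun=> 0); [exact: ccts_cst|move=> w; rewrite subrr mul0r]. Qed.
Lemma cder_id z : cder id z.
Proof. by exists (fun=> 1); [exact: ccts_cst|move=> w; rewrite mul1r]. Qed.
Lemma cderD F G z : cder F z -> cder G z -> cder (fun w => F w + G w) z.
Proof.
move=> [q qc qE] [p pc pE]; exists (fun w => q w + p w); first exact: cctsD.
by move=> w; rewrite mulrDl -qE -pE opprD addrACA.
Qed.
Lemma cderM F G z : cder F z -> cder G z -> cder (fun w => F w * G w) z.
Proof.
move=> hF hG; have [q qc qE] := hF; have [p pc pE] := hG.
exists (fun w => q w * G w + F z * p w).
  apply: cctsD; apply: cctsM => //; [exact: cder_ccts|exact: ccts_cst].
by move=> w; rewrite mulrDl mulrAC -qE -mulrA -pE; ring.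
Qed.
Lemma cder_comp F G z : cder G z -> cder F (G z) -> cder (fun w => F (G w)) z.
Proof.
move=> hG [q qc qE]; have [p pc pE] := hG.
exists (fun w => q (G w) * p w); last by move=> w; rewrite -mulrA -pE qE.
by apply: cctsM => //; apply: ccts_comp => //; exact: cder_ccts.
Qed.
Lemma cder_inv z : z != 0 -> cder GRing.inv z.
Proof.
move=> z0; apply: (@cder_near (fun w => if w == 0 then 0 else w^-1) _ _ (cmod z)).
- exact: cmod_gt0.
- by move=> w _; case: eqP => // ->; rewrite invr0.
(* The function takes the value 0 at [w = 0], so its quotient there is
   [(0 - z^-1) / (0 - z) = z^-2]. *)
exists (fun w => if w == 0 then z^-2 else - (w^-1 * z^-1)).
  apply: (@ccts_near (fun w => - 1 * (w^-1 * z^-1)) _ _ (cmod z)).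
  - exact: cmod_gt0.
  - by move=> w; case: eqP => [->|_ _]; rewrite ?sub0r ?cmodN ?ltxx // mulN1r.
  by apply: cctsM; [exact: ccts_cst|apply: cctsM; [exact: ccts_inv|exact: ccts_cst]].
move=> w; rewrite (negPf z0); case: eqP => [->|/eqP w0]; last by field; rewrite z0 w0.
by rewrite sub0r; field.
Qed.

Definition holo F := forall z, cmod z < 1 -> cder F z.

Definition csqrt (z : C) : C := sqrtc z.

Lemma csqrtK z : csqrt z ^+ 2 = z. Proof. exact: sqr_sqrtc. Qed.
Lemma re_csqrt_ge0 z : 0 <= re (csqrt z).
Proof. by case: z => a b; rewrite /csqrt /sqrtc /= sqrtr_ge0. Qed.
(** [re (w ^+ 2) = re w ^+ 2 - im w ^+ 2]: a root of a point of the right half-plane lies in the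
    sector [|arg| < pi / 4]. *)
Lemma im_csqrt_le z : 0 < re z -> `|im (csqrt z)| < re (csqrt z).
Proof.
move=> z0; rewrite -(@ltr_pXn2r _ 2) ?nnegrE ?re_csqrt_ge0 // normr_sq.
by rewrite -subr_gt0 !expr2 -reM -expr2 csqrtK.
Qed.
Lemma re_csqrt_gt0 z : 0 < re z -> 0 < re (csqrt z).
Proof. by move=> /im_csqrt_le; apply: le_lt_trans. Qed.
Lemma cmod_csqrt z : cmod (csqrt z) ^+ 2 = cmod z.
Proof. by rewrite -cmodX csqrtK. Qed.
(** [(csqrt w - csqrt z) * (csqrt w + csqrt z) = w - z], and the second factor has real part at
    least [re (csqrt z) > 0]. Its inverse is the quotient used in [cder_csqrt]. *)
Lemma ccts_csqrt z : 0 < re z -> ccts csqrt z.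
Proof.
move=> z0 e e0; have s0 := re_csqrt_gt0 z0.
exists (e * re (csqrt z)); first exact: mulr_gt0.
move=> w h.
have E : (csqrt w - csqrt z) * (csqrt w + csqrt z) = w - z.
  by rewrite -subr_sqr !csqrtK.
have h2 : re (csqrt z) <= cmod (csqrt w + csqrt z).
  by apply: le_trans (re_le _); rewrite reD lerDr re_csqrt_ge0.
rewrite -(ltr_pM2r s0); apply: le_lt_trans h; rewrite -E cmodM.
by apply: ler_wpM2l; rewrite ?cmod_ge0.
Qed.
Lemma cder_csqrt z : 0 < re z -> cder csqrt z.
Proof.
move=> z0; have s0 := re_csqrt_gt0 z0.
have n0 w : csqrt w + csqrt z != 0.
  apply/eqP => /(congr1 re); rewrite reD re0 => h.
  by have := re_csqrt_ge0 w; lra.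
exists (fun w => (csqrt w + csqrt z)^-1); last first.
  move=> w; have -> : w - z = (csqrt w - csqrt z) * (csqrt w + csqrt z).
    by rewrite -subr_sqr !csqrtK.
  by rewrite mulrCA mulVf // mulr1.
apply: (@ccts_comp GRing.inv (fun w => csqrt w + csqrt z)); last exact: ccts_inv.
by apply: cctsD; [exact: ccts_csqrt|exact: ccts_cst].
Qed.
Lemma cmod_re_sqrt2 z : `|im z| <= re z -> cmod z <= 2 * re z.
Proof. move=> h; apply: le_trans (cmod_le z) _.
by rewrite (ger0_norm (le_trans (normr_ge0 _) h)) mulr_natl mulr2n lerD2l.
Qed.

(** Puts a complex linear approximation into the shape of [lin_at]; the repeated coefficient [re w]
    is a Cauchy-Riemann equation. *)
Lemma re_lin z w (h k : R) : re (z - w * (h +i* k)%C) = re z - (re w * h + - im w * k).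
Proof. by case: z w => [a b] [c d] /=; ring. Qed.
Lemma im_lin z w (h k : R) : im (z - w * (h +i* k)%C) = im z - (im w * h + re w * k).
Proof. by case: z w => [a b] [c d] /=; ring. Qed.
Lemma re_expi t : re (expi t) = cos t. Proof. by []. Qed.
Lemma im_expi t : im (expi t) = sin t. Proof. by []. Qed.

End ComplexBasics.
Arguments cmod : simpl never.
Arguments rc : simpl never.
Arguments cj : simpl never.
Arguments csqrt : simpl never.
Arguments expi : simpl never.

(** * Goursat's bisection argument on a rectangle *)

Section Goursat.
Variable R : realType.
Implicit Types (f g : R -> R) (P Q : R -> R -> R).
Local Notation mu := (@lebesgue_measure R).

Definition itg f a b : R := (\int[mu]_(x in `[a, b]) f x)%R.
Definition cts_on f a b := forall x : R, a <= x <= b -> {for x, continuous f}.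

Lemma cts_on_integrable f a b : cts_on f a b -> mu.-integrable `[a, b] (EFin \o f).
Proof.
move=> h; apply: continuous_compact_integrable; first exact: segment_compact.
by apply: continuous_in_subspaceT => x; rewrite inE /= in_itv /= => /h.
Qed.

Lemma itg_split f a c b : a <= c <= b -> cts_on f a b ->
  itg f a b = itg f a c + itg f c b.
Proof.
move=> /andP[ac cb] h.
have hi := cts_on_integrable h.
have := @Rintegral_itvB R f (BLeft a) (BRight b) c hi.
rewrite !bnd_simp => /(_ ac cb) E.
have E2 : (\int[mu]_(x in `]c, b]) f x = itg f c b)%R.
  apply: (@Rintegral_itv_obnd_cbnd R c (BRight b) f).
  by apply: integrableS hi => //; apply: subset_itvr; rewrite bnd_simp.
by rewrite -E2 -E addrC subrK.
Qed.

Lemma cts_onB f g a b : cts_on f a b -> cts_on g a b -> cts_on (fun x => f x - g x) a b.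
Proof. by move=> hf hg x xab; apply: cvgB; [exact: hf|exact: hg]. Qed.

Lemma itgB f g a b : cts_on f a b -> cts_on g a b ->
  itg (fun x => f x - g x) a b = itg f a b - itg g a b.
Proof. by move=> hf hg; rewrite /itg RintegralB //; exact: cts_on_integrable. Qed.

Lemma itg_cst c a b : a <= b -> itg (fun=> c) a b = c * (b - a).
Proof.
move=> ab; rewrite /itg Rintegral_cst //= lebesgue_measure_itv /= lte_fin.
by case: ltgtP ab => // ->; rewrite subrr.
Qed.

Lemma le_itg f g a b : cts_on f a b -> cts_on g a b ->
  (forall x, a <= x <= b -> f x <= g x) -> itg f a b <= itg g a b.
Proof.
move=> hf hg fg; by apply: le_Rintegral => //; exact: cts_on_integrable.
Qed.

Lemma cts_on_cst c a b : cts_on (fun=> c) a b.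
Proof. by move=> x _; exact: cvg_cst. Qed.

Lemma itg_bound f a b c M : a <= b -> cts_on f a b ->
  (forall x, a <= x <= b -> `|f x - c| <= M) -> `|itg f a b - c * (b - a)| <= M * (b - a).
Proof.
move=> ab hf h.
have k1 : itg (fun=> c - M) a b <= itg f a b.
  by apply: le_itg => //; [exact: cts_on_cst|move=> x /h; rewrite ler_norml; lra].
have k2 : itg f a b <= itg (fun=> c + M) a b.
  by apply: le_itg => //; [exact: cts_on_cst|move=> x /h; rewrite ler_norml; lra].
move: k1 k2; rewrite !itg_cst // !mulrDl mulNr ler_norml; lra.
Qed.

(** Differentiability at a single point with gradient [(A, B)]: bisection only looks at the point to
    which the rectangles shrink. *)
Definition lin_at P x y A B := forall e : R, 0 < e -> exists2 d : R, 0 < d &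
  forall x' y', `|x' - x| < d -> `|y' - y| < d ->
  `|P x' y' - P x y - (A * (x' - x) + B * (y' - y))| <= e * (`|x' - x| + `|y' - y|).

Lemma lin_cts1 P x y A B : lin_at P x y A B -> {for x, continuous (fun t => P t y)}.
Proof.
move=> h; apply/cvgrPdist_le => e e0.
pose K := `|A| + 1.
have K0 : 0 < K by rewrite /K ltr_wpDl.
have [d d0 H] := h _ ltr01.
apply/nbhs_ballP; exists (Num.min d (e / K)) => /=; first by rewrite lt_min d0 divr_gt0.
move=> t; rewrite /ball /= distrC lt_min => /andP[h1 h2].
have := H t y h1; rewrite subrr normr0 mulr0 !addr0 mul1r => /(_ d0) h3.
rewrite distrC -(subrK (A * (t - x)) (P t y - P x y)).
apply: le_trans (ler_normD _ _) _; rewrite normrM.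
have : `|t - x| * K <= e by rewrite -ler_pdivlMr // ltW.
by rewrite /K; lra.
Qed.

Lemma lin_cts2 P x y A B : lin_at P x y A B -> {for y, continuous (fun t => P x t)}.
Proof.
move=> h; apply: (@lin_cts1 (fun u v => P v u) _ _ B A) => e /h[d d0 H].
exists d => // x' y' h1 h2; rewrite [B * _ + _]addrC [`|x' - y| + _]addrC.
exact: H.
Qed.

Section Rect.
Variables (P Q : R -> R -> R) (X0 X1 Y0 Y1 : R).
Hypothesis PQ : forall x y, X0 <= x <= X1 -> Y0 <= y <= Y1 ->
  exists A B D : R, lin_at P x y A B /\ lin_at Q x y D A.

(** The boundary integral that Green's formula equates with the integral of [P_x - Q_y]. In [PQ] the
    shared number [A] is both [P_x] and [Q_y]. *)
Definition flux x0 x1 y0 y1 : R :=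
  itg (fun y => P x1 y - P x0 y) y0 y1 - itg (fun x => Q x y1 - Q x y0) x0 x1.

Let ctsP x y0 y1 : X0 <= x <= X1 -> Y0 <= y0 -> y1 <= Y1 -> cts_on (P x) y0 y1.
Proof.
move=> hx h0 h1 y hy; have [|A [B [D [h _]]]] := PQ hx (y := y); first lra.
exact: lin_cts2 h.
Qed.
Let ctsQ y x0 x1 : Y0 <= y <= Y1 -> X0 <= x0 -> x1 <= X1 -> cts_on (Q^~ y) x0 x1.
Proof.
move=> hy h0 h1 x hx; have [|A [B [D [_ h]]]] := PQ (x := x) _ hy; first lra.
exact: lin_cts1 h.
Qed.

Lemma flux_quad x0 x1 x2 y0 y1 y2 :
  X0 <= x0 -> x0 <= x1 -> x1 <= x2 -> x2 <= X1 ->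
  Y0 <= y0 -> y0 <= y1 -> y1 <= y2 -> y2 <= Y1 ->
  flux x0 x2 y0 y2 = flux x0 x1 y0 y1 + flux x0 x1 y1 y2 + flux x1 x2 y0 y1 + flux x1 x2 y1 y2.
Proof.
move=> a0 a1 a2 a3 b0 b1 b2 b3.
have [p0 p1 p2] : [/\ X0 <= x0 <= X1, X0 <= x1 <= X1 & X0 <= x2 <= X1] by split; lra.
have [q0 q1 q2] : [/\ Y0 <= y0 <= Y1, Y0 <= y1 <= Y1 & Y0 <= y2 <= Y1] by split; lra.
have [y12 x12] : y0 <= y1 <= y2 /\ x0 <= x1 <= x2 by split; apply/andP.
have [y1' x1'] : y1 <= Y1 /\ x1 <= X1 by split; [case/andP: q1|case/andP: p1].
have [y1'' x1''] : Y0 <= y1 /\ X0 <= x1 by split; [case/andP: q1|case/andP: p1].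
by rewrite /flux !itgB ?(@itg_split (P x2) y0 y1 y2) ?(@itg_split (P x0) y0 y1 y2)
  ?(@itg_split (Q^~ y2) x0 x1 x2) ?(@itg_split (Q^~ y0) x0 x1 x2) //;
  first 1 [ring] || (try exact: ctsP); try exact: ctsQ.
Qed.

(** The affine parts contribute [A * (x1 - x0) * (y1 - y0)] to both integrals and cancel. Each
    integrand is left with two errors of size [e * s], where [s] is the half perimeter. *)
Lemma flux_small x y : X0 <= x <= X1 -> Y0 <= y <= Y1 -> forall e : R, 0 < e ->
  exists2 d : R, 0 < d & forall x0 x1 y0 y1,
    X0 <= x0 -> x0 <= x -> x <= x1 -> x1 <= X1 ->
    Y0 <= y0 -> y0 <= y -> y <= y1 -> y1 <= Y1 ->
    x1 - x0 < d -> y1 - y0 < d ->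
    `|flux x0 x1 y0 y1| <= 2 * e * (x1 - x0 + (y1 - y0)) ^+ 2.
Proof.
move=> hx hy e e0; have [A [B [D [hP hQ]]]] := PQ hx hy.
have [d d0 HP] := hP _ e0; have [d' d0' HQ] := hQ _ e0.
exists (Num.min d d'); first by rewrite lt_min d0.
move=> x0 x1 y0 y1 a0 a1 a2 a3 b0 b1 b2 b3; rewrite !lt_min => /andP[h1 h1'] /andP[h2 h2'].
set s := x1 - x0 + (y1 - y0).
have dist (u v w0 w1 : R) : w0 <= u <= w1 -> w0 <= v <= w1 -> `|u - v| <= w1 - w0.
  by rewrite ler_norml => h h'; lra.
have s1 u v : x0 <= u <= x1 -> y0 <= v <= y1 -> e * (`|u - x| + `|v - y|) <= e * s.
  move=> hu hv; rewrite ler_pM2l //; apply: lerD; apply: dist => //; lra.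
have E1 : `|itg (fun t => P x1 t - P x0 t) y0 y1 - A * (x1 - x0) * (y1 - y0)|
    <= (e * s + e * s) * (y1 - y0).
  apply: itg_bound; [lra|apply: cts_onB; apply: ctsP; lra|move=> t ht].
  have k u : x0 <= u <= x1 ->
    `|P u t - P x y - (A * (u - x) + B * (t - y))| <= e * s.
    move=> hu; apply: le_trans (s1 u t hu ht).
    by apply: HP; apply: le_lt_trans (dist _ _ _ _ _ _) _; try eassumption; lra.
  have [k1 k0] : x0 <= x1 <= x1 /\ x0 <= x0 <= x1 by split; lra.
  move: (k x1 k1) (k x0 k0); rewrite !ler_norml; lra.
have E2 : `|itg (fun t => Q t y1 - Q t y0) x0 x1 - A * (y1 - y0) * (x1 - x0)|
    <= (e * s + e * s) * (x1 - x0).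
  apply: itg_bound; [lra|apply: cts_onB; apply: ctsQ; lra|move=> t ht].
  have k u : y0 <= u <= y1 ->
    `|Q t u - Q x y - (D * (t - x) + A * (u - y))| <= e * s.
    move=> hu; apply: le_trans (s1 t u ht hu).
    by apply: HQ; apply: le_lt_trans (dist _ _ _ _ _ _) _; try eassumption; lra.
  have [k1 k0] : y0 <= y1 <= y1 /\ y0 <= y0 <= y1 by split; lra.
  move: (k y1 k1) (k y0 k0); rewrite !ler_norml; lra.
rewrite /flux.
have -> : 2 * e * s ^+ 2 = (e * s + e * s) * (x1 - x0) + (e * s + e * s) * (y1 - y0).
  by rewrite /s; ring.
move: E1 E2; rewrite !ler_norml; lra.
Qed.

Hypotheses (X01 : X0 <= X1) (Y01 : Y0 <= Y1).

Let w n : R := (X1 - X0) / 2 ^+ n.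
Let v n : R := (Y1 - Y0) / 2 ^+ n.
Let wS n : w n = w n.+1 + w n.+1. Proof. by rewrite /w exprS; field. Qed.
Let vS n : v n = v n.+1 + v n.+1. Proof. by rewrite /v exprS; field. Qed.
Let w_ge0 n : 0 <= w n. Proof. by rewrite /w divr_ge0 ?exprn_ge0 ?subr_ge0. Qed.
Let v_ge0 n : 0 <= v n. Proof. by rewrite /v divr_ge0 ?exprn_ge0 ?subr_ge0. Qed.

Let bad (eta : R) n (z : R * R) :=
  [/\ X0 <= z.1, z.1 + w n <= X1, Y0 <= z.2, z.2 + v n <= Y1 &
   eta / 4 ^+ n <= `|flux z.1 (z.1 + w n) z.2 (z.2 + v n)|].

(** The flux is the sum over the four quarters, so one of them carries at least a fourth of it. *)
Let bad_next eta n z : bad eta n z -> exists z', [/\ bad eta n.+1 z',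
  z.1 <= z'.1, z'.1 + w n.+1 <= z.1 + w n, z.2 <= z'.2 & z'.2 + v n.+1 <= z.2 + v n].
Proof.
case: z => x y [/= a0 a1 b0 b1].
have [hw hv] := (w_ge0 n.+1, v_ge0 n.+1); move: a1 b1; rewrite wS vS => a1 b1.
rewrite (@flux_quad x (x + w n.+1) _ y (y + v n.+1)); try lra.
rewrite (addrA y (v _) (v _)) (addrA x (w _) (w _)).
set f1 := flux x _ y (y + v n.+1); set f2 := flux x _ (y + v n.+1) _.
set f3 := flux _ _ y (y + v n.+1); set f4 := flux _ _ (y + v n.+1) _.
move=> h.
have q4 : eta / 4 ^+ n = 4 * (eta / 4 ^+ n.+1) by rewrite exprS; field.
have tri : `|f1 + f2 + f3 + f4| <= `|f1| + `|f2| + `|f3| + `|f4|.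
  apply: le_trans (ler_normD _ _) _; rewrite lerD2r.
  by apply: le_trans (ler_normD _ _) _; rewrite lerD2r ler_normD.
have [h1|h1] := leP (eta / 4 ^+ n.+1) `|f1|; first by exists (x, y); do !split => //=; lra.
have [h2|h2] := leP (eta / 4 ^+ n.+1) `|f2|.
  by exists (x, y + v n.+1); do !split => //=; lra.
have [h3|h3] := leP (eta / 4 ^+ n.+1) `|f3|.
  by exists (x + w n.+1, y); do !split => //=; lra.
have [h4|h4] := leP (eta / 4 ^+ n.+1) `|f4|; last by exfalso; lra.
by exists (x + w n.+1, y + v n.+1); do !split => //=; lra.
Qed.

Lemma nested_point (a l : nat -> R) : (forall n, a n <= a n.+1) ->
  (forall n, a n.+1 + l n.+1 <= a n + l n) -> (forall n, 0 <= l n) ->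
  exists p, forall n, a n <= p <= a n + l n.
Proof.
move=> h1 h2 l0.
have mono m k : a m <= a (m + k)%N.
  by elim: k => [|k IH]; rewrite ?addn0 // addnS; exact: le_trans IH (h1 _).
have mono' m k : a (m + k)%N + l (m + k)%N <= a m + l m.
  by elim: k => [|k IH]; rewrite ?addn0 // addnS; exact: le_trans (h2 _) IH.
have ub m n : a m <= a n + l n.
  have [mn|/ltnW nm] := leqP m n.
    by rewrite -(subnKC mn); apply: le_trans (mono m (n - m)%N) _; rewrite lerDl.
  by rewrite -(subnKC nm); apply: le_trans (mono' n (m - n)%N); rewrite lerDl.
exists (sup (range a)) => n; apply/andP; split.
  apply: ub_le_sup; last by exists n.
  by exists (a 0%N + l 0%N) => _ [m _ <-].
by apply: ge_sup; [exists (a 0%N), 0%N|move=> _ [m _ <-]].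
Qed.

Lemma flux_eq0 : flux X0 X1 Y0 Y1 = 0.
Proof.
apply/eqP/negPn/negP => F0; pose eta := `|flux X0 X1 Y0 Y1|.
have eta0 : 0 < eta by rewrite normr_gt0.
(* [next] has to be total, so it returns [z] when there is no bad quarter; [badZ] shows that this
   case never occurs. *)
pose next n z := match pselect (exists z', [/\ bad eta n.+1 z',
  z.1 <= z'.1, z'.1 + w n.+1 <= z.1 + w n, z.2 <= z'.2 & z'.2 + v n.+1 <= z.2 + v n]) with
  | left h => sval (cid h) | right _ => z end.
pose fix Z n := if n is k.+1 then next k (Z k) else (X0, Y0).
have badZ n : bad eta n (Z n).
  elim: n => [|n IH].
    rewrite /bad /Z /w /v /= expr0 !divr1 !subrKC; split => //; lra.
  rewrite /= /next; case: pselect => h; last by case: h; exact: bad_next.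
  by case: cid => z' [].
have stepZ n : [/\ (Z n).1 <= (Z n.+1).1, (Z n.+1).1 + w n.+1 <= (Z n).1 + w n,
  (Z n).2 <= (Z n.+1).2 & (Z n.+1).2 + v n.+1 <= (Z n).2 + v n].
  rewrite /= /next; case: pselect => h; last by case: h; exact: bad_next (badZ n).
  by case: cid => z' [].
have [p Hp] : exists p, forall n, (Z n).1 <= p <= (Z n).1 + w n.
  by apply: (@nested_point (fun n => (Z n).1)) => // n; have [] := stepZ n.
have [q Hq] : exists p, forall n, (Z n).2 <= p <= (Z n).2 + v n.
  by apply: (@nested_point (fun n => (Z n).2)) => // n; have [] := stepZ n.
have hp : X0 <= p <= X1 by have := Hp 0%N; rewrite /w /= expr0 divr1; lra.
have hq : Y0 <= q <= Y1 by have := Hq 0%N; rewrite /v /= expr0 divr1; lra.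
pose S := X1 - X0 + (Y1 - Y0).
have S0 : 0 <= S by rewrite /S; lra.
(* With this [e], [flux_small] bounds the flux of the n-th rectangle by [eta / 4 ^+ n] times
   [S ^+ 2 / (2 * (S ^+ 2 + 1)) < 1], against [badZ]. *)
have e0 : 0 < eta / (4 * (S ^+ 2 + 1)) by rewrite divr_gt0 // mulr_gt0 // ltr_wpDl // sqr_ge0.
have [d d0 H] := flux_small hp hq e0.
have [n hn] : exists n, S / 2 ^+ n < d.
  have := @cvg_geometric R S 2^-1; rewrite ger0_norm ?invf_lt1 ?invr_ge0 // ltr1n => /(_ isT).
  move=> /cvgrPdist_lt /(_ _ d0) [n _ hn]; exists n.
  have := hn n (leqnn n); rewrite /geometric /= sub0r normrN exprVn.
  by move=> h; apply: le_lt_trans h; exact: ler_norm.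
have wn : w n <= S / 2 ^+ n by rewrite /w ler_pM2r ?invr_gt0 ?exprn_gt0 // /S; lra.
have vn : v n <= S / 2 ^+ n by rewrite /v ler_pM2r ?invr_gt0 ?exprn_gt0 // /S; lra.
have [a0 a1 b0 b1 h] := badZ n.
have := H (Z n).1 ((Z n).1 + w n) (Z n).2 ((Z n).2 + v n) a0.
have := Hp n; have := Hq n => /andP[q1 q2] /andP[p1 p2].
have addKl (x y : R) : x + y - x = y by ring.
move=> /(_ p1 p2 a1 b0 q1 q2 b1); rewrite !addKl.
move=> /(_ (le_lt_trans wn hn) (le_lt_trans vn hn)) /(le_trans h).
have -> : w n + v n = S / 2 ^+ n by rewrite /w /v /S; ring.
rewrite expr_div_n -exprM mulnC exprM (_ : 2 ^+ 2 = 4 :> R); last by ring.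
rewrite mulrA ler_pM2r ?invr_gt0 ?exprn_gt0 //.
apply/negP; rewrite -ltNge.
have S1 : 0 < S ^+ 2 + 1 by rewrite ltr_wpDl // sqr_ge0.
have -> : 2 * (eta / (4 * (S ^+ 2 + 1))) * S ^+ 2 = eta * (S ^+ 2 / (2 * (S ^+ 2 + 1))).
  by field; rewrite gt_eqF.
rewrite gtr_pMr // ltr_pdivrMr; lra.
Qed.

End Rect.
End Goursat.

(** * Integrals over the circle and the constancy of circular means *)

Section CircleIntegral.
Variable R : realType.
Local Notation C := (Cplx R).
Local Notation re := (@complex.Re R).
Local Notation im := (@complex.Im R).
Local Notation m := (uniform_prob (two_pi_gt0 R)).
Local Notation mu := (@lebesgue_measure R).
Implicit Types (f g : R -> R) (u v : R -> C) (F G : C -> C).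

Definition ri f := m.-integrable setT (EFin \o f).
Definition RI f : R := (\int[m]_t f t)%R.

Lemma m_integral_lebesgue f : measurable_fun setT f -> mu.-integrable `[0, 2 * pi] (EFin \o f) ->
  (\int[m]_t (f t)%:E = (2 * pi)^-1%:E * \int[mu]_(t in `[0%R, (2 * pi)%R]) (f t)%:E)%E.
Proof.
move=> mf fi; have mf' : measurable_fun setT (EFin \o f) by exact/measurable_EFinP.
rewrite integralE [in RHS]integralE muleBr //; last first.
  by apply: fin_num_adde_defr; apply: integrable_pos_fin_num.
have := integral_uniform (two_pi_gt0 R).
rewrite subr0 => H; congr (_ - _)%E; rewrite H //.
  exact: measurable_funepos.
exact: measurable_funeneg.
Qed.

Lemma ri_lebesgue f : measurable_fun setT f -> mu.-integrable `[0, 2 * pi] (EFin \o f) -> ri f.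
Proof.
move=> mf fi; have mf' : measurable_fun setT (EFin \o f) by exact/measurable_EFinP.
apply/integrableP; split => //.
rewrite (@integral_uniform _ _ _ (two_pi_gt0 R)) //; last exact: measurableT_comp.
rewrite lte_mul_pinfty ?lee_fin ?invr_ge0 ?subr0 //; first by rewrite ltW ?two_pi_gt0.
by case/integrableP: fi.
Qed.

Lemma ri_cont f : continuous f -> ri f.
Proof.
move=> cf; apply: ri_lebesgue; first exact: continuous_measurable_fun.
by apply: cts_on_integrable => x _; exact: cf.
Qed.

Lemma RI_itg f : continuous f -> RI f = (2 * pi)^-1 * itg f 0 (2 * pi).
Proof.
move=> cf; have fi : mu.-integrable `[0, 2 * pi] (EFin \o f).
  by apply: cts_on_integrable => x _; exact: cf.
rewrite /RI /Rintegral m_integral_lebesgue //; last exact: continuous_measurable_fun.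
by rewrite fineM //; exact: integrable_fin_num.
Qed.

Lemma riD f g : ri f -> ri g -> ri (fun t => f t + g t).
Proof. by move=> hf hg; exact: (integrableD measurableT hf hg). Qed.
Lemma riZ k f : ri f -> ri (fun t => k * f t).
Proof. by move=> hf; exact: (integrableZl measurableT k hf). Qed.
Lemma riN f : ri f -> ri (fun t => - f t).
Proof. by move=> hf; exact: (integrableN hf). Qed.
Lemma riB f g : ri f -> ri g -> ri (fun t => f t - g t).
Proof. by move=> hf hg; apply: riD => //; exact: riN. Qed.
Lemma ri_cst k : ri (fun=> k).
Proof. by apply: ri_cont => x; exact: cvg_cst. Qed.
Lemma ri_le f g : measurable_fun setT f -> (forall t, `|f t| <= g t) -> ri g -> ri f.
Proof.
move=> mf fg gi; apply: le_integrable gi => //; first exact/measurable_EFinP.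
by move=> x _ /=; rewrite lee_fin; apply: le_trans (fg x) _; exact: ler_norm.
Qed.
Lemma ri_meas f : ri f -> measurable_fun setT f.
Proof. by case/integrableP => /measurable_EFinP. Qed.

Lemma RID f g : ri f -> ri g -> RI (fun t => f t + g t) = RI f + RI g.
Proof. by move=> *; exact: RintegralD. Qed.
Lemma RIZ k f : ri f -> RI (fun t => k * f t) = k * RI f.
Proof. by move=> *; exact: RintegralZl. Qed.
Lemma RIB f g : ri f -> ri g -> RI (fun t => f t - g t) = RI f - RI g.
Proof. by move=> *; exact: RintegralB. Qed.
Lemma RIN f : ri f -> RI (fun t => - f t) = - RI f.
Proof.
by move=> hf; rewrite -[RHS]mulN1r -RIZ //; apply: eq_Rintegral => t _; rewrite mulN1r.
Qed.
Lemma RI_cst k : RI (fun=> k) = k.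
Proof. rewrite /RI Rintegral_cst //.
rewrite -[RHS]mulr1; congr (_ * _).
exact: (congr1 fine (@probability_setT _ _ _ m)). Qed.
Lemma le_RI f g : ri f -> ri g -> (forall t, f t <= g t) -> RI f <= RI g.
Proof. by move=> hf hg fg; apply: le_Rintegral. Qed.
Lemma RI_ge0 f : (forall t, 0 <= f t) -> 0 <= RI f.
Proof. by move=> h; exact: Rintegral_ge0. Qed.
Lemma eq_RI f g : (forall t, f t = g t) -> RI f = RI g.
Proof. by move=> h; apply: eq_Rintegral => t _; exact: h. Qed.
Lemma RI_sum n (f : nat -> R -> R) : (forall i, ri (f i)) ->
  ri (fun t => \sum_(i < n) f i t) /\ RI (fun t => \sum_(i < n) f i t) = \sum_(i < n) RI (f i).
Proof.
move=> h; elim: n => [|n [IH1 IH2]].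
  split; first by under eq_fun do rewrite big_ord0; exact: ri_cst.
  rewrite big_ord0; transitivity (RI (fun=> 0)); last exact: RI_cst.
  by apply: eq_RI => t; rewrite big_ord0.
under eq_fun do rewrite big_ord_recr /=.
by split; [exact: riD|rewrite RID // big_ord_recr /= IH2].
Qed.

Definition cint u := ri (fun t => re (u t)) /\ ri (fun t => im (u t)).
Definition CI u : C := circle_integral u.

Lemma re_CI u : re (CI u) = RI (fun t => re (u t)). Proof. by []. Qed.
Lemma im_CI u : im (CI u) = RI (fun t => im (u t)). Proof. by []. Qed.
Lemma eq_CI u v : (forall t, u t = v t) -> CI u = CI v.
Proof. by move=> h; congr CI; apply/funext. Qed.
Lemma cintD u v : cint u -> cint v -> cint (fun t => u t + v t).
Proof.
case=> u1 u2 [v1 v2]; split; [under eq_fun do rewrite reD|under eq_fun do rewrite imD];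
  exact: riD.
Qed.
Lemma CID u v : cint u -> cint v -> CI (fun t => u t + v t) = CI u + CI v.
Proof.
case=> u1 u2 [v1 v2]; apply: cE; rewrite ?reD ?imD ?re_CI ?im_CI -RID //; apply: eq_RI => t;
  by rewrite ?reD ?imD.
Qed.
Lemma cintZ c u : cint u -> cint (fun t => c * u t).
Proof.
case=> u1 u2; split; [under eq_fun do rewrite reM|under eq_fun do rewrite imM].
  by apply: riB; exact: riZ.
by apply: riD; exact: riZ.
Qed.
Lemma CIZ c u : cint u -> CI (fun t => c * u t) = c * CI u.
Proof.
case=> u1 u2; apply: cE; rewrite ?reM ?imM ?re_CI ?im_CI -!RIZ // -?RIB -?RID;
  try exact: riZ; by apply: eq_RI => t; rewrite ?reM ?imM.
Qed.
Lemma cintN u : cint u -> cint (fun t => - u t).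
Proof. by move=> h; under eq_fun do rewrite -mulN1r; exact: cintZ. Qed.
Lemma CIN u : cint u -> CI (fun t => - u t) = - CI u.
Proof. by move=> h; under eq_fun do rewrite -mulN1r; rewrite CIZ // mulN1r. Qed.
Lemma cintB u v : cint u -> cint v -> cint (fun t => u t - v t).
Proof. by move=> *; apply: cintD => //; exact: cintN. Qed.
Lemma CIB u v : cint u -> cint v -> CI (fun t => u t - v t) = CI u - CI v.
Proof. by move=> *; rewrite CID ?CIN //; exact: cintN. Qed.
Lemma cint_cst c : cint (fun=> c). Proof. by split; exact: ri_cst. Qed.
Lemma CI_cst c : CI (fun=> c) = c.
Proof. by apply: cE; rewrite ?re_CI ?im_CI RI_cst. Qed.
Lemma cint_cj u : cint u -> cint (fun t => cj (u t)).
Proof.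
case=> u1 u2; split; [under eq_fun do rewrite re_cj|under eq_fun do rewrite im_cj] => //.
exact: riN.
Qed.
Lemma CI_cj u : cint u -> CI (fun t => cj (u t)) = cj (CI u).
Proof.
case=> u1 u2; apply: cE; rewrite ?re_cj ?im_cj ?re_CI ?im_CI -?RIN //; apply: eq_RI => t;
  by rewrite ?re_cj ?im_cj.
Qed.

Lemma measurable_cmod u : measurable_fun setT (fun t => re (u t)) ->
  measurable_fun setT (fun t => im (u t)) -> measurable_fun setT (fun t => cmod (u t)).
Proof.
move=> h1 h2.
have -> : (fun t => cmod (u t)) = @Num.sqrt R \o (fun t => re (u t) ^+ 2 + im (u t) ^+ 2).
  by apply/funext => t /=; rewrite -cmod_sqE sqrtr_sqr ger0_norm // cmod_ge0.
apply: measurableT_comp.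
  by apply: continuous_measurable_fun; exact: sqrt_continuous.
by apply: measurable_funD; exact: measurable_funX.
Qed.

Lemma cint_le u g : measurable_fun setT (fun t => re (u t)) ->
  measurable_fun setT (fun t => im (u t)) -> (forall t, cmod (u t) <= g t) -> ri g -> cint u.
Proof.
move=> h1 h2 h gi; split; apply: ri_le gi => // t; apply: le_trans (h t).
  exact: abs_re.
exact: abs_im.
Qed.

Lemma ri_cmod u : cint u -> ri (fun t => cmod (u t)).
Proof.
case=> h1 h2; apply: (@ri_le _ (fun t => `|re (u t)| + `|im (u t)|)).
- by apply: measurable_cmod; exact: ri_meas.
- by move=> t; rewrite ger0_norm ?cmod_ge0 // cmod_le.
- by apply: riD; [exact: integrable_norm h1|exact: integrable_norm h2].
Qed.

(** Multiplication by [cj (CI u)] makes the integral real and nonnegative, so that monotonicity of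
    real integrals applies. *)
Lemma cmod_CI u : cint u -> cmod (CI u) <= RI (fun t => cmod (u t)).
Proof.
move=> hu; have [->|n0] := eqVneq (CI u) 0; first by rewrite cmod0 RI_ge0 // => t; exact: cmod_ge0.
have p0 := cmod_gt0 n0.
rewrite -(ler_pM2l p0) -expr2 -(re_rc (_ ^+ 2)) -mul_cj mulrC -CIZ // re_CI -RIZ; last exact: ri_cmod.
apply: le_RI => [||t]; [by case: (cintZ (cj (CI u)) hu)|by apply: riZ; exact: ri_cmod|].
by apply: le_trans (re_le _) _; rewrite cmodM cmod_cj.
Qed.

Definition ccont u := forall t (e : R), 0 < e ->
  exists2 d : R, 0 < d & forall s, `|s - t| < d -> cmod (u s - u t) < e.

Lemma continuous_near f : (forall t (e : R), 0 < e ->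
  exists2 d : R, 0 < d & forall s, `|s - t| < d -> `|f s - f t| < e) -> continuous f.
Proof.
move=> h t; apply/cvgrPdist_lt => e /(h t)[d d0 H]; apply/nbhs_ballP; exists d => //= s.
by rewrite /ball /= distrC => /H; rewrite distrC.
Qed.
Lemma ccont_re u : ccont u -> continuous (fun t => re (u t)).
Proof.
move=> h; apply: continuous_near => t e /(h t)[d d0 H]; exists d => // s /H.
by apply: le_lt_trans; rewrite -reN -reD abs_re.
Qed.
Lemma ccont_im u : ccont u -> continuous (fun t => im (u t)).
Proof.
move=> h; apply: continuous_near => t e /(h t)[d d0 H]; exists d => // s /H.
by apply: le_lt_trans; rewrite -imN -imD abs_im.
Qed.
Lemma ccont_cint u : ccont u -> cint u.
Proof. by move=> h; split; apply: ri_cont; [exact: ccont_re|exact: ccont_im]. Qed.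
Lemma ccont_cst (c : C) : ccont (fun=> c).
Proof. by move=> t e e0; exists 1 => // s _; rewrite subrr cmod0. Qed.
Lemma ccont_ccts F u : ccont u -> (forall t, ccts F (u t)) -> ccont (fun t => F (u t)).
Proof.
move=> hu hF t e /(hF t)[d d0 H]; have [d' d0' H'] := hu t _ d0.
by exists d' => // s /H' /H.
Qed.
Lemma ccontZ c u : ccont u -> ccont (fun t => c * u t).
Proof.
move=> h; apply: (@ccont_ccts (fun z => c * z)) => // t.
by apply: cctsM; [exact: ccts_cst|exact: ccts_id].
Qed.
Lemma ccont_cj u : ccont u -> ccont (fun t => cj (u t)).
Proof.
move=> h t e /(h t)[d d0 H]; exists d => // s /H.
by rewrite -cjN -cjD cmod_cj.
Qed.
Lemma ccontX n u : ccont u -> ccont (fun t => u t ^+ n).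
Proof.
move=> h; apply: (@ccont_ccts (fun z => z ^+ n)) => // t.
elim: n => [|n IH]; first exact: ccts_cst.
by under eq_fun do rewrite exprS; apply: cctsM => //; exact: ccts_id.
Qed.
Lemma ccontD u v : ccont u -> ccont v -> ccont (fun t => u t + v t).
Proof.
move=> hF hG t e e0; have e2 : 0 < e / 2 by rewrite divr_gt0.
have [d d0 H] := hF t _ e2; have [d' d0' H'] := hG t _ e2.
exists (Num.min d d'); first by rewrite lt_min d0.
move=> w; rewrite lt_min => /andP[/H h1 /H' h2].
rewrite opprD addrACA; apply: le_lt_trans (cmodD _ _) _; lra.
Qed.
(** Polarization expresses [u * v] through squares, and squaring is composition with one continuous
    map. *)
Lemma ccontM u v : ccont u -> ccont v -> ccont (fun t => u t * v t).
Proof.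
move=> hu hv.
have sq w : ccont w -> ccont (fun t => w t * w t).
  by move=> hw; under eq_fun do rewrite -expr2; exact: ccontX.
have -> : (fun t => u t * v t) = (fun t => 2^-1 * ((u t + v t) * (u t + v t) +
    (-1) * (u t * u t + v t * v t))).
  apply/funext => t; have two0 : (2 : C) != 0 by rewrite pnatr_eq0.
  by apply: (mulfI two0); rewrite (mulrA 2 2^-1) divff // mul1r; ring.
apply: ccontZ; apply: ccontD; first by apply: sq; exact: ccontD.
by apply: ccontZ; apply: ccontD; exact: sq.
Qed.
Lemma ccont_cmod u : ccont u -> continuous (fun t => cmod (u t)).
Proof.
move=> h; apply: continuous_near => t e /(h t)[d d0 H]; exists d => // s /H.
apply: le_lt_trans; rewrite ler_norml.
have := cmodB_ge (u s) (u t); have := cmodB_ge (u t) (u s); rewrite (cmodBC (u t)); lra.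
Qed.
Lemma ccont_rc f : continuous f -> ccont (fun t => rc (f t)).
Proof.
move=> h t e e0; have /cvgrPdist_lt /(_ _ e0) /nbhs_ballP[d /= d0 H] := h t.
exists d => // s; rewrite distrC => /H /=; rewrite distrC.
by rewrite -rcN -rcD cmod_rc.
Qed.

Lemma ccont_expi : ccont (@expi R).
Proof.
have -> : @expi R = (fun t => rc (cos t) + (0 +i* 1) * rc (sin t))%C.
  by apply/funext => t; apply: cE; rewrite !reimE ?re_expi ?im_expi /= ?mul0r ?mul1r ?mulr0 ?subr0 ?addr0 ?add0r.
apply: ccontD; last apply: ccontZ; apply: ccont_rc; [exact: continuous_cos|exact: continuous_sin].
Qed.

Lemma expiD s t : expi (s + t) = expi s * expi t :> C.
Proof. by apply: cE; rewrite !reimE ?re_expi ?im_expi ?cosD ?sinD; ring. Qed.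
Lemma cmod_expi t : cmod (expi t) = 1 :> R.
Proof.
by rewrite -[LHS]ger0_norm ?cmod_ge0 // -sqrtr_sqr cmod_sqE re_expi im_expi cos2Dsin2 sqrtr1.
Qed.
Lemma expi0 : expi 0 = 1 :> C.
Proof. by rewrite /expi cos0 sin0. Qed.
Lemma expi_neq0 t : expi t != 0 :> C.
Proof. by apply/eqP => /(congr1 (@cmod R)) /eqP; rewrite cmod_expi cmod0 oner_eq0. Qed.
Lemma expi_cj t : cj (expi t) = (expi t)^-1 :> C.
Proof.
apply: (mulfI (expi_neq0 t)); rewrite mul_cj cmod_expi expr1n divff //; exact: expi_neq0.
Qed.
Lemma expi2pi : expi (2 * pi) = 1 :> C.
Proof. by rewrite /expi mulr_natl cos2pi sin2pi. Qed.

Lemma is_derive_small f a x : is_derive x (1 : R) f a -> forall e : R, 0 < e ->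
  exists2 d : R, 0 < d & forall h, `|h| < d -> `|f (x + h) - f x - a * h| <= e * `|h|.
Proof.
move=> /is_derive1_caratheodory[g [gE gc <-]] e e0.
have /cvgrPdist_lt /(_ _ e0) /nbhs_ballP[d /= d0 H] := gc.
exists d => // h hd; rewrite gE (addrC x h) addrK -mulrBl normrM.
apply: ler_wpM2r => //; apply/ltW; rewrite distrC; apply: H.
by rewrite /ball /= opprD addrCA subrr addr0 normrN.
Qed.

(** Combines the derivatives of [expR], [cos] and [sin] at 0 into that of the complex exponential,
    the change of variables in [polar]. *)
Lemma polar_small (e : R) : 0 < e -> exists2 d : R, 0 < d & forall h k : R, `|h| < d -> `|k| < d ->
  cmod (rc (expR h) * expi k - 1 - (h +i* k)%C) <= e * (`|h| + `|k|).
Proof.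
(* The real and imaginary errors below add up to [5 * b * |h| + 3 * b * |k|], hence the 6. *)
move=> e0; have [b [b0 b1 be]] : exists b : R, [/\ 0 < b, b <= 1 & 6 * b <= e].
  exists (Num.min 1 (e / 6)); rewrite lt_min ltr01 divr_gt0 // ge_min lexx; split=> //.
  by rewrite mulrC -ler_pdivlMr // ge_min lexx orbT.
have [d1 d10 H1] := is_derive_small (is_derive_expR 0) b0.
have [d2 d20 H2] := is_derive_small (is_derive_cos 0) b0.
have [d3 d30 H3] := is_derive_small (is_derive_sin 0) b0.
exists (Num.min b (Num.min d1 (Num.min d2 d3))); first by rewrite !lt_min b0 d10 d20 d30.
move=> h k; rewrite !lt_min => /and4P[hb h1 _ _] /and4P[kb _ k2 k3].
move: (H1 _ h1) (H2 _ k2) (H3 _ k3).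
rewrite !add0r expR0 cos0 sin0 oppr0 mul0r !subr0 !mul1r ?addr0 => E1 E2 E3.
have [a0 c0] := (normr_ge0 h, normr_ge0 k).
have Rp : `|expR h * cos k - 1 - h| <= b * `|h| + 2 * (b * `|k|).
  have -> : expR h * cos k - 1 - h = (expR h - 1 - h) * cos k + (1 + h) * (cos k - 1) by ring.
  apply: le_trans (ler_normD _ _) _; rewrite !normrM; apply: lerD.
    by apply: le_trans E1; rewrite ler_piMr // cos_max.
  apply: ler_pM => //; apply: le_trans (ler_normD _ _) _; rewrite normr1; lra.
have Ip : `|expR h * sin k - k| <= 4 * (b * `|h|) + b * `|k|.
  have -> : expR h * sin k - k = (expR h - 1) * sin k + (sin k - k) by ring.
  apply: le_trans (ler_normD _ _) _; apply: lerD; last exact: E3.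
  rewrite normrM.
  have F1 : `|expR h - 1| <= 2 * `|h|.
    rewrite -(subrK h (expR h - 1)); apply: le_trans (ler_normD _ _) _.
    have : b * `|h| <= `|h| by rewrite ler_piMl.
    by move: E1; lra.
  have F2 : `|sin k| <= 2 * b.
    rewrite -(subrK k (sin k)); apply: le_trans (ler_normD _ _) _.
    have : b * `|k| <= `|k| by rewrite ler_piMl.
    by move: E3; lra.
  have -> : 4 * (b * `|h|) = (2 * `|h|) * (2 * b) by ring.
  exact: ler_pM.
apply: le_trans (cmod_le _) _; rewrite !reimE ?re_expi ?im_expi /= !mul0r !subr0 !addr0.
have : 6 * b * (`|h| + `|k|) <= e * (`|h| + `|k|) by rewrite ler_wpM2r // addr_ge0.
have p1 : 0 <= b * `|h| by rewrite mulr_ge0 // ltW.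
have p2 : 0 <= b * `|k| by rewrite mulr_ge0 // ltW.
by move: Rp Ip p1 p2; rewrite mulrDr; lra.
Qed.

(** In the coordinates [z = exp (x + i y)] an annulus becomes a rectangle of height [2 * pi] whose
    two horizontal sides carry the same values. *)
Definition polar (F : C -> C) x y : C := F (rc (expR x) * expi y).

(** By the chain rule [L = z F'(z)]. The common entry [re L] is the Cauchy-Riemann equation that
    [PQ] asks for. *)
Lemma polar_lin F x y : cder F (rc (expR x) * expi y) -> exists L : C,
  lin_at (fun x y => re (polar F x y)) x y (re L) (- im L) /\
  lin_at (fun x y => im (polar F x y)) x y (im L) (re L).
Proof.
set z := rc (expR x) * expi y => -[q qc qE]; exists (q z * z).
suff H : forall e : R, 0 < e -> exists2 d : R, 0 < d & forall x' y' : R,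
    `|x' - x| < d -> `|y' - y| < d ->
    cmod (polar F x' y' - polar F x y - q z * z * ((x' - x) +i* (y' - y))%C)
      <= e * (`|x' - x| + `|y' - y|).
  split=> e /H[d d0 Hd]; exists d => // x' y' h1 h2; apply: le_trans (Hd x' y' h1 h2).
    by apply: le_trans (abs_re _); rewrite re_lin reD reN.
  by apply: le_trans (abs_im _); rewrite im_lin imD imN.
move=> e e0; pose K := cmod z + 1; pose Q := cmod (q z) + 1.
have K0 : 0 < K by rewrite ltr_wpDl // cmod_ge0.
have Q0 : 0 < Q by rewrite ltr_wpDl // cmod_ge0.
(* In the final expansion [e2] controls [q z' - q z] and [e1] controls [rho], each for one half of
   [e]. The 1 in the minima gives [|q z'| <= Q] and [|rho| <= s]. *)
pose e2 := Num.min 1 (e / (2 * K)); pose e1 := Num.min 1 (e / (2 * K * Q)).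
have e20 : 0 < e2 by rewrite lt_min ltr01 divr_gt0 // mulr_gt0.
have e10 : 0 < e1 by rewrite lt_min ltr01 divr_gt0 // !mulr_gt0.
have [d1 d10 H1] := qc _ e20; have [d2 d20 H2] := polar_small e10.
exists (Num.min d2 (d1 / (4 * K))); first by rewrite lt_min d20 divr_gt0 // mulr_gt0.
move=> x' y'; set h := x' - x; set k := y' - y; rewrite !lt_min => /andP[h1 h2] /andP[k1 k2].
have := H2 _ _ h1 k1; set rho := (X in cmod X) => Hrho.
set s := `|h| + `|k|; have s0 : 0 <= s by rewrite addr_ge0.
have hk : cmod (h +i* k)%C <= s by exact: cmod_le.
have zz : rc (expR x') * expi y' - z = z * ((h +i* k)%C + rho).
  have xE : expR x' = expR h * expR x by rewrite -expRD subrK.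
  have yE : expi y' = expi k * expi y by rewrite -expiD subrK.
  rewrite /rho (addrC (h +i* k)%C) subrK mulrBr mulr1 xE yE rcM /z; ring.
have rs : cmod rho <= s.
  by apply: le_trans Hrho _; rewrite ler_piMl // ge_min lexx.
have hr : cmod ((h +i* k)%C + rho) <= 2 * s by apply: le_trans (cmodD _ _) _; lra.
have zK : cmod z <= K by rewrite lerDl.
have zs : cmod (rc (expR x') * expi y' - z) < d1.
  rewrite zz cmodM; apply: (@le_lt_trans _ _ (K * (2 * s))).
    by apply: ler_pM; rewrite ?cmod_ge0.
  have : s < d1 / (2 * K).
    by have -> : d1 / (2 * K) = d1 / (4 * K) + d1 / (4 * K);
       [field; rewrite gt_eqF|rewrite /s ltrD].
  by rewrite ltr_pdivlMr ?mulr_gt0 // (_ : K * (2 * s) = s * (2 * K)) //; ring.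
have qq := H1 _ zs.
rewrite {1}/polar -/z qE zz.
set z' := rc (expR x') * expi y' in zz zs qq *.
have -> : q z' * (z * ((h +i* k)%C + rho)) - q z * z * (h +i* k)%C =
  (q z' - q z) * z * (h +i* k)%C + q z' * z * rho by ring.
apply: le_trans (cmodD _ _) _; rewrite (cmodM _ rho) (cmodM _ (h +i* k)%C) !(cmodM _ z).
have -> : e * s = e / (2 * K) * K * s + Q * K * (e / (2 * K * Q) * s).
  by field; rewrite !gt_eqF.
apply: lerD.
  apply: ler_pM; rewrite ?mulr_ge0 ?cmod_ge0 //.
  apply: ler_pM; rewrite ?cmod_ge0 //; apply: ltW; apply: lt_le_trans qq _.
  by rewrite ge_min lexx orbT.
apply: ler_pM; rewrite ?mulr_ge0 ?cmod_ge0 //.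
  apply: ler_pM; rewrite ?cmod_ge0 //.
  rewrite -(subrK (q z) (q z')) addrC; apply: le_trans (cmodD _ _) _; rewrite lerD2l.
  by apply/ltW/(lt_le_trans qq); rewrite ge_min lexx.
by apply: le_trans Hrho _; rewrite ler_wpM2r // ge_min lexx orbT.
Qed.

Lemma ccont_circle F r : (forall t, ccts F (rc r * expi t)) -> ccont (fun t => F (rc r * expi t)).
Proof. by move=> h; apply: ccont_ccts => //; exact/ccontZ/ccont_expi. Qed.

Lemma cmod_circle r t : 0 <= r -> cmod (rc r * expi t : C) = r.
Proof. by move=> r0; rewrite cmodM cmod_expi mulr1 cmod_rc ger0_norm. Qed.

(** Goursat on the rectangle with sides [[ln r, ln s]] and [[0, 2 pi]]: the horizontal sides cancel
    by periodicity and the vertical sides are the two means, up to the factor [2 * pi]. *)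
Lemma re_mean_const F a b : 0 <= a -> (forall z, a < cmod z < b -> cder F z) ->
  forall r s, a < r -> r <= s -> s < b ->
  RI (fun t => re (F (rc r * expi t))) = RI (fun t => re (F (rc s * expi t))).
Proof.
move=> a0 hF r s ar rs sb.
have [r0 s0] : 0 < r /\ 0 < s by split; lra.
have cir w : a < w < b -> continuous (fun t => re (F (rc w * expi t))).
  move=> hw; apply: ccont_re; apply: ccont_circle => t; apply/cder_ccts/hF.
  by rewrite cmod_circle //; lra.
have p0 := two_pi_gt0 R.
have [ca cb] : continuous (fun t => re (F (rc r * expi t))) /\ continuous (fun t => re (F (rc s * expi t))).
  by split; apply: cir; lra.
have PQ x y : ln r <= x <= ln s -> 0 <= y <= 2 * pi -> exists A B D : R,
    lin_at (fun x y => re (polar F x y)) x y A B /\ lin_at (fun x y => im (polar F x y)) x y D A.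
  move=> /andP[h1 h2] _; case: (@polar_lin F x y).
    apply: hF; rewrite cmod_circle ?expR_ge0 //.
    move: h1 h2; rewrite -ler_expR lnK ?posrE // => h1.
    by rewrite -ler_expR lnK ?posrE // => h2; lra.
  by move=> L [L1 L2]; exists (re L), (- im L), (im L).
have := flux_eq0 PQ; rewrite ler_ln ?posrE // => /(_ rs (ltW p0)).
rewrite /flux /polar !lnK ?posrE // expi2pi expi0.
have -> : itg (fun x => im (F (rc (expR x) * 1)) - im (F (rc (expR x) * 1))) (ln r) (ln s) = 0.
  under eq_fun do rewrite subrr; by rewrite itg_cst ?mul0r // ler_ln ?posrE.
rewrite itgB; try by move=> x _; first [exact: cb|exact: ca].
rewrite subr0 => /eqP; rewrite subr_eq0 => /eqP E.
by rewrite !RI_itg // E.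
Qed.

Lemma mean_const F a b : 0 <= a -> (forall z, a < cmod z < b -> cder F z) ->
  forall r s, a < r -> r < b -> a < s -> s < b ->
  CI (fun t => F (rc r * expi t)) = CI (fun t => F (rc s * expi t)).
Proof.
move=> a0 hF r s.
wlog rs : r s / r <= s.
  move=> H h1 h2 h3 h4; have [rs|/ltW sr] := leP r s; [exact: H|by symmetry; apply: H].
move=> h1 _ _ h4; apply: cE; rewrite ?re_CI ?im_CI; first exact: (re_mean_const a0 hF).
(* The imaginary part of [F] is the real part of [- i F]. *)
have hF' z : a < cmod z < b -> cder (fun z => (0 -i* 1)%C * F z) z.
  by move=> hz; apply: cderM; [exact: cder_cst|exact: hF].
have E w : RI (fun t => im (F (rc w * expi t))) =
    RI (fun t => re ((0 -i* 1)%C * F (rc w * expi t))).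
  by apply: eq_RI => t; rewrite reM /=; ring.
by rewrite !E; exact: (re_mean_const a0 hF').
Qed.

End CircleIntegral.

(** * Power series with bounded coefficients, orthogonality and Parseval on circles *)

Section PowerSeries.
Variable R : realType.
Local Notation C := (Cplx R).
Local Notation re := (@complex.Re R).
Local Notation im := (@complex.Im R).
Implicit Types (c d s : nat -> C) (z w : C) (u : R -> C) (F G : C -> C).

Definition clim s (l : C) := forall e : R, 0 < e ->
  exists N, forall n, (N <= n)%N -> cmod (s n - l) < e.

Lemma clim_uniq s k l : clim s k -> clim s l -> k = l.
Proof.
move=> hk hl; apply/eqP; rewrite -subr_eq0; apply/negPn/negP => /cmod_gt0 kl.
have e0 : 0 < cmod (k - l) / 2 by rewrite divr_gt0.
have [N HN] := hk _ e0; have [N' HN'] := hl _ e0.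
have h1 := HN _ (leq_maxl N N'); have h2 := HN' _ (leq_maxr N N').
have : cmod (k - l) <= cmod (k - s (maxn N N')) + cmod (s (maxn N N') - l).
  by apply: le_trans (cmodD _ _); rewrite addrA subrK.
by rewrite (cmodBC k (s _)); lra.
Qed.
Lemma clim_cst (k : C) : clim (fun=> k) k.
Proof. by move=> e e0; exists 0%N => n _; rewrite subrr cmod0. Qed.
Lemma climD s t k l : clim s k -> clim t l -> clim (fun n => s n + t n) (k + l).
Proof.
move=> hk hl e e0; have e2 : 0 < e / 2 by rewrite divr_gt0.
have [N HN] := hk _ e2; have [N' HN'] := hl _ e2.
exists (maxn N N') => n; rewrite geq_max => /andP[/HN h1 /HN' h2].
by rewrite opprD addrACA; apply: le_lt_trans (cmodD _ _) _; lra.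
Qed.
Lemma climZ s k a : clim s k -> clim (fun n => a * s n) (a * k).
Proof.
move=> hk e e0; have a1 : 0 < cmod a + 1 by rewrite ltr_wpDl // cmod_ge0.
have [N HN] := hk (e / (cmod a + 1)) (divr_gt0 e0 a1).
exists N => n /HN h; rewrite -mulrBr cmodM.
have : cmod (s n - k) * (cmod a + 1) < e by rewrite -ltr_pdivlMr.
by have := cmod_ge0 (s n - k); rewrite mulrDr mulr1 mulrC; lra.
Qed.
Lemma clim_shift s k : clim s k -> clim (fun n => s n.+1) k.
Proof. by move=> h e /h[N HN]; exists N => n /leqW /HN. Qed.
Lemma clim_cj s k : clim s k -> clim (fun n => cj (s n)) (cj k).
Proof. by move=> h e /h[N HN]; exists N => n /HN; rewrite -cjN -cjD cmod_cj. Qed.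
Lemma clim_le s k N (M : R) : clim s k -> (forall n, (N <= n)%N -> cmod (s n) <= M) -> cmod k <= M.
Proof.
move=> h hM; rewrite leNgt; apply/negP => Mk.
have [|N' HN] := h (cmod k - M); first by rewrite subr_gt0.
have := hM _ (leq_maxl N N'); have := HN _ (leq_maxr N N').
by rewrite cmodBC; have := cmodB_ge k (s (maxn N N')); lra.
Qed.
Lemma clim_squeeze s k (e_ : nat -> R) : (forall n, cmod (s n - k) <= e_ n) ->
  e_ n @[n --> \oo] --> 0 -> clim s k.
Proof.
move=> h /cvgrPdist_lt H e /H[N _ HN]; exists N => n /HN.
by rewrite sub0r normrN; apply: le_lt_trans; apply: le_trans (h n) _; exact: ler_norm.
Qed.
Lemma clim_cvg s k : clim s k -> (fun n => re (s n)) @ \oo --> re k /\ (fun n => im (s n)) @ \oo --> im k.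
Proof.
move=> h; split; apply/cvgrPdist_lt => e /h[N HN]; exists N => // n /HN;
  rewrite cmodBC; apply: le_lt_trans.
  by rewrite -reN -reD abs_re.
by rewrite -imN -imD abs_im.
Qed.
Lemma cvg_clim s k : (fun n => re (s n)) @ \oo --> re k -> (fun n => im (s n)) @ \oo --> im k ->
  clim s k.
Proof.
move=> /cvgrPdist_lt h1 /cvgrPdist_lt h2 e e0; have e2 : 0 < e / 2 by rewrite divr_gt0.
have [N _ HN] := h1 _ e2; have [N' _ HN'] := h2 _ e2.
exists (maxn N N') => n; rewrite geq_max => /andP[/HN k1 /HN' k2].
rewrite cmodBC; apply: le_lt_trans (cmod_le _) _; rewrite !reimE; lra.
Qed.

(** The Taylor coefficients of an H^1 function are bounded by its norm, and boundedness already
    gives geometric tails inside the disk. *)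
Definition cbounded c (B : R) := forall n, cmod (c n) <= B.
Definition ppart c z n : C := \sum_(i < n) c i * z ^+ i.
Definition psum c z : C :=
  (limn (fun n => re (ppart c z n)) +i* limn (fun n => im (ppart c z n)))%C.

Lemma cbounded_ge0 c B : cbounded c B -> 0 <= B.
Proof. by move=> /(_ 0%N); apply: le_trans; exact: cmod_ge0. Qed.

Lemma geo_le (x : R) n : 0 <= x -> x < 1 -> \sum_(i < n) x ^+ i <= (1 - x)^-1.
Proof.
move=> x0 x1; have p : 0 < 1 - x by rewrite subr_gt0.
rewrite -[leRHS]mul1r ler_pdivlMr // mulrC.
have -> : (1 - x) * \sum_(i < n) x ^+ i = 1 - x ^+ n.
  by rewrite -[RHS]opprB subrX1 -mulNr opprB.
by rewrite gerBl exprn_ge0.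
Qed.

Lemma psum_lim c B z : cbounded c B -> cmod z < 1 -> clim (ppart c z) (psum c z).
Proof.
move=> hc z1; have z0 := cmod_ge0 z.
have key (f : nat -> R) : (forall n, `|f n| <= B * cmod z ^+ n) -> cvgn (series f).
  move=> hf; apply: normed_cvg; apply: (@series_le_cvg _ _ (geometric B (cmod z))) => //.
  - by move=> n /=.
  - by move=> n; rewrite /geometric /= mulr_ge0 ?exprn_ge0 // (cbounded_ge0 hc).
  - by apply: is_cvg_geometric_series; rewrite ger0_norm.
have E (f : C -> R) (fs : forall n, f (ppart c z n) = \sum_(i < n) f (c i * z ^+ i)) :
    (forall x, `|f x| <= cmod x) -> cvgn (fun n => f (ppart c z n)).
  move=> hf; have -> : (fun n => f (ppart c z n)) = series (fun n => f (c n * z ^+ n)).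
    by apply/funext => n; rewrite fs /series /= big_mkord.
  by apply: key => n; apply: le_trans (hf _) _; rewrite cmodM cmodX ler_wpM2r // exprn_ge0.
apply: cvg_clim => /=.
  by apply: (E re) => [n|x]; [exact: re_sum|exact: abs_re].
by apply: (E im) => [n|x]; [exact: im_sum|exact: abs_im].
Qed.

Lemma ppart_tail c B z N k : cbounded c B -> cmod z < 1 ->
  cmod (ppart c z (N + k) - ppart c z N) <= B * cmod z ^+ N / (1 - cmod z).
Proof.
move=> hc z1; have z0 := cmod_ge0 z.
rewrite /ppart big_split_ord /= addrAC subrr add0r; apply: le_trans (cmod_sum _ _ _) _.
apply: (@le_trans _ _ (\sum_(i < k) B * cmod z ^+ N * cmod z ^+ i)).
  apply: ler_sum => i _; rewrite cmodM cmodX exprD mulrA ler_wpM2r ?exprn_ge0 //.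
  by rewrite ler_wpM2r ?exprn_ge0.
rewrite -mulr_sumr; apply: ler_wpM2l; last exact: geo_le.
by rewrite mulr_ge0 ?exprn_ge0 // (cbounded_ge0 hc).
Qed.

Lemma psum_tail c B z N : cbounded c B -> cmod z < 1 ->
  cmod (psum c z - ppart c z N) <= B * cmod z ^+ N / (1 - cmod z).
Proof.
move=> hc z1; have hl := climD (psum_lim hc z1) (clim_cst (- ppart c z N)).
apply: (clim_le (N := N) hl) => n Nn.
by rewrite -(subnKC Nn); exact: ppart_tail.
Qed.

Lemma psum_bound c B z : cbounded c B -> cmod z < 1 -> cmod (psum c z) <= B / (1 - cmod z).
Proof.
move=> hc z1; have := psum_tail 0 hc z1.
by rewrite /ppart big_ord0 subr0 expr0 mulr1.
Qed.

Lemma psumP c B z l : cbounded c B -> cmod z < 1 -> clim (ppart c z) l -> psum c z = l.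
Proof. by move=> hc z1; apply: clim_uniq; exact: psum_lim hc z1. Qed.

Lemma cboundedS c B : cbounded c B -> cbounded (fun n => c n.+1) B.
Proof. by move=> h n. Qed.

Lemma psum_shift c B z : cbounded c B -> cmod z < 1 ->
  psum c z = c 0%N + z * psum (fun n => c n.+1) z.
Proof.
move=> hc z1; apply: clim_uniq (clim_shift (psum_lim hc z1)) _.
have := climD (clim_cst (c 0%N)) (climZ z (psum_lim (cboundedS hc) z1)).
congr clim; apply/funext => n; rewrite /ppart big_ord_recl expr0 mulr1 mulr_sumr.
by congr (_ + _); apply: eq_bigr => i _; rewrite exprS mulrCA.
Qed.

Lemma psum_lin c B d B' k z : cbounded c B -> cbounded d B' -> cmod z < 1 ->
  psum (fun n => c n + k * d n) z = psum c z + k * psum d z.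
Proof.
move=> hc hd z1; apply: (@psumP _ (B + cmod k * B')) => //.
  move=> n; apply: le_trans (cmodD _ _) _; rewrite cmodM.
  by apply: lerD => //; rewrite ler_wpM2l // cmod_ge0.
have := climD (psum_lim hc z1) (climZ k (psum_lim hd z1)).
congr clim; apply/funext => n; rewrite /ppart mulr_sumr -big_split /=.
by apply: eq_bigr => i _; rewrite mulrDl mulrA.
Qed.

Definition psum_quot c z i : C := psum (fun k => c (i + k).+1) z.

Lemma psum_quot_bounded c B z : cbounded c B -> cmod z < 1 ->
  cbounded (psum_quot c z) (B / (1 - cmod z)).
Proof. by move=> hc z1 i; apply: psum_bound => // n. Qed.

(* With b i = sum_k c (i + k + 1) z^k one has b i = c (i + 1) + z b (i + 1), so
   that the difference quotient of a power series is a power series. *)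
Lemma psum_sub c B z w : cbounded c B -> cmod z < 1 -> cmod w < 1 ->
  psum c w - psum c z = psum (psum_quot c z) w * (w - z).
Proof.
move=> hc z1 w1; have hb := psum_quot_bounded hc z1.
have bE i : psum_quot c z i = c i.+1 + z * psum_quot c z i.+1.
  rewrite /psum_quot (@psum_shift _ B) ?addn0 //.
  have -> : (fun n => c (i + n.+1).+1) = (fun k => c (i.+1 + k).+1); last by [].
  by apply/funext => k; rewrite addnS addSn.
have cz : psum c z = c 0%N + z * psum_quot c z 0%N.
  by rewrite (psum_shift hc z1); congr (_ + _ * psum _ _).
have cw : psum (fun n => c n.+1) w =
    psum (psum_quot c z) w + - z * psum (fun n => psum_quot c z n.+1) w.
  rewrite -(psum_lin _ hb (cboundedS hb) w1); congr psum; apply/funext => n.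
  by rewrite [in RHS]bE mulNr addrK.
rewrite (psum_shift hc w1) cz cw.
have := psum_shift hb w1; set X := psum _ w; set Y := psum _ w => XE.
have -> : w * (X + - z * Y) = w * X - z * (w * Y) by ring.
have -> : w * Y = X - psum_quot c z 0%N by rewrite XE addrC addKr.
by ring.
Qed.

Lemma ccts_lip F z (e K : R) : 0 < e ->
  (forall w, cmod (w - z) < e -> cmod (F w - F z) <= K * cmod (w - z)) -> ccts F z.
Proof.
move=> e0 H k k0; have K1 : 0 < `|K| + 1 by rewrite ltr_wpDl.
exists (Num.min e (k / (`|K| + 1))); first by rewrite lt_min e0 divr_gt0.
move=> w; rewrite lt_min => /andP[/H h1]; rewrite ltr_pdivlMr // => h2.
apply: le_lt_trans h1 _; apply: le_lt_trans h2; rewrite mulrC ler_wpM2l ?cmod_ge0 //.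
by have := ler_norm K; lra.
Qed.

Lemma near_disk z : cmod z < 1 -> exists2 e : R, 0 < e &
  forall w, cmod (w - z) < e -> cmod w <= (1 + cmod z) / 2.
Proof.
move=> z1; exists ((1 - cmod z) / 2); first by rewrite divr_gt0 // subr_gt0.
by move=> w; have := cmodB_ge w z; lra.
Qed.

Lemma psum_ccts c B z : cbounded c B -> cmod z < 1 -> ccts (psum c) z.
Proof.
move=> hc z1; have [e e0 he] := near_disk z1.
apply: (@ccts_lip _ _ e (B / (1 - cmod z) / (1 - (1 + cmod z) / 2)) e0) => w /he hw.
have w1 : cmod w < 1 by lra.
rewrite (psum_sub hc z1 w1) cmodM ler_wpM2r ?cmod_ge0 //.
apply: le_trans (psum_bound (psum_quot_bounded hc z1) w1) _.
apply: ler_wpM2l; first by rewrite divr_ge0 ?(cbounded_ge0 hc) //; lra.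
by rewrite lef_pV2 ?posrE; lra.
Qed.

Lemma cder_local F q z (e : R) : 0 < e -> ccts q z ->
  (forall w, cmod (w - z) < e -> F w - F z = q w * (w - z)) -> cder F z.
Proof.
move=> e0 qc qE.
apply: (@cder_near _ (fun w => q w * (w - z) + F z) F z e e0).
  by move=> w /qE <-; rewrite subrK.
by exists q => // w; rewrite subrr mulr0 add0r addrK.
Qed.

Lemma psum_cder c B z : cbounded c B -> cmod z < 1 -> cder (psum c) z.
Proof.
move=> hc z1; have [e e0 he] := near_disk z1.
apply: (@cder_local _ (psum (psum_quot c z)) _ e e0).
  exact: psum_ccts (psum_quot_bounded hc z1) z1.
move=> w /he hw; have w1 : cmod w < 1 by lra.
exact: (psum_sub hc z1 w1).
Qed.

Lemma cint_bounded_mul u v (K : R) : cint u -> ccont v -> (forall t, cmod (v t) <= K) ->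
  cint (fun t => u t * v t).
Proof.
move=> hu hv hK; have [u1 u2] := hu.
have [v1 v2] : measurable_fun setT (fun t => re (v t)) /\ measurable_fun setT (fun t => im (v t)).
  by split; apply: continuous_measurable_fun; [exact: ccont_re|exact: ccont_im].
apply: (@cint_le _ _ (fun t => K * cmod (u t))).
- under eq_fun do rewrite reM.
  by apply: measurable_funB; apply: measurable_funM => //; exact: ri_meas.
- under eq_fun do rewrite imM.
  by apply: measurable_funD; apply: measurable_funM => //; exact: ri_meas.
- by move=> t; rewrite cmodM mulrC ler_wpM2r ?cmod_ge0.
- by apply: riZ; exact: ri_cmod.
Qed.

Lemma CI_sum n (f : nat -> R -> C) : (forall i, cint (f i)) ->
  cint (fun t => \sum_(i < n) f i t) /\ CI (fun t => \sum_(i < n) f i t) = \sum_(i < n) CI (f i).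
Proof.
move=> h; elim: n => [|n [IH1 IH2]].
  split; first by under eq_fun do rewrite big_ord0; exact: cint_cst.
  rewrite big_ord0; transitivity (CI (fun=> 0 : C)); last exact: CI_cst.
  by apply: eq_CI => t; rewrite big_ord0.
under eq_fun do rewrite big_ord_recr /=.
by split; [exact: cintD|rewrite CID // big_ord_recr /= IH2].
Qed.

Lemma ccont_cjexpi : ccont (fun t => cj (@expi R t)).
Proof. exact/ccont_cj/ccont_expi. Qed.

Lemma ccont_psum c B w : cbounded c B -> cmod w < 1 ->
  ccont (fun t => psum c (w * cj (expi t))).
Proof.
move=> hc w1; apply: (@ccont_ccts _ (psum c) (fun t => w * cj (expi t))).
  exact/ccontZ/ccont_cjexpi.
by move=> t; apply: psum_ccts hc _; rewrite cmodM cmod_cj cmod_expi mulr1.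
Qed.

Lemma geo_cvg0 (K x : R) : 0 <= x -> x < 1 -> K * x ^+ n @[n --> \oo] --> (0 : R).
Proof. by move=> x0 x1; apply: cvg_geometric; rewrite ger0_norm. Qed.

(** The series converges uniformly in [t], hence integrates term by term. For [d = 1] its sum is the
    Cauchy kernel, and the result is the power series of the Fourier coefficients of [u]. *)
Lemma CI_psum u d B w : cint u -> cbounded d B -> cmod w < 1 ->
  CI (fun t => u t * psum d (w * cj (expi t))) =
  psum (fun n => d n * CI (fun t => u t * cj (expi t) ^+ n)) w.
Proof.
move=> hu hd w1.
have w0 := cmod_ge0 w.
have hn n : cint (fun t => u t * cj (expi t) ^+ n).
  apply: (@cint_bounded_mul _ _ 1) => //; first exact/ccontX/ccont_cjexpi.
  by move=> t; rewrite cmodX cmod_cj cmod_expi expr1n.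
set K := RI (fun t => cmod (u t)).
have bn n : cmod (CI (fun t => u t * cj (expi t) ^+ n)) <= K.
  apply: le_trans (cmod_CI (hn n)) _; apply: le_RI; [exact: ri_cmod|exact: ri_cmod|move=> t].
  by rewrite cmodM cmodX cmod_cj cmod_expi expr1n mulr1.
have wt t : cmod (w * cj (expi t)) = cmod w by rewrite cmodM cmod_cj cmod_expi mulr1.
have hp : cint (fun t => u t * psum d (w * cj (expi t))).
  apply: (@cint_bounded_mul _ _ (B / (1 - cmod w))) => //; first exact: ccont_psum hd w1.
  by move=> t; rewrite -[in leRHS](wt t); apply: psum_bound hd _; rewrite wt.
symmetry; apply: (@psumP _ (B * K)) => //.
  by move=> n; rewrite cmodM ler_pM ?cmod_ge0.
apply: (@clim_squeeze _ _ (fun n => (B / (1 - cmod w) * K) * cmod w ^+ n)); last exact: geo_cvg0.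
move=> n.
have [h1 h2] := CI_sum n (fun i => cintZ (d i * w ^+ i) (hn i)).
have -> : ppart (fun n => d n * CI (fun t => u t * cj (expi t) ^+ n)) w n =
    CI (fun t => u t * ppart d (w * cj (expi t)) n).
  transitivity (\sum_(i < n) CI (fun t => d i * w ^+ i * (u t * cj (expi t) ^+ i))).
    by apply: eq_bigr => i _; rewrite CIZ // mulrAC.
  rewrite -h2; apply: eq_CI => t; rewrite /ppart mulr_sumr; apply: eq_bigr => i _.
  by rewrite exprMn; ring.
have h3 : cint (fun t => u t * ppart d (w * cj (expi t)) n).
  move: h1; congr cint; apply/funext => t; rewrite /ppart mulr_sumr; apply: eq_bigr => i _.
  by rewrite exprMn; ring.
rewrite -CIB //; apply: le_trans (cmod_CI (cintB h3 hp)) _.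
rewrite (_ : _ * K * _ = B * cmod w ^+ n / (1 - cmod w) * K); last by ring.
rewrite -RIZ; last exact: ri_cmod.
apply: le_RI; [by apply: ri_cmod; exact: cintB|by apply: riZ; exact: ri_cmod|move=> t].
rewrite -mulrBr cmodM mulrC ler_wpM2r ?cmod_ge0 // cmodBC -(wt t).
by apply: psum_tail hd _; rewrite wt.
Qed.

(** The mean does not depend on the radius. If it were at distance [D > 0] from [F 0], then
    [|F - F 0|] would have mean at least [D] on a circle where it is below [D] everywhere; a minimum
    over the compact interval makes this gap uniform. *)
Lemma mean_value0 F : ccts F 0 -> (forall z, 0 < cmod z < 1 -> cder F z) ->
  forall r, 0 < r -> r < 1 -> CI (fun t => F (rc r * expi t)) = F 0.
Proof.
move=> F0 hF r r0 r1; apply/eqP; rewrite -subr_eq0; apply/negPn/negP => /cmod_gt0.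
set D := cmod _ => D0.
have [d d0 H] := F0 _ D0.
pose s := Num.min (d / 2) (1 / 2).
have s0 : 0 < s by rewrite lt_min !divr_gt0.
have s1 : s < 1 by rewrite gt_min; apply/orP; right; lra.
have sd : s < d by rewrite gt_min; apply/orP; left; lra.
have cs : ccont (fun t => F (rc s * expi t)).
  apply: ccont_circle => t; apply/cder_ccts/hF; by rewrite cmod_circle ?ltW // s0.
have E := mean_const (lexx 0) hF r0 r1 s0 s1.
pose D' := RI (fun t => cmod (F (rc s * expi t) - F 0)).
have DD : D <= D'.
  have -> : D = cmod (CI (fun t => F (rc s * expi t) - F 0)).
    by rewrite /D E CIB ?CI_cst //; [exact: ccont_cint|exact: cint_cst].
  by apply: cmod_CI; apply: cintB; [exact: ccont_cint|exact: cint_cst].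
have cc : continuous (fun t => D - cmod (F (rc s * expi t) - F 0)).
  move=> t; apply: cvgB; first exact: cvg_cst.
  by apply: (@ccont_cmod _ (fun t => F (rc s * expi t) - F 0)); apply: ccontD => //; exact: ccont_cst.
have pos t : 0 < D - cmod (F (rc s * expi t) - F 0).
  by rewrite subr_gt0; apply: H; rewrite subr0 cmod_circle ?ltW.
have : RI (fun t => D - cmod (F (rc s * expi t) - F 0)) <= 0.
  rewrite RIB ?RI_cst ?subr_le0 //; first exact: ri_cst.
  by apply: ri_cmod; apply: cintB; [exact: ccont_cint|exact: cint_cst].
have p0 := two_pi_gt0 R.
have [t _ tmin] := @EVT_min R (fun t => D - cmod (F (rc s * expi t) - F 0)) 0 (2 * pi) (ltW p0)
  (continuous_subspaceT cc).
rewrite leNgt => /negP; apply.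
rewrite RI_itg // mulr_gt0 ?invr_gt0 //.
apply: (@lt_le_trans _ _ (itg (fun=> D - cmod (F (rc s * expi t) - F 0)) 0 (2 * pi))).
  by rewrite itg_cst ?ltW // subr0 mulr_gt0.
apply: le_itg => [|x _|x hx]; [exact: cts_on_cst|exact: cc|].
by apply: tmin; rewrite in_itv.
Qed.

Lemma CI_expiX n : CI (fun t => @expi R t ^+ n) = (n == 0%N)%:R.
Proof.
case: n => [|n]; first by rewrite eqxx -(CI_cst 1); apply: eq_CI => t; rewrite expr0.
rewrite /=; pose r : R := 2^-1.
have X z : cder (fun z : C => z ^+ n.+1) z.
  elim: n => [|n IH]; first by under eq_fun do rewrite expr1; exact: cder_id.
  by under eq_fun do rewrite exprS; apply: cderM => //; exact: cder_id.
have [r0 r1] : 0 < r /\ r < 1 by rewrite /r; split; lra.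
have := mean_value0 (cder_ccts (X 0)) (fun z _ => X z) r0 r1.
rewrite expr0n /=; under eq_CI do rewrite exprMn.
rewrite CIZ; last by apply: ccont_cint; exact/ccontX/ccont_expi.
move/eqP; rewrite mulf_eq0 expf_eq0 /= => /orP[/eqP/(congr1 re) r_0|/eqP //].
by have h : r = 0 by []; move: r0; rewrite h ltxx.
Qed.

Lemma expi_cjX n (t : R) : expi t ^+ n * cj (expi t) ^+ n = 1 :> C.
Proof. by rewrite -exprMn mul_cj cmod_expi !expr1n. Qed.

Lemma CI_orth i n : CI (fun t => @expi R t ^+ i * cj (expi t) ^+ n) = (i == n)%:R.
Proof.
wlog ni : i n / (n <= i)%N.
  move=> H; have [ni|/ltnW ni] := leqP n i; first exact: H.
  transitivity (cj (CI (fun t => @expi R t ^+ n * cj (expi t) ^+ i))).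
    rewrite -CI_cj; last by apply: ccont_cint; apply: ccontM; apply: ccontX;
      [exact: ccont_expi|exact: ccont_cjexpi].
    by apply: eq_CI => t; rewrite cjM !cjX cjK mulrC.
  by rewrite H // eq_sym; case: eqP => _; [exact: cj_rc 1|exact: cj0].
transitivity (CI (fun t => @expi R t ^+ (i - n))).
  apply: eq_CI => t; rewrite -{1}(subnK ni) exprD -mulrA expi_cjX mulr1 //.
by rewrite CI_expiX subn_eq0 [in RHS]eqn_leq ni andbT.
Qed.

Lemma psum_delta (a : C) n z : cmod z < 1 -> psum (fun k => (k == n)%:R * a) z = a * z ^+ n.
Proof.
move=> z1; apply: (@psumP _ (cmod a)) => //.
  by move=> k; case: eqP => _; rewrite ?mul1r // mul0r cmod0 cmod_ge0.
move=> e e0; exists n.+1 => N nN; rewrite /ppart.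
rewrite (bigD1 (Ordinal nN)) //= eqxx mul1r big1 ?addr0 ?subrr ?cmod0 // => i /eqP ni.
by case: eqP => [in'|_]; rewrite ?mul0r //; case: ni; exact: val_inj.
Qed.

Lemma psum_cj c B z : cbounded c B -> cmod z < 1 ->
  cj (psum c z) = psum (fun n => cj (c n)) (cj z).
Proof.
move=> hc z1; symmetry; apply: (@psumP _ B); rewrite ?cmod_cj //.
  by move=> n; rewrite cmod_cj.
have := clim_cj (psum_lim hc z1); congr clim; apply/funext => n.
by rewrite /ppart (big_morph _ (@cjD R) (cj0 R)); apply: eq_bigr => i _; rewrite cjM cjX.
Qed.

Lemma circle_lt1 (r t : R) : 0 <= r < 1 -> cmod (rc r * expi t : C) < 1.
Proof. by move=> /andP[r0 r1]; rewrite cmod_circle. Qed.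

Lemma ccont_psum_circle c B r : cbounded c B -> 0 <= r < 1 -> ccont (fun t => psum c (rc r * expi t)).
Proof. by move=> hc hr; apply: ccont_circle => t; apply: psum_ccts hc _; exact: circle_lt1. Qed.

(** Conjugation turns a series in [expi t] into one in [cj (expi t)], the form treated by [CI_psum];
    orthogonality keeps a single term. *)
Lemma psum_coef c B r n : cbounded c B -> 0 <= r < 1 ->
  CI (fun t => psum c (rc r * expi t) * cj (expi t) ^+ n) = c n * rc r ^+ n.
Proof.
move=> hc hr.
have r1 : cmod (rc r : C) < 1 by rewrite cmod_rc ger0_norm; case/andP: hr.
transitivity (cj (CI (fun t => expi t ^+ n * psum (fun n => cj (c n)) (rc r * cj (expi t))))).
  rewrite -CI_cj; last first.
    apply: ccont_cint; apply: ccontM; first exact/ccontX/ccont_expi.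
    by apply: (@ccont_psum _ B) => // k; rewrite cmod_cj.
  apply: eq_CI => t; rewrite cjM cjX mulrC; congr (_ * _).
  rewrite (@psum_cj _ B) ?cjM ?cj_rc ?cjK //; first by congr psum; apply/funext => k; rewrite cjK.
    by move=> k; rewrite cmod_cj.
  by rewrite cmodM cmod_cj cmod_expi mulr1.
rewrite (@CI_psum _ _ B) //; first last.
- by move=> k; rewrite cmod_cj.
- by apply: ccont_cint; exact/ccontX/ccont_expi.
transitivity (cj (psum (fun k => (k == n)%:R * cj (c n)) (rc r))).
  congr (cj (psum _ _)); apply/funext => k; rewrite CI_orth eq_sym mulrC.
  by case: eqP => [->|_]; rewrite ?mul0r.
by rewrite psum_delta // cjM cjK cjX cj_rc.
Qed.

Lemma parseval c d B B' r : cbounded c B -> cbounded d B' -> 0 <= r < 1 ->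
  CI (fun t => psum c (rc r * expi t) * cj (psum d (rc r * expi t))) =
  psum (fun n => c n * cj (d n) * rc r ^+ n) (rc r).
Proof.
move=> hc hd hr.
have r1 : cmod (rc r : C) < 1 by rewrite cmod_rc ger0_norm; case/andP: hr.
transitivity (CI (fun t => psum c (rc r * expi t) * psum (fun n => cj (d n)) (rc r * cj (expi t)))).
  by apply: eq_CI => t; rewrite (psum_cj hd (@circle_lt1 r t hr)) cjM cj_rc.
rewrite (@CI_psum _ _ B') //; first last.
- by move=> k; rewrite cmod_cj.
- by apply: ccont_cint; exact: ccont_psum_circle hc hr.
by congr psum; apply/funext => n; rewrite (psum_coef n hc hr) mulrC mulrAC.
Qed.

End PowerSeries.

(** * Cauchy's formula, Taylor expansion, square-summable coefficients *)

Section Taylor.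
Variable R : realType.
Local Notation C := (Cplx R).
Local Notation re := (@complex.Re R).
Local Notation im := (@complex.Im R).
Implicit Types (c d a : nat -> C) (z w : C) (u : R -> C) (F G : C -> C).

Lemma RI_le_cst (f : R -> R) (M : R) : continuous f ->
  (forall t, 0 <= t <= 2 * pi -> f t <= M) -> RI f <= M.
Proof.
move=> cf h; have p0 := two_pi_gt0 R.
rewrite RI_itg // ler_pdivrMl //.
have -> : 2 * pi * M = itg (fun=> M) 0 (2 * pi) by rewrite itg_cst ?ltW // subr0 mulrC.
by apply: le_itg => // [x _|]; [exact: cf|exact: cts_on_cst].
Qed.

(** Compactness of [[0, 2 pi]] makes continuity in the radius uniform in the angle. *)
Lemma circle_uniform G (r0 : R) : (forall t, ccts G (rc r0 * expi t)) ->
  forall e : R, 0 < e -> exists2 d : R, 0 < d & forall r : R, `|r - r0| < d ->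
    forall t, 0 <= t <= 2 * pi -> cmod (G (rc r * expi t) - G (rc r0 * expi t)) < e.
Proof.
move=> hG e e0.
pose P (r t : R) := cmod (G (rc r * expi t) - G (rc r0 * expi t)) < e.
suff [d d0 H] : exists2 d : R, 0 < d & forall r, `|r - r0| < d -> `[0, 2 * pi]%classic `<=` P r.
  by exists d => // r /H + t ht; apply; rewrite /= in_itv.
have /compact_near_coveringP K := @segment_compact R 0 (2 * pi).
have [|d /= d0 H] := (nbhs_ballP r0 _).1 (K R (nbhs r0) P _ _); last first.
  by exists d => // r hr; apply: H; rewrite /ball /= distrC.
move=> t _; have e2 : 0 < e / 2 by rewrite divr_gt0.
have [d d0 Hd] := hG t _ e2.
pose A := `|r0| + 1; have A0 : 0 < A by rewrite ltr_wpDl.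
have dA : 0 < d / (2 * A) by rewrite divr_gt0 // mulr_gt0.
have [d1 d10 Hd1] := @ccont_expi R t _ dA.
exists (ball t d1, ball r0 (d / 2)).
  by split; apply: nbhsx_ballx => //; rewrite divr_gt0.
move=> [t' r] [/= h1 h2]; rewrite /P.
have h3 : cmod (expi t' - expi t : C) < d / (2 * A) by apply: Hd1; rewrite distrC.
have h4 : cmod (rc r0 * expi t' - rc r0 * expi t) < d / 2.
  rewrite -mulrBr cmodM cmod_rc; apply: (@le_lt_trans _ _ (A * cmod (expi t' - expi t : C))).
    by rewrite ler_wpM2r ?cmod_ge0 // lerDl.
  have -> : d / 2 = A * (d / (2 * A)) by field; rewrite gt_eqF.
  by rewrite ltr_pM2l.
have h5 : cmod (rc r * expi t' - rc r0 * expi t) < d.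
  have -> : rc r * expi t' - rc r0 * expi t =
    rc (r - r0) * expi t' + (rc r0 * expi t' - rc r0 * expi t) by rewrite rcD rcN; ring.
  apply: le_lt_trans (cmodD _ _) _; rewrite [d in _ < d]splitr; apply: ltrD => //.
  by rewrite cmodM cmod_expi mulr1 cmod_rc distrC.
have k1 := Hd _ h5; have k2 := Hd (rc r0 * expi t') (lt_trans h4 _).
have -> : G (rc r * expi t') - G (rc r0 * expi t') =
  (G (rc r * expi t') - G (rc r0 * expi t)) - (G (rc r0 * expi t') - G (rc r0 * expi t)) by ring.
apply: le_lt_trans (cmodB _ _) _; rewrite [e]splitr; apply: ltrD => //.
by apply: k2; rewrite ltr_pdivrMr // ltr_pMr // ltr1n.
Qed.

Lemma mean_uniform G (r0 b : R) : 0 < r0 < b -> (forall z, cmod z < b -> ccts G z) ->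
  forall e : R, 0 < e -> exists2 d : R, 0 < d & forall r : R, `|r - r0| < d -> 0 < r < b ->
    cmod (CI (fun t => G (rc r * expi t)) - CI (fun t => G (rc r0 * expi t))) <= e.
Proof.
move=> hr0 hG e e0.
have cG r : 0 < r < b -> ccont (fun t => G (rc r * expi t)).
  move=> /andP[h1 h2]; apply: ccont_circle => t; apply: hG.
  by rewrite cmod_circle // ltW.
have [|d d0 H] := @circle_uniform G r0 _ e e0.
  by move=> t; apply: hG; rewrite cmod_circle; case/andP: hr0 => // /ltW.
exists d => // r /H hr hrb.
have h1 := ccont_cint (cG _ hrb); have h2 := ccont_cint (cG _ hr0).
rewrite -CIB //; apply: le_trans (cmod_CI (cintB h1 h2)) _.
apply: RI_le_cst => [|t /hr/ltW //].
apply: (@ccont_cmod _ (fun t => G (rc r * expi t) - G (rc r0 * expi t))).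
apply: ccontD; first exact: cG.
by under eq_fun do rewrite -mulN1r; apply: ccontZ; exact: cG.
Qed.

Lemma cder_scale F (k z : C) : cder F (k * z) -> cder (fun w => F (k * w)) z.
Proof.
move=> h; apply: (@cder_comp _ F (fun w => k * w)) => //.
by apply: cderM; [exact: cder_cst|exact: cder_id].
Qed.

(* Meant for the difference quotient (F w - F z) / (w - z), which is continuous but not
   known to be differentiable at w = z; then a = |z|. *)
Lemma mean_value_cross G (a : R) : 0 < a < 1 -> (forall z, cmod z < 1 -> ccts G z) ->
  (forall z, 0 < cmod z < 1 -> cmod z != a -> cder G z) ->
  forall r, a < r -> r < 1 -> CI (fun t => G (rc r * expi t)) = G 0.
Proof.
move=> /andP[a0 a1] cG dG r ar r1.
have low s : 0 < s -> s < a -> CI (fun t => G (rc s * expi t)) = G 0.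
  move=> s0 sa.
  have h : ccts (fun w => G (rc a * w)) 0.
    apply: (@ccts_comp _ G (fun w => rc a * w)); last by rewrite mulr0; apply: cG; rewrite cmod0.
    by apply: cctsM; [exact: ccts_cst|exact: ccts_id].
  have dh z : 0 < cmod z < 1 -> cder (fun w => G (rc a * w)) z.
    move=> /andP[z0 z1]; apply: cder_scale.
    have E : cmod (rc a * z) = a * cmod z by rewrite cmodM cmod_rc gtr0_norm.
    have za : a * cmod z < a by rewrite gtr_pMr.
    by apply: dG; rewrite E; [rewrite mulr_gt0 //=; lra|rewrite lt_eqF].
  have := mean_value0 h dh (r := s / a) (divr_gt0 s0 a0).
  rewrite ltr_pdivrMr // mul1r mulr0 => /(_ sa) <-.
  by apply: eq_CI => t; rewrite mulrA -rcM (mulrC a) divfK ?gt_eqF.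
have high s : a < s -> s < 1 -> CI (fun t => G (rc r * expi t)) = CI (fun t => G (rc s * expi t)).
  move=> h1 h2; apply: (@mean_const _ G a 1) => //; first exact: ltW.
  by move=> z hz; apply: dG; [lra|rewrite gt_eqF //; case/andP: hz].
apply/eqP; rewrite -subr_eq0; apply/negPn/negP => /cmod_gt0 D0.
set D := cmod _ in D0.
have D4 : 0 < D / 4 by rewrite divr_gt0.
have [|d d0 H] := @mean_uniform G a 1 _ cG _ D4; first by rewrite a0.
pose k := Num.min (d / 2) (Num.min (a / 2) ((1 - a) / 2)).
have k0 : 0 < k by rewrite !lt_min !divr_gt0 // subr_gt0.
have [k1 k2 k3] : [/\ k <= d / 2, k <= a / 2 & k <= (1 - a) / 2].
  by split; rewrite !ge_min lexx ?orbT.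
have A1 : `|a - k - a| < d by rewrite addrAC subrr sub0r normrN gtr0_norm; lra.
have A2 : `|a + k - a| < d by rewrite addrAC subrr add0r gtr0_norm; lra.
have h1 := H _ A1; have h2 := H _ A2.
rewrite low in h1; [|lra|lra]; rewrite -high in h2; [|lra|lra].
have := cmodB (CI (fun t => G (rc r * expi t)) - CI (fun t => G (rc a * expi t)))
  (G 0 - CI (fun t => G (rc a * expi t))).
rewrite opprB addrA subrK -/D.
have p1 : 0 < a - k < 1 by lra.
have p2 : 0 < a + k < 1 by lra.
by have := h1 p1; have := h2 p2; lra.
Qed.

Lemma cmod_geo w : cmod w < 1 -> psum (fun=> 1) w = (1 - w)^-1.
Proof.
move=> w1; have b1 : cbounded (fun=> 1 : C) 1 by move=> n; rewrite cmod1.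
have w0 : 1 - w != 0.
  by apply/eqP => /eqP; rewrite subr_eq0 => /eqP h; move: w1; rewrite -h cmod1 ltxx.
have := psum_shift b1 w1; set p := psum _ w => E.
apply: (mulfI w0); rewrite divff // mulrBl mul1r [X in X - _]E; ring.
Qed.

Lemma CI_cauchy1 w : cmod w < 1 -> CI (fun t => psum (fun=> 1) (w * cj (expi t))) = 1.
Proof.
move=> w1; transitivity (CI (fun t => 1 * psum (fun=> 1) (w * cj (expi t)))).
  by apply: eq_CI => t; rewrite mul1r.
have b1 : cbounded (fun=> 1 : C) 1 by move=> n; rewrite cmod1.
rewrite (CI_psum (cint_cst 1) b1 w1) -[RHS](mul1r 1) -[X in _ * X](expr0 w).
rewrite -(psum_delta 1 0 w1); congr psum; apply/funext => n.
have := CI_orth R 0 n; rewrite (eq_sym 0%N) mul1r mulr1 => <-.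
by apply: eq_CI => t; rewrite expr0.
Qed.

Lemma cauchy_circle (r : R) z t : 0 < r -> cmod z < r ->
  rc r * expi t / (rc r * expi t - z) = psum (fun=> 1) (z / rc r * cj (expi t)).
Proof.
move=> r0 zr; have rn : rc r != 0 :> C.
  by apply/eqP => /(congr1 (@cmod R)); rewrite cmod_rc cmod0 gtr0_norm // => h; move: r0; rewrite h ltxx.
have e0 := expi_neq0 t.
have d0 : rc r * expi t - z != 0.
  by apply/eqP => /eqP; rewrite subr_eq0 => /eqP h; move: zr; rewrite -h cmod_circle ?ltW // ltxx.
rewrite cmod_geo; last first.
  by rewrite !cmodM cmod_cj cmod_expi mulr1 cmodV cmod_rc gtr0_norm // ltr_pdivrMr // mul1r.
by rewrite expi_cj; field; rewrite rn e0 d0.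
Qed.

(** Subtracting [F z] times the mean of the kernel, which is 1, leaves the mean of [w * q w], where
    [q] is the difference quotient at [z]. This product vanishes at 0, so its mean is 0. *)
Lemma cauchy F (r : R) z : holo F -> cmod z < r -> r < 1 ->
  F z = CI (fun t => F (rc r * expi t) * psum (fun=> 1) (z / rc r * cj (expi t))).
Proof.
move=> hF zr r1; have z0 := cmod_ge0 z; have r0 : 0 < r by lra.
have b1 : cbounded (fun=> 1 : C) 1 by move=> n; rewrite cmod1.
have w1 : cmod (z / rc r) < 1.
  by rewrite cmodM cmodV cmod_rc gtr0_norm // ltr_pdivrMr // mul1r.
have cF : ccont (fun t => F (rc r * expi t)).
  by apply: ccont_circle => t; apply/cder_ccts/hF; rewrite cmod_circle // ltW.
have cK : ccont (fun t => psum (fun=> 1) (z / rc r * cj (expi t))) by exact: ccont_psum b1 w1.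
have z1 : cmod z < 1 by lra.
have [q qc qE] := hF z z1.
suff : CI (fun t => (rc r * expi t) * q (rc r * expi t)) = 0.
  move=> H; apply/esym/eqP; rewrite -subr_eq0.
  rewrite -[X in _ - X]mulr1 -{2}(CI_cauchy1 w1) -CIZ; last exact: ccont_cint.
  rewrite -CIB; [|by apply: ccont_cint; exact: ccontM|by apply: ccont_cint; exact: ccontZ].
  apply/eqP; transitivity (CI (fun t => rc r * expi t * q (rc r * expi t))); last exact: H.
  apply: eq_CI => t; rewrite -mulrBl qE -cauchy_circle //.
  have d0 : rc r * expi t - z != 0.
    by apply/eqP => /eqP; rewrite subr_eq0 => /eqP h; move: zr; rewrite -h cmod_circle ?ltW // ltxx.
  by field.
(* [mean_value_cross] takes a positive radius [cmod z]. For [z = 0] the mean of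
   [w * q w = F w - F 0] is computed directly. *)
have [zE|zn] := eqVneq z 0.
  have E t : rc r * expi t * q (rc r * expi t) = F (rc r * expi t) - F 0.
    by rewrite -zE qE zE subr0 mulrC.
  under eq_CI do rewrite E.
  rewrite CIB ?CI_cst; [|exact: ccont_cint|exact: cint_cst].
  rewrite (@mean_value0 _ F) ?subrr //; first by apply/cder_ccts/hF; rewrite cmod0.
  by move=> w /andP[_ w1']; exact: hF.
have qd w : cmod w < 1 -> w != z -> cder q w.
  move=> w1' wz.
  have wz0 : w - z != 0 by rewrite subr_eq0.
  apply: (@cder_near _ (fun v => (F v - F z) * (v - z)^-1) q w (cmod (w - z))).
  - exact: cmod_gt0.
  - move=> v hv; rewrite qE mulfK // subr_eq0; apply/eqP => vz; move: hv.
    by rewrite vz cmodBC ltxx.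
  apply: cderM; first by apply: cderD; [exact: hF|exact: cder_cst].
  apply: (@cder_comp _ GRing.inv (fun v => v - z)); last exact: cder_inv.
  by apply: cderD; [exact: cder_id|exact: cder_cst].
pose G w := w * q w.
have G00 : G 0 = 0 by rewrite /G mul0r.
rewrite -[RHS]G00; apply: (@mean_value_cross G (cmod z)) => //.
- by rewrite cmod_gt0.
- move=> w w1'; apply: cctsM; first exact: ccts_id.
  by have [->|wz] := eqVneq w z; [exact: qc|exact/cder_ccts/qd].
- move=> w /andP[_ w1'] wz; apply: cderM; first exact: cder_id.
  by apply: qd => //; apply: contraNneq wz => ->.
Qed.

Lemma cderX n z : cder (fun w : C => w ^+ n) z.
Proof.
elim: n => [|n IH]; first exact: cder_cst.
by under eq_fun do rewrite exprS; apply: cderM => //; exact: cder_id.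
Qed.

Lemma rc_neq0 (r : R) : 0 < r -> rc r != 0 :> C.
Proof.
move=> r0; apply/eqP => /(congr1 (@cmod R)); rewrite cmod_rc cmod0 gtr0_norm // => h.
by move: r0; rewrite h ltxx.
Qed.

(** Both sides are circular means of [F z / z ^+ n], which is holomorphic in the punctured disk. *)
Lemma fourier_radial F n (r s : R) : holo F -> 0 < r -> r < 1 -> 0 < s -> s < 1 ->
  CI (fun t => F (rc r * expi t) * cj (expi t) ^+ n) / rc r ^+ n =
  CI (fun t => F (rc s * expi t) * cj (expi t) ^+ n) / rc s ^+ n.
Proof.
move=> hF.
have E (w : R) : 0 < w -> w < 1 -> CI (fun t => F (rc w * expi t) * cj (expi t) ^+ n) / rc w ^+ n =
    CI (fun t => F (rc w * expi t) * ((rc w * expi t) ^+ n)^-1).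
  move=> w0 w1; rewrite mulrC -CIZ; last first.
    apply: ccont_cint; apply: ccontM; last exact/ccontX/ccont_cjexpi.
    by apply: ccont_circle => t; apply/cder_ccts/hF; rewrite cmod_circle // ltW.
  by apply: eq_CI => t; rewrite exprMn invfM expi_cj exprVn mulrCA.
move=> r0 r1 s0 s1; rewrite (E r r0 r1) (E s s0 s1).
apply: (@mean_const _ (fun z => F z * (z ^+ n)^-1) 0 1) => // z /andP[z0 z1].
apply: cderM; first exact: hF.
apply: (@cder_comp _ GRing.inv (fun w => w ^+ n)); first exact: cderX.
apply: cder_inv; rewrite expf_neq0 //; apply/eqP => zE; move: z0; by rewrite zE cmod0 ltxx.
Qed.

Lemma bernoulli_le (x : R) n : 0 <= x <= 1 -> 1 - n%:R * x <= (1 - x) ^+ n.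
Proof.
move=> /andP[x0 x1]; elim: n => [|n IH]; first by rewrite mul0r subr0 expr0.
rewrite exprS; apply: (@le_trans _ _ ((1 - x) * (1 - n%:R * x))).
  have : 0 <= n%:R * x * x by rewrite !mulr_ge0.
  by rewrite -natr1; lra.
by apply: ler_wpM2l => //; rewrite subr_ge0.
Qed.

(** Lets [r] tend to 1. Bernoulli's inequality makes the loss at [r = 1 - e] at most half of a
    supposed gap [x - M]. *)
Lemma pow_limit (x M : R) n : 0 <= x -> (forall r, 0 < r -> r < 1 -> x * r ^+ n <= M) -> x <= M.
Proof.
move=> x0 H; rewrite leNgt; apply/negP => Mx.
pose K := x * n%:R + 1; have K0 : 0 < K by rewrite ltr_wpDl // mulr_ge0.
pose e := Num.min (1 / 2) ((x - M) / (2 * K)).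
have e0 : 0 < e by rewrite lt_min !divr_gt0 ?subr_gt0 ?mulr_gt0.
have [e1 e2] : e <= 1 / 2 /\ e <= (x - M) / (2 * K) by split; rewrite ge_min lexx ?orbT.
have := H (1 - e); rewrite subr_gt0 gtrBl => /(_ _ e0) h.
have {}h : x * (1 - e) ^+ n <= M by apply: h; lra.
have b : 1 - n%:R * e <= (1 - e) ^+ n by apply: bernoulli_le; lra.
have h2 : x * (1 - n%:R * e) <= M by apply: le_trans h; exact: ler_wpM2l.
have h3 : x * n%:R * e <= K * ((x - M) / (2 * K)).
  apply: (@le_trans _ _ (K * e)); last by rewrite ler_pM2l.
  by apply: ler_wpM2r; [exact: ltW|rewrite /K lerDl].
have h4 : K * ((x - M) / (2 * K)) = (x - M) / 2 by field; rewrite gt_eqF.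
by move: h2 h3; rewrite h4 mulrBr mulr1 mulrA; lra.
Qed.

Lemma taylor F (M : R) : holo F ->
  (forall r, 0 < r -> r < 1 -> RI (fun t => cmod (F (rc r * expi t))) <= M) ->
  exists2 a, cbounded a M & forall z, cmod z < 1 -> F z = psum a z.
Proof.
move=> hF hM; pose s : R := 2^-1.
have [s0 s1] : 0 < s /\ s < 1 by rewrite /s; split; lra.
(* By [fourier_radial] any other radius gives the same coefficients; radii near 1 yield the bound
   [M]. *)
pose a n := CI (fun t => F (rc s * expi t) * cj (expi t) ^+ n) / rc s ^+ n.
have cF r : 0 < r -> r < 1 -> ccont (fun t => F (rc r * expi t)).
  by move=> r0 r1; apply: ccont_circle => t; apply/cder_ccts/hF; rewrite cmod_circle // ltW.
have aE n r : 0 < r -> r < 1 -> CI (fun t => F (rc r * expi t) * cj (expi t) ^+ n) = a n * rc r ^+ n.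
  move=> r0 r1; rewrite /a (fourier_radial n hF s0 s1 r0 r1) divfK // expf_neq0 //.
  exact: rc_neq0.
have ab : cbounded a M.
  move=> n; apply: (@pow_limit _ _ n); first exact: cmod_ge0.
  move=> r r0 r1; apply: le_trans (hM r r0 r1).
  have -> : cmod (a n) * r ^+ n = cmod (a n * rc r ^+ n).
    by rewrite cmodM cmodX cmod_rc gtr0_norm.
  rewrite -aE //.
  have ci : cint (fun t => F (rc r * expi t) * cj (expi t) ^+ n).
    by apply: ccont_cint; apply: ccontM; [exact: cF|exact/ccontX/ccont_cjexpi].
  apply: le_trans (cmod_CI ci) _.
  apply: le_RI => [||t]; [exact: ri_cmod|by apply/ri_cmod/ccont_cint/cF|].
  by rewrite cmodM cmodX cmod_cj cmod_expi expr1n mulr1.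
exists a => // z z1.
pose r := (1 + cmod z) / 2; have z0 := cmod_ge0 z.
have [r0 r1 zr] : [/\ 0 < r, r < 1 & cmod z < r] by rewrite /r; split; lra.
have b1 : cbounded (fun=> 1 : C) 1 by move=> n; rewrite cmod1.
have w1 : cmod (z / rc r) < 1.
  by rewrite cmodM cmodV cmod_rc gtr0_norm // ltr_pdivrMr // mul1r.
rewrite (cauchy hF zr r1) (CI_psum (ccont_cint (cF r r0 r1)) b1 w1).
have Mr : cbounded (fun n => 1 * CI (fun t => F (rc r * expi t) * cj (expi t) ^+ n)) M.
  move=> n; rewrite mul1r aE // cmodM cmodX cmod_rc gtr0_norm //.
  apply: le_trans (ab n); rewrite ler_piMr ?cmod_ge0 //.
  by rewrite exprn_ile1 ?ltW.
apply/esym; apply: (psumP ab z1).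
have := psum_lim Mr w1; congr clim; apply/funext => N; apply: eq_bigr => i _.
rewrite mul1r aE // -mulrA -exprMn; congr (_ * _ ^+ _).
by rewrite mulrC divfK // rc_neq0.
Qed.

Definition sqsum a (M : R) := forall N, \sum_(i < N) cmod (a i) ^+ 2 <= M.

Lemma sqsum_term a M n : sqsum a M -> cmod (a n) ^+ 2 <= M.
Proof.
move=> /(_ n.+1); rewrite big_ord_recr /=; apply: le_trans; rewrite lerDr.
by apply: sumr_ge0 => i _; exact: sqr_ge0.
Qed.
Lemma sqsum_ge0 a M : sqsum a M -> 0 <= M.
Proof. by move=> /(_ 0%N); rewrite big_ord0. Qed.
Lemma sqr_le1 (x : R) : x <= 1 + x ^+ 2.
Proof. by have := sqr_ge0 (x - 1 / 2); rewrite sqrrB; lra. Qed.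
Lemma sqsum_bounded a M : sqsum a M -> cbounded a (1 + M).
Proof.
move=> h n; apply: le_trans (sqr_le1 _) _; rewrite lerD2l; exact: sqsum_term h.
Qed.

Lemma ri_sqr_psum a B r : cbounded a B -> 0 <= r < 1 ->
  continuous (fun t => cmod (psum a (rc r * expi t)) ^+ 2).
Proof.
move=> ha hr t; under eq_fun do rewrite expr2.
by apply: cvgM; apply: (ccont_cmod (ccont_psum_circle ha hr)).
Qed.

Lemma parseval_lim a B r : cbounded a B -> 0 <= r < 1 ->
  \sum_(i < N) cmod (a i) ^+ 2 * (r ^+ i) ^+ 2 @[N --> \oo] -->
    RI (fun t => cmod (psum a (rc r * expi t)) ^+ 2).
Proof.
move=> ha hr.
have r1 : cmod (rc r : C) < 1 by rewrite cmod_rc ger0_norm; case/andP: hr.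
have hb : cbounded (fun n => a n * cj (a n) * rc r ^+ n) (B * B).
  move=> n; rewrite !cmodM cmod_cj -[leRHS]mulr1; apply: ler_pM; rewrite ?mulr_ge0 ?cmod_ge0 //.
    by apply: ler_pM; rewrite ?cmod_ge0.
  by rewrite cmodX exprn_ile1 ?cmod_ge0 // ltW.
have := (clim_cvg (psum_lim hb r1)).1; rewrite -(parseval ha ha hr).
have -> : complex.Re (CI (fun t => psum a (rc r * expi t) * cj (psum a (rc r * expi t)))) =
    RI (fun t => cmod (psum a (rc r * expi t)) ^+ 2).
  by rewrite re_CI; apply: eq_RI => t; rewrite mul_cj.
apply: cvg_trans; apply: near_eq_cvg; near=> N.
rewrite re_sum; apply: eq_bigr => i _.
by rewrite mul_cj -!rcX -!rcM re_rc expr2; ring.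
Unshelve. all: by end_near. Qed.

Lemma parseval_le a B M r : cbounded a B -> sqsum a M -> 0 <= r < 1 ->
  RI (fun t => cmod (psum a (rc r * expi t)) ^+ 2) <= M.
Proof.
move=> ha hM hr; have /cvg_lim <- // := parseval_lim ha hr.
apply: limr_le; first by apply: cvgP; exact: parseval_lim ha hr.
apply: nearW => N; apply: le_trans (hM N); apply: ler_sum => i _.
rewrite ler_piMr ?sqr_ge0 // exprn_ile1 ?exprn_ge0 //; case/andP: hr => // r0 r1.
by rewrite exprn_ile1 // ltW.
Qed.

Lemma parseval_ge a B M : cbounded a B ->
  (forall r, 0 < r -> r < 1 -> RI (fun t => cmod (psum a (rc r * expi t)) ^+ 2) <= M) -> sqsum a M.
Proof.
move=> ha hM N; apply: (@pow_limit _ _ (N * 2)); first by apply: sumr_ge0 => i _; exact: sqr_ge0.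
move=> r r0 r1; apply: le_trans (hM r r0 r1).
have hr : 0 <= r < 1 by rewrite ltW.
pose S N := \sum_(i < N) cmod (a i) ^+ 2 * (r ^+ i) ^+ 2.
have nd : nondecreasing_seq S.
  by apply/nondecreasing_seqP => n; rewrite /S big_ord_recr /= lerDl mulr_ge0 ?sqr_ge0.
apply: (@le_trans _ _ (S N)).
  rewrite mulr_suml; apply: ler_sum => i _; rewrite ler_wpM2l ?sqr_ge0 // exprM.
  rewrite ler_pXn2r ?nnegrE ?exprn_ge0 ?(ltW r0) //.
  by apply: ler_wiXn2l; [exact: ltW|exact: ltW|exact: ltnW].
have /cvg_lim <- // := parseval_lim ha hr.
by apply: nondecreasing_cvgn_le => //; apply: cvgP; exact: parseval_lim ha hr.
Qed.

(** [x <= 1 + x ^+ 2] turns square means into means, so [taylor] provides the expansion; Parseval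
    then bounds the squares of its coefficients. *)
Lemma taylor2 F (M : R) : holo F ->
  (forall r, 0 < r -> r < 1 -> RI (fun t => cmod (F (rc r * expi t)) ^+ 2) <= M) ->
  exists2 a, sqsum a M & forall z, cmod z < 1 -> F z = psum a z.
Proof.
move=> hF hM.
have cF r : 0 < r -> r < 1 -> ccont (fun t => F (rc r * expi t)).
  by move=> r0 r1; apply: ccont_circle => t; apply/cder_ccts/hF; rewrite cmod_circle // ltW.
have [r r0 r1|a ab aE] := @taylor F (1 + M) hF.
  have i2 : ri (fun t => cmod (F (rc r * expi t)) ^+ 2).
    apply: ri_cont => t; under eq_fun do rewrite expr2.
    by apply: cvgM; apply: (ccont_cmod (cF r r0 r1)).
  apply: (@le_trans _ _ (RI (fun t => 1 + cmod (F (rc r * expi t)) ^+ 2))).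
    apply: le_RI => [||t]; [by apply/ri_cmod/ccont_cint/cF|by apply: riD => //; exact: ri_cst|].
    exact: sqr_le1.
  by rewrite RID ?RI_cst ?lerD2l ?hM //; exact: ri_cst.
exists a => //; apply: (parseval_ge ab) => r r0 r1; apply: le_trans (hM r r0 r1).
rewrite le_eqVlt; apply/orP; left; apply/eqP/eq_RI => t; congr (cmod _ ^+ 2).
by rewrite aE // cmod_circle // ltW.
Qed.

Lemma cauchy_schwarz_sum N (x y : nat -> R) :
  (\sum_(i < N) x i * y i) ^+ 2 <= (\sum_(i < N) x i ^+ 2) * (\sum_(i < N) y i ^+ 2).
Proof.
set X := \sum_(i < N) x i ^+ 2; set Y := \sum_(i < N) y i ^+ 2; set Z := \sum_(i < N) _.
have X0 : 0 <= X by apply: sumr_ge0 => i _; exact: sqr_ge0.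
have Y0 : 0 <= Y by apply: sumr_ge0 => i _; exact: sqr_ge0.
have [YE|Yn] := eqVneq Y 0.
  have yE (i : 'I_N) : y i = 0.
    apply/eqP; rewrite -sqrf_eq0; apply/eqP.
    by apply: (psumr_eq0P (fun i _ => sqr_ge0 (y (nat_of_ord i))) YE).
  by rewrite /Z big1 ?expr0n ?mulr_ge0 //= => i _; rewrite yE mulr0.
have Yp : 0 < Y by rewrite lt_neqAle eq_sym Yn.
have : 0 <= \sum_(i < N) (Y * x i - Z * y i) ^+ 2 by apply: sumr_ge0 => i _; exact: sqr_ge0.
have E (k l : R) : \sum_(i < N) (k * x i - l * y i) ^+ 2 = k ^+ 2 * X - 2 * k * l * Z + l ^+ 2 * Y.
  transitivity (\sum_(i < N) (k ^+ 2 * x i ^+ 2 + (- (2 * k * l) * (x i * y i) + l ^+ 2 * y i ^+ 2))).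
    by apply: eq_bigr => i _; ring.
  by rewrite !big_split /= -!mulr_sumr -/X -/Y -/Z; ring.
rewrite E.
have -> : Y ^+ 2 * X - 2 * Y * Z * Z + Z ^+ 2 * Y = Y * (X * Y - Z ^+ 2) by ring.
by rewrite pmulr_rge0 // subr_ge0.
Qed.

(** Cauchy-Schwarz against the reproducing kernel of H^2, whose squared norm is [1 / (1 - |z|^2)].
    Integrated along a symbol, it bounds the composition operator. *)
Lemma psum_le_sq a M z : sqsum a M -> cmod z < 1 -> cmod (psum a z) ^+ 2 <= M / (1 - cmod z ^+ 2).
Proof.
move=> hM z1; have z0 := cmod_ge0 z; have M0 := sqsum_ge0 hM.
have q1 : cmod z ^+ 2 < 1 by rewrite expr_lt1.
have q0 : 0 <= M / (1 - cmod z ^+ 2) by rewrite divr_ge0 // subr_ge0 ltW.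
rewrite -[leRHS]sqr_sqrtr // ler_pXn2r ?nnegrE ?cmod_ge0 ?sqrtr_ge0 //.
apply: (clim_le (N := 0) (psum_lim (sqsum_bounded hM) z1)) => n _.
rewrite -(ler_pXn2r (n := 2)) // ?nnegrE ?cmod_ge0 ?sqrtr_ge0 // sqr_sqrtr //.
apply: (@le_trans _ _ ((\sum_(i < n) cmod (a i) * cmod z ^+ i) ^+ 2)).
  rewrite ler_pXn2r ?nnegrE ?cmod_ge0 //.
    by apply: le_trans (cmod_sum _ _ _) _; apply: ler_sum => i _; rewrite cmodM cmodX.
  by apply: sumr_ge0 => i _; rewrite mulr_ge0 ?exprn_ge0 ?cmod_ge0.
apply: le_trans (cauchy_schwarz_sum n (fun i => cmod (a i)) (fun i => cmod z ^+ i)) _.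
apply: ler_pM => //.
- by apply: sumr_ge0 => i _; exact: sqr_ge0.
- by apply: sumr_ge0 => i _; exact: sqr_ge0.
- under eq_bigr do rewrite -exprM mulnC exprM; apply: geo_le => //; exact: sqr_ge0.
Qed.

End Taylor.

(** * Integrals of functions known up to a null set *)

Section Null.
Import HBNNSimple.
Local Open Scope ereal_scope.
Context (d : measure_display) (T : measurableType d) (R : realType).
Variable m : {measure set T -> \bar R}.

(* The integral of a nonnegative function is a supremum over simple functions,
   so no measurability is needed to neglect a null set. *)
Lemma le_integral_off_null (f g : T -> \bar R) (N : set T) :
  measurable N -> m N = 0 -> (forall x, 0 <= f x) -> (forall x, 0 <= g x) ->
  (forall x, ~ N x -> f x <= g x) -> \int[m]_x f x <= \int[m]_x g x.
Proof.
move=> mN N0 f0 g0 fg; rewrite !ge0_integralTE //.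
apply: ge_ereal_sup => _ [h /= hf <-].
pose h' := mul_nnsfun h (indic_nnsfun R (measurableC mN)).
have h'E x : h' x = (h x * \1_(~` N) x)%R by [].
apply: le_ereal_sup_tmp; exists (sintegral m h'); last first.
  rewrite -!integralT_nnsfun le_eqVlt; apply/orP; left; apply/eqP; apply: ae_eq_integral => //.
  - by apply/measurable_EFinP.
  - by apply/measurable_EFinP.
  exists N; split => // x /= hx; apply: contrapT => nx; apply: hx => _.
  by change ((h x)%:E = (h' x)%:E); rewrite h'E indicE mem_set // mulr1.
exists h' => // x; rewrite h'E indicE; have [Nx|Nx] := pselect (N x).
  by rewrite memNset ?mulr0 //=; apply.
by rewrite mem_set // mulr1; apply: le_trans (hf x) (fg x Nx).
Qed.

(** It lets [boundary f], a pointwise [lim], be exchanged for a function that it equals almost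
    everywhere. *)
Lemma integral_ae (f g : T -> \bar R) : (\forall t \ae m, f t = g t) ->
  \int[m]_t f t = \int[m]_t g t.
Proof.
move=> [N [mN N0 Ns]].
have fg x : ~ N x -> f x = g x by move=> Nx; apply: contrapT => h; apply: Nx; exact: Ns.
rewrite integralE [RHS]integralE; congr (_ - _); apply/eqP; rewrite eq_le; apply/andP; split;
  by apply: (le_integral_off_null mN N0) => // x /fg; rewrite ?funeposE ?funenegE => ->.
Qed.

End Null.

(** * The Poisson kernel and its convergence at Lebesgue points *)

Section PoissonFatou.
Variable R : realType.
Local Notation C := (Cplx R).
Local Notation re := (@complex.Re R).
Local Notation im := (@complex.Im R).
Local Notation m := (uniform_prob (two_pi_gt0 R)).
Local Notation mu := (@lebesgue_measure R).
Implicit Types (c d a : nat -> C) (z w : C) (u : R -> C) (f g : R -> R).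

Lemma ri_abs f : ri f -> ri (fun t => `|f t|).
Proof. by move=> hf; exact: (integrable_norm hf). Qed.

Lemma ri_mul_sq f g : measurable_fun setT f -> measurable_fun setT g ->
  ri (fun t => f t ^+ 2) -> ri (fun t => g t ^+ 2) -> ri (fun t => f t * g t).
Proof.
move=> mf mg f2 g2; apply: (@ri_le _ _ (fun t => f t ^+ 2 + g t ^+ 2)); last exact: riD.
  exact: measurable_funM.
move=> t; rewrite normrM -(normr_sq (f t)) -(normr_sq (g t)).
have := sqr_ge0 (`|f t| - `|g t|); rewrite sqrrB.
have : 0 <= `|f t| * `|g t| by rewrite mulr_ge0.
by rewrite -mulr_natr; lra.
Qed.

Lemma RI_CS f g : measurable_fun setT f -> measurable_fun setT g ->
  ri (fun t => f t ^+ 2) -> ri (fun t => g t ^+ 2) ->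
  RI (fun t => f t * g t) ^+ 2 <= RI (fun t => f t ^+ 2) * RI (fun t => g t ^+ 2).
Proof.
move=> mf mg f2 g2; have fg := ri_mul_sq mf mg f2 g2.
set X := RI (fun t => f t ^+ 2); set Y := RI (fun t => g t ^+ 2); set Z := RI _.
have X0 : 0 <= X by apply: RI_ge0 => t; exact: sqr_ge0.
have Y0 : 0 <= Y by apply: RI_ge0 => t; exact: sqr_ge0.
have E (k l : R) : 0 <= k ^+ 2 * X + (- (2 * k * l) * Z + l ^+ 2 * Y).
  have -> : k ^+ 2 * X + (- (2 * k * l) * Z + l ^+ 2 * Y) = RI (fun t => (k * f t - l * g t) ^+ 2).
    rewrite /X /Y /Z -!RIZ // -!RID; try by repeat (apply: riD || apply: riZ).
    by apply: eq_RI => t; ring.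
  by apply: RI_ge0 => t; exact: sqr_ge0.
have [YE|Yn] := eqVneq Y 0.
  (* For [Y = 0] this choice of [k] and [l] gives [- (Z ^+ 2 * (X + 2)) >= 0]. *)
  have := E Z (X + 1); rewrite YE mulr0 addr0.
  have -> : Z ^+ 2 * X + - (2 * Z * (X + 1)) * Z = - (Z ^+ 2 * (X + 2)) by ring.
  by rewrite mulr0 oppr_ge0 pmulr_lle0 //; lra.
have Yp : 0 < Y by rewrite lt_neqAle eq_sym Yn.
have := E Y Z.
have -> : Y ^+ 2 * X + (- (2 * Y * Z) * Z + Z ^+ 2 * Y) = Y * (X * Y - Z ^+ 2) by ring.
by rewrite pmulr_rge0 // subr_ge0.
Qed.

Lemma aeS (P Q : R -> Prop) : (forall t, P t -> Q t) ->
  (\forall t \ae m, P t) -> \forall t \ae m, Q t.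
Proof.
move=> PQ [N [mN N0 Ns]]; exists N; split => // t nQ; apply: Ns => Pt; apply: nQ.
exact: PQ.
Qed.

Lemma aeI (P Q : R -> Prop) : (\forall t \ae m, P t) -> (\forall t \ae m, Q t) ->
  \forall t \ae m, P t /\ Q t.
Proof.
move=> [N [mN N0 Ns]] [N' [mN' N0' Ns']]; exists (N `|` N'); split.
- exact: measurableU.
- exact: null_set_setU.
move=> t nPQ; have [Pt|Pt] := pselect (P t); last by left; exact: Ns.
by right; apply: Ns' => Qt; apply: nPQ.
Qed.

Lemma RI_ae f g : (\forall t \ae m, f t = g t) -> RI f = RI g.
Proof.
by move=> h; congr fine; apply: integral_ae; apply: aeS h => t ->.
Qed.

Lemma le_RI_ae f g : ri f -> ri g -> (\forall t \ae m, f t <= g t) -> RI f <= RI g.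
Proof.
move=> hf hg h; rewrite -subr_ge0 -RIB //.
rewrite (@RI_ae _ (fun t => `|g t - f t|)); first by apply: RI_ge0 => t; exact: normr_ge0.
by apply: aeS h => t ht; rewrite ger0_norm // subr_ge0.
Qed.

Lemma CI_ae u (v : R -> C) : (\forall t \ae m, u t = v t) -> CI u = CI v.
Proof.
move=> h; apply: cE; rewrite ?re_CI ?im_CI; apply: RI_ae; by apply: aeS h => t ->.
Qed.

Lemma ae_lebesgue (P : R -> Prop) : (\forall t \ae mu, P t) -> \forall t \ae m, P t.
Proof.
move=> [N [mN N0 Ns]]; exists N; split => //.
by have /null_content_dominatesP := dominates_uniform_prob (two_pi_gt0 R); apply.
Qed.

Lemma ae_circle : \forall t \ae m, 0 < t < 2 * pi.
Proof.
have p0 := two_pi_gt0 R.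
have mI : measurable (`]0, (2 * pi)[%classic : set R) by exact: measurable_itv.
exists (~` `]0, (2 * pi)[%classic); split; first exact: measurableC.
  have h1 : m `]0, (2 * pi)[%classic = 1%E.
    rewrite /= /uniform_prob.
    rewrite (eq_integral (fun=> ((2 * pi)^-1)%:E)); last first.
      move=> x; rewrite inE /= in_itv /= /uniform_pdf subr0 => /andP[h1 h2].
      by rewrite (ltW h1) (ltW h2).
    rewrite integral_cst //= lebesgue_measure_itv /= lte_fin p0 oppr0 addr0 -EFinM mulVf //.
    by rewrite gt_eqF.
  transitivity (1 - m `]0%R, (2 * pi)%R[%classic)%E; first exact: probability_setC.
  by rewrite h1 subee.
by move=> t /= ht; rewrite in_itv /=.
Qed.

(** The Poisson kernel, as [2 re (1 / (1 - w)) - 1] with [w = z e^(-it)]: its integrals reduce to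
    those of the Cauchy kernel in [CI_psum]. *)
Definition pois z (t : R) : R := 2 * re (psum (fun=> 1) (z * cj (expi t))) - 1.

Let one_bounded : cbounded (fun=> 1 : C) 1.
Proof. by move=> n; rewrite cmod1. Qed.

Lemma cmod_zcj z t : cmod (z * cj (expi t)) = cmod z.
Proof. by rewrite cmodM cmod_cj cmod_expi mulr1. Qed.

Lemma poisE z t : cmod z < 1 ->
  pois z t = (1 - cmod z ^+ 2) / cmod (1 - z * cj (expi t)) ^+ 2.
Proof.
move=> z1; rewrite /pois -(cmod_zcj z t); set w := z * _.
have w1 : cmod w < 1 by rewrite cmod_zcj.
rewrite cmod_geo //.
have n0 : 1 - w != 0.
  by apply/eqP => /eqP; rewrite subr_eq0 => /eqP h; move: w1; rewrite -h cmod1 ltxx.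
have d0 : 0 < cmod (1 - w) ^+ 2 by rewrite exprn_gt0 // cmod_gt0.
have -> : (1 - w)^-1 = rc (cmod (1 - w) ^+ 2)^-1 * cj (1 - w).
  apply: (mulfI n0); rewrite divff // mulrCA mul_cj -rcM mulVf ?rc1 //.
  by rewrite gt_eqF.
have -> : re (rc (cmod (1 - w) ^+ 2)^-1 * cj (1 - w)) = (1 - re w) / cmod (1 - w) ^+ 2.
  by rewrite !reimE mul0r subr0 mulrC.
have E : cmod (1 - w) ^+ 2 = 1 - 2 * re w + cmod w ^+ 2.
  by rewrite !cmod_sqE !reimE; ring.
apply: (mulIf (lt0r_neq0 d0)); rewrite mulrBl mul1r -mulrA !divfK ?(lt0r_neq0 d0) // E.
by ring.
Qed.

Lemma pois_ge0 z t : cmod z < 1 -> 0 <= pois z t.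
Proof.
move=> z1; rewrite poisE // divr_ge0 ?sqr_ge0 // subr_ge0.
by rewrite exprn_ile1 ?cmod_ge0 // ltW.
Qed.

Lemma pois_continuous z : cmod z < 1 -> continuous (pois z).
Proof.
move=> z1 t; apply: cvgB; last exact: cvg_cst.
apply: cvgM; first exact: cvg_cst.
exact: (ccont_re (ccont_psum one_bounded z1)).
Qed.

Lemma RI_pois z : cmod z < 1 -> RI (pois z) = 1.
Proof.
move=> z1; have cK := ccont_psum one_bounded z1.
have iK : ri (fun t => re (psum (fun=> 1) (z * cj (expi t)))) by case: (ccont_cint cK).
rewrite /pois RIB ?RI_cst ?RIZ // -?re_CI; [|exact: riZ|exact: ri_cst].
by rewrite CI_cauchy1 // re1; lra.
Qed.

Lemma cint_pois u z : cint u -> cmod z < 1 -> cint (fun t => u t * rc (pois z t)).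
Proof.
move=> hu z1; apply: (@cint_bounded_mul _ _ _ (2 / (1 - cmod z) + 1)) => //.
  exact/ccont_rc/pois_continuous.
move=> t; rewrite cmod_rc /pois; apply: le_trans (ler_normB _ _) _; rewrite normr1 lerD2r.
rewrite normrM ger0_norm // ler_pM2l //; apply: le_trans (abs_re _) _.
by rewrite -[in leRHS](cmod_zcj z t) -div1r; apply: psum_bound one_bounded _; rewrite cmod_zcj.
Qed.

(** The Poisson kernel is [K + cj K - 1], with [K] the Cauchy kernel. [K] sums the coefficients of
    index at least 0; by the vanishing of the negative ones [cj K] keeps the constant term only,
    which the -1 removes. *)
Lemma poisson_formula u z : cint u -> cmod z < 1 ->
  (forall n, CI (fun t => u t * expi t ^+ n.+1) = 0) ->
  CI (fun t => u t * rc (pois z t)) = psum (fun n => CI (fun t => u t * cj (expi t) ^+ n)) z.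
Proof.
move=> hu z1 neg; have cK := ccont_psum one_bounded z1.
have Kb t : cmod (psum (fun=> 1) (z * cj (expi t))) <= 1 / (1 - cmod z).
  by rewrite -[in leRHS](cmod_zcj z t); apply: psum_bound one_bounded _; rewrite cmod_zcj.
have i1 : cint (fun t => u t * psum (fun=> 1) (z * cj (expi t))) by exact: cint_bounded_mul hu cK Kb.
have i2 : cint (fun t => cj (u t) * psum (fun=> 1) (z * cj (expi t))).
  exact: cint_bounded_mul (cint_cj hu) cK Kb.
have E t : u t * rc (pois z t) = u t * psum (fun=> 1) (z * cj (expi t)) +
    cj (cj (u t) * psum (fun=> 1) (z * cj (expi t))) - u t.
  set K := psum _ _; rewrite cjM cjK -[X in _ = _ - X]mulr1 -mulrDr -mulrBr; congr (_ * _).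
  by apply: cE; rewrite /pois -/K !reimE /=; ring.
under eq_CI do rewrite E.
rewrite CIB //; [|by apply: cintD => //; exact: cint_cj].
rewrite CID //; [|exact: cint_cj].
rewrite (CI_cj i2) (CI_psum hu one_bounded z1) (CI_psum (cint_cj hu) one_bounded z1).
have -> : (fun n => 1 * CI (fun t => cj (u t) * cj (expi t) ^+ n)) =
    (fun n => (n == 0%N)%:R * cj (CI u)).
  apply/funext => -[|n]; rewrite mul1r.
    by rewrite mul1r -(CI_cj hu); apply: eq_CI => t; rewrite expr0 mulr1.
  rewrite mul0r -(cj0 R) -(neg n) -CI_cj; last first.
    apply: (@cint_bounded_mul _ _ _ 1) => //; first exact/ccontX/ccont_expi.
    by move=> t; rewrite cmodX cmod_expi expr1n.
  by apply: eq_CI => t; rewrite cjM cjX.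
rewrite psum_delta // expr0 mulr1 cjK addrK; congr psum; apply/funext => n.
by rewrite mul1r.
Qed.

Lemma one_sub_cos (x : R) : 1 - cos x = 2 * sin (x / 2) ^+ 2.
Proof.
have E : cos x = cos (x / 2 + x / 2) by congr cos; lra.
rewrite E cosD -!expr2; have := cos2Dsin2 (x / 2); lra.
Qed.

(** Near 0 this comes from the derivative of [sin]. On the rest of [[- A, A]] the function [1 - cos]
    has a positive minimum, as [A < 2 * pi] keeps away from its next zero. *)
Lemma cos_low (A : R) : 0 < A -> A < 2 * pi ->
  exists2 k : R, 0 < k & forall x, `|x| <= A -> k * x ^+ 2 <= 1 - cos x.
Proof.
move=> A0 A2; have h2 : (0 : R) < 1 / 2 by lra.
have [d d0 H] := is_derive_small (is_derive_sin 0) h2.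
have small x : `|x| < 2 * d -> 1 / 8 * x ^+ 2 <= 1 - cos x.
  move=> xd; have := H (x / 2); rewrite !add0r sin0 cos0 subr0 mul1r normrM.
  have -> : `|2^-1 : R| = 1 / 2 by rewrite ger0_norm; lra.
  have xd2 : `|x| * (1 / 2) < d by lra.
  move=> /(_ xd2) h; rewrite one_sub_cos -(normr_sq (sin _)) -(normr_sq x).
  have h3 : `|x| / 4 <= `|sin (x / 2)|.
    have := ler_normB (sin (x / 2)) (sin (x / 2) - x / 2); rewrite subKr normrM.
    have -> : `|2^-1 : R| = 1 / 2 by rewrite ger0_norm; lra.
    lra.
  have : (`|x| / 4) ^+ 2 <= `|sin (x / 2)| ^+ 2 by rewrite ler_pXn2r ?nnegrE ?divr_ge0.
  by rewrite expr_div_n; lra.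
have [dA|Ad] := ltP A (2 * d).
  by exists (1 / 8) => [|x xA]; [lra|apply: small; lra].
have cc : continuous (fun x : R => 1 - cos x).
  by move=> x; apply: cvgB; [exact: cvg_cst|exact: continuous_cos].
have [y yI ymin] := @EVT_min R (fun x => 1 - cos x) (2 * d) A Ad (continuous_subspaceT cc).
set M := 1 - cos y in ymin.
have M0 : 0 < M.
  rewrite /M one_sub_cos mulr_gt0 // exprn_gt0 // sin_gt0_pi //.
  by move: yI; rewrite in_itv /= => /andP[y1 y2]; apply/andP; split; lra.
exists (Num.min (1 / 8) (M / A ^+ 2)); first by rewrite lt_min !divr_gt0 // exprn_gt0.
move=> x xA; have [xd|dx] := ltP `|x| (2 * d).
  by apply: le_trans (small x xd); rewrite ler_wpM2r ?sqr_ge0 // ge_min lexx.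
have -> : cos x = cos `|x| by case: (ger0P x) => // _; rewrite cosN.
apply: le_trans (ymin `|x| _); last by rewrite in_itv /= dx.
apply: (@le_trans _ _ (M / A ^+ 2 * x ^+ 2)).
  by rewrite ler_wpM2r ?sqr_ge0 // ge_min lexx orbT.
rewrite mulrAC ler_pdivrMr ?exprn_gt0 // ler_pM2l // -(normr_sq x).
by rewrite ler_pXn2r ?nnegrE ?(ltW A0).
Qed.

(** [|1 - r e^(i(q - t))|^2 = (1 - r)^2 + 2 r (1 - cos (t - q))], where [2 * r >= 1]. As [q] is
    interior, [|t - q|] stays below some [A < 2 * pi] and [cos_low] applies. *)
Lemma pois_upper (q : R) : 0 < q -> q < 2 * pi -> exists2 K : R, 0 < K &
  forall r t : R, 1 / 2 <= r -> r < 1 -> 0 <= t <= 2 * pi ->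
    pois (rc r * expi q) t <= K * ((1 - r) / ((1 - r) ^+ 2 + (t - q) ^+ 2)).
Proof.
move=> q0 q2; pose A := Num.max q (2 * pi - q).
have A0 : 0 < A by rewrite lt_max q0.
have A2 : A < 2 * pi by rewrite gt_max q2 /=; lra.
have [k k0 Hk] := cos_low A0 A2.
pose l := Num.min 1 k; have l0 : 0 < l by rewrite lt_min ltr01.
have [l1 lk] : l <= 1 /\ l <= k by split; rewrite ge_min lexx ?orbT.
exists (2 / l); first by rewrite divr_gt0.
move=> r t r2 r1 ht; have r0 : 0 <= r by lra.
have z1 : cmod (rc r * expi q : C) < 1 by rewrite cmod_circle.
rewrite poisE // cmod_circle //.
have E : cmod (1 - rc r * expi q * cj (expi t)) ^+ 2 = (1 - r) ^+ 2 + 2 * r * (1 - cos (t - q)).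
  rewrite cmod_sqE !reimE ?re_expi ?im_expi cosB.
  have := cos2Dsin2 q; have := cos2Dsin2 t; set a := cos t; set b := sin t; set a' := cos q.
  set b' := sin q => h1 h2.
  transitivity (1 - 2 * r * (a * a' + b * b') + r ^+ 2 * ((a ^+ 2 + b ^+ 2) * (a' ^+ 2 + b' ^+ 2))).
    by ring.
  by rewrite h1 h2; ring.
have tA : `|t - q| <= A.
  have [Aq Aq'] : q <= A /\ 2 * pi - q <= A by split; rewrite le_max lexx ?orbT.
  by rewrite ler_norml; lra.
have h := Hk _ tA.
have D0 : 0 < (1 - r) ^+ 2 + (t - q) ^+ 2.
  by apply: ltr_wpDr; rewrite ?sqr_ge0 // exprn_gt0 // subr_gt0.
have low : l * ((1 - r) ^+ 2 + (t - q) ^+ 2) <= cmod (1 - rc r * expi q * cj (expi t)) ^+ 2.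
  rewrite E mulrDr; apply: lerD; first by rewrite ler_piMl // sqr_ge0.
  apply: le_trans (_ : k * (t - q) ^+ 2 <= _); first by rewrite ler_wpM2r // sqr_ge0.
  apply: le_trans h _; rewrite ler_peMl ?subr_ge0 ?cos_max //; lra.
apply: (@le_trans _ _ ((2 * (1 - r)) / (l * ((1 - r) ^+ 2 + (t - q) ^+ 2)))).
  have L0 := mulr_gt0 l0 D0; apply: ler_pM => //.
  - by rewrite subr_ge0 exprn_ile1 // ltW.
  - by rewrite invr_ge0 sqr_ge0.
  - by have : 0 <= (1 - r) ^+ 2 := sqr_ge0 _; rewrite sqrrB expr1n; lra.
  - by rewrite lef_pV2 ?posrE // (lt_le_trans L0).
by rewrite le_eqVlt; apply/orP; left; apply/eqP; field; rewrite (gt_eqF l0) (gt_eqF D0).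
Qed.

(** The Lebesgue point condition at [q]: over windows of radius [p], the deviation from [g q]
    integrates to [o(p)]. *)
Definition near_mean g q := forall e : R, 0 < e -> exists2 n : R, 0 < n &
  forall p : R, 0 < p -> p <= n -> RI (fun s => `|g s - g q| * (`|s - q| < p)%R%:R) <= e * p.

Lemma dyadic_scale (d n : R) : 0 < d -> d <= n ->
  exists J, 2 ^+ J * d <= n /\ n < 2 ^+ J.+1 * d.
Proof.
move=> d0 dn.
have ex : exists k, n < 2 ^+ k * d.
  have := @cvg_geometric R n 2^-1; rewrite ger0_norm ?invf_lt1 ?invr_ge0 // ltr1n => /(_ isT).
  move=> /cvgrPdist_lt /(_ _ d0) [k _ hk]; exists k.
  have := hk k (leqnn k); rewrite /geometric /= sub0r normrN exprVn.
  rewrite ger0_norm ?divr_ge0 ?exprn_ge0 //; last by lra.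
  by rewrite ltr_pdivrMr ?exprn_gt0 // mulrC.
case: (ex_minnP ex) => -[|k] hk mk.
  by move: hk; rewrite expr0 mul1r; lra.
exists k; split => //; rewrite leNgt; apply/negP => /mk; by rewrite ltnn.
Qed.

(** The bell-shaped kernel is dominated by indicators of the windows [|x| < 2 ^+ j * d], over which
    [near_mean] controls integrals, plus a constant that covers the part outside them. Between
    [2 ^+ j * d] and [2 ^+ j.+1 * d] the kernel is at most [1 / (4 ^+ j * d)], hence the 4 in the
    weights. *)
Lemma dyadic_bound (d x n : R) J : 0 < d -> 2 ^+ J * d <= n -> n < 2 ^+ J.+1 * d ->
  d / (d ^+ 2 + x ^+ 2) <=
  \sum_(j < J.+1) 4 / (4 ^+ j * d) * (`|x| < 2 ^+ j * d)%R%:R + 4 * d / n ^+ 2.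
Proof.
move=> d0 Jn nJ.
have n0 : 0 < n by apply: lt_le_trans Jn; rewrite mulr_gt0 // exprn_gt0.
have dx : 0 < d ^+ 2 + x ^+ 2 by apply: ltr_wpDr; rewrite ?sqr_ge0 // exprn_gt0.
have tail0 : 0 <= 4 * d / n ^+ 2 by rewrite divr_ge0 ?sqr_ge0 // mulr_ge0 // ltW.
have term0 (j : nat) : 0 <= 4 / (4 ^+ j * d) * (`|x| < 2 ^+ j * d)%R%:R.
  by rewrite mulr_ge0 // divr_ge0 // mulr_ge0 ?exprn_ge0 // ltW.
have one (j : 'I_J.+1) (v : R) : `|x| < 2 ^+ j * d -> v <= 4 / (4 ^+ j * d) ->
  v <= \sum_(j < J.+1) 4 / (4 ^+ j * d) * (`|x| < 2 ^+ j * d)%R%:R + 4 * d / n ^+ 2.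
  move=> xj vj; apply: ler_wpDr => //; rewrite (bigD1 j) //= xj mulr1.
  by apply: ler_wpDr => //; apply: sumr_ge0.
have far (j : nat) : 2 ^+ j * d <= `|x| -> d / (d ^+ 2 + x ^+ 2) <= 1 / (4 ^+ j * d).
  move=> h; rewrite ler_pdivrMr // mulrAC ler_pdivlMr ?mulr_gt0 ?exprn_gt0 // mul1r.
  have : (2 ^+ j * d) ^+ 2 <= x ^+ 2.
    by rewrite -(normr_sq x) ler_pXn2r ?nnegrE ?mulr_ge0 ?exprn_ge0 // ltW.
  rewrite exprMn -exprM mulnC exprM (_ : 2 ^+ 2 = 4 :> R); last by ring.
  by have := sqr_ge0 d; rewrite !expr2; lra.
have [ex|nex] := pselect (exists j, (j < J.+1)%N && (`|x| < 2 ^+ j * d)).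
  case: (ex_minnP ex) => -[|j] /andP[jJ xj] mj.
    apply: (one (Ordinal jJ)) => //=; rewrite expr0 mul1r.
    apply: (@le_trans _ _ (1 / d)); last by rewrite ler_pM2r ?invr_gt0 // ler1n.
    rewrite ler_pdivrMr // div1r mulrC ler_pdivlMr //.
    by have := sqr_ge0 x; rewrite !expr2; lra.
  apply: (one (Ordinal jJ)) => //=.
  have -> : 4 / (4 ^+ j.+1 * d) = 1 / (4 ^+ j * d).
    by rewrite exprS; field; rewrite (gt_eqF d0) expf_neq0.
  apply: far; rewrite leNgt; apply/negP => h.
  by have := mj j; rewrite (ltn_trans (ltnSn j) jJ) h ltnn => /(_ isT).
have xJ : 2 ^+ J * d <= `|x|.
  by rewrite leNgt; apply/negP => h; apply: nex; exists J; rewrite ltnSn.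
have := far J xJ => h; apply: le_trans h _; apply: ler_wpDl.
  by apply: sumr_ge0.
rewrite ler_pdivlMr ?exprn_gt0 // mulrAC mul1r ler_pdivrMr ?mulr_gt0 ?exprn_gt0 //.
have : n ^+ 2 <= (2 ^+ J.+1 * d) ^+ 2.
  by rewrite ler_pXn2r ?nnegrE ?ltW //; apply: le_lt_trans nJ; exact: ltW.
rewrite exprMn -exprM mulnC exprM (_ : 2 ^+ 2 = 4 :> R); last by ring.
by have -> : 4 * d * (4 ^+ J * d) = 4 ^+ J.+1 * d ^+ 2 by rewrite exprS; ring.
Qed.

Lemma ri_mul_bool g (P : R -> bool) : measurable_fun setT P -> ri g ->
  ri (fun s => g s * (P s)%:R).
Proof.
move=> mP hg; have mg := ri_meas hg.
have -> : (fun s => g s * (P s)%:R) = (fun s => if P s then g s else 0).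
  by apply/funext => s; case: (P s); rewrite ?mulr1 ?mulr0.
apply: (@ri_le _ _ (fun s => `|g s|)); last exact: integrable_norm hg.
  by apply: measurable_fun_if => //; apply: measurable_funTS.
by move=> t; case: (P t) => //; rewrite normr0.
Qed.

Lemma ri_near g q p : ri g -> ri (fun s => `|g s - g q| * (`|s - q| < p)%R%:R).
Proof.
move=> hg; apply: ri_mul_bool.
  apply: measurable_fun_ltr => //; apply: measurableT_comp => //.
  exact: measurable_funB.
by apply: ri_abs; apply: riB => //; exact: ri_cst.
Qed.

Lemma poisson_cvg g q : ri g -> 0 < q -> q < 2 * pi -> near_mean g q ->
  forall e : R, 0 < e -> exists2 d : R, 0 < d & forall r, 1 - d < r -> r < 1 ->
    `|RI (fun t => g t * pois (rc r * expi q) t) - g q| <= e.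
Proof.
move=> hg q0 q2 hm e e0.
have [K K0 HK] := pois_upper q0 q2.
(* The j-th window contributes [4 * (e / (32 * K)) / 2 ^+ j]; the sum, multiplied by [K], is at most
   [e / 4]. *)
have e1 : 0 < e / (32 * K) by rewrite divr_gt0 // mulr_gt0.
have [n n0 Hn] := hm _ e1.
pose G s := `|g s - g q|.
have hG : ri G by apply: ri_abs; apply: riB => //; exact: ri_cst.
pose I := RI G; have I0 : 0 <= I by apply: RI_ge0 => t; exact: normr_ge0.
(* For [D <= d1] the constant tail contributes at most [e / 2 * (I / (I + 1))]. *)
pose d1 := e * n ^+ 2 / (8 * K * (I + 1)).
have d10 : 0 < d1.
  by rewrite divr_gt0 ?mulr_gt0 ?exprn_gt0 // ltr_wpDl.
pose d := Num.min (1 / 2) (Num.min n d1).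
have d0 : 0 < d by rewrite !lt_min n0 d10 divr_gt0.
have [dh dn dd1] : [/\ d <= 1 / 2, d <= n & d <= d1] by split; rewrite !ge_min lexx ?orbT.
exists d => // r rd r1; pose D := 1 - r.
have D0 : 0 < D by rewrite subr_gt0.
have Dd : D < d by rewrite /D; lra.
have r2 : 1 / 2 <= r by lra.
have r0 : 0 <= r by lra.
have z1 : cmod (rc r * expi q : C) < 1 by rewrite cmod_circle.
have [J [Jn nJ]] := dyadic_scale D0 (ltW (lt_le_trans Dd dn)).
have hP : ri (pois (rc r * expi q)) by apply/ri_cont/pois_continuous.
have ubP (f : R -> R) : ri f -> ri (fun t => f t * pois (rc r * expi q) t).
  move=> hf; have [] := @cint_pois (fun t => rc (f t)) (rc r * expi q) _ z1.
    by split => //; exact: ri_cst.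
  by move=> + _; congr ri; apply/funext => t; rewrite reM re_rc im_rc mul0r subr0.
have -> : g q = RI (fun t => g q * pois (rc r * expi q) t) by rewrite RIZ // RI_pois // mulr1.
rewrite -RIB; [|exact: ubP|exact: riZ].
have i1 : ri (fun t => G t * pois (rc r * expi q) t) by exact: ubP.
apply: (@le_trans _ _ (RI (fun t => G t * pois (rc r * expi q) t))).
  have i2 : ri (fun t => g t * pois (rc r * expi q) t - g q * pois (rc r * expi q) t).
    by apply: riB; [exact: ubP|exact: riZ].
  apply: le_trans (le_normr_Rintegral _ _) _ => //.
  rewrite le_eqVlt; apply/orP; left; apply/eqP/eq_RI => t.
  by rewrite -mulrBl normrM (ger0_norm (pois_ge0 t z1)).
pose B (j : nat) := 4 / (4 ^+ j * D).
have iB (j : nat) : ri (fun s => B j * (G s * (`|s - q| < 2 ^+ j * D)%R%:R)).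
  by apply: riZ; exact: ri_near.
have [iS1 iS2] := RI_sum J.+1 iB.
pose U s := K * (\sum_(j < J.+1) B j * (G s * (`|s - q| < 2 ^+ j * D)%R%:R) + 4 * D / n ^+ 2 * G s).
have iU : ri U by apply: riZ; apply: riD => //; exact: riZ.
apply: (@le_trans _ _ (RI U)).
  apply: le_RI_ae => //; apply: aeS ae_circle => t ht'.
  have ht : 0 <= t <= 2 * pi by lra.
  apply: (@le_trans _ _ (G t * (K * (D / (D ^+ 2 + (t - q) ^+ 2))))).
    by apply: ler_wpM2l; [exact: normr_ge0|exact: HK].
  rewrite /U mulrCA ler_pM2l //.
  apply: (@le_trans _ _ (G t * (\sum_(j < J.+1) B j * (`|t - q| < 2 ^+ j * D)%R%:R + 4 * D / n ^+ 2))).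
    by apply: ler_wpM2l; [exact: normr_ge0|exact: dyadic_bound].
  rewrite mulrDr mulr_sumr [X in _ + X]mulrC le_eqVlt; apply/orP; left; apply/eqP.
  by congr (_ + _); apply: eq_bigr => j _; rewrite mulrCA.
rewrite /U RIZ ?RID ?iS2 //; [|exact: riZ|by apply: riD => //; exact: riZ].
rewrite RIZ // -/I mulrDr [leRHS]splitr; apply: lerD.
  apply: (@le_trans _ _ (K * \sum_(j < J.+1) (4 * (e / (32 * K)) * (1 / 2) ^+ j))).
    rewrite ler_pM2l //; apply: ler_sum => j _; rewrite RIZ; last exact: ri_near.
    have jJ : (j <= J)%N by rewrite -ltnS.
    have j2 : 2 ^+ j * D <= n.
      by apply: le_trans Jn; rewrite ler_pM2r // ler_eXn2l // ltr1n.
    have j0 : 0 < 2 ^+ j * D by rewrite mulr_gt0 // exprn_gt0.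
    apply: (@le_trans _ _ (B j * (e / (32 * K) * (2 ^+ j * D)))).
      by apply: ler_wpM2l; [rewrite divr_ge0 // mulr_ge0 ?exprn_ge0 // ltW|exact: Hn].
    rewrite le_eqVlt; apply/orP; left; apply/eqP.
    rewrite /B; have -> : 4 ^+ j = 2 ^+ j * 2 ^+ j :> R by rewrite -exprMn; congr (_ ^+ _); ring.
    rewrite div1r exprVn; field.
    by rewrite (gt_eqF K0) (gt_eqF D0) expf_neq0.
  rewrite -mulr_sumr; apply: (@le_trans _ _ (K * (4 * (e / (32 * K)) * 2))).
    rewrite ler_pM2l // ler_pM2l; last by rewrite mulr_gt0.
    have h2 : 0 <= 1 / 2 :> R by lra.
    have := @geo_le R (1 / 2) J.+1 h2; have -> : (1 - 1 / 2)^-1 = 2 :> R by field.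
    apply; lra.
  have -> : K * (4 * (e / (32 * K)) * 2) = e / 4 by field; rewrite gt_eqF.
  lra.
apply: (@le_trans _ _ (K * (4 * d1 / n ^+ 2 * I))).
  rewrite ler_pM2l //; apply: ler_wpM2r => //; rewrite ler_pM2r ?invr_gt0 ?exprn_gt0 //.
  by rewrite ler_pM2l // ltW // (lt_le_trans Dd).
have -> : K * (4 * d1 / n ^+ 2 * I) = e / 2 * (I / (I + 1)).
  by rewrite /d1; field; rewrite (gt_eqF n0) (gt_eqF K0) gt_eqF // ltr_wpDl.
rewrite ler_piMr //; first by rewrite divr_ge0 // ltW.
by rewrite ler_pdivrMr ?ltr_wpDl // mul1r lerDl.
Qed.

Lemma near_mean_ae g : ri g -> \forall q \ae m, near_mean g q.
Proof.
move=> hg; have mg := ri_meas hg; have p0 := two_pi_gt0 R.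
have gi : mu.-integrable `[0, 2 * pi] (EFin \o g).
  apply/integrableP; split; first by apply/measurable_EFinP; exact: measurable_funTS.
  case/integrableP: hg => _.
  rewrite (integral_uniform (two_pi_gt0 R)) //; last by apply/measurableT_comp => //; exact/measurable_EFinP.
  rewrite subr0 => h; have k0 : (0 < (2 * pi)^-1 :> R) by rewrite invr_gt0.
  move: h; rewrite !ltey; apply: contraNneq => ->.
  by rewrite mulry gtr0_sg ?mul1e.
have /integrable_locally/lebesgue_differentiation/ae_lebesgue := gi => /(_ (measurable_itv _)) h.
apply: aeS (aeI h ae_circle) => q [hq /andP[q0 q2]] e e0.
pose g0 := g \_ `[0, 2 * pi].
have g0q : g0 q = g q.
  by rewrite /g0 patchE mem_set //= in_itv /= (ltW q0) (ltW q2).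
(* The window has length [2 * p] and [m] has density [1 / (2 * pi)], so an average below [e * pi]
   gives the integral [e * p]. *)
have pe0 : 0 < e * pi by rewrite mulr_gt0 // pi_gt0.
have := hq; rewrite /lebesgue_pt => /fine_cvgP [hfin /cvgrPdist_lt /(_ _ pe0) hlt].
have /nbhs_ballP[n1 /= n10 H1] : nbhs (0 : R) (fun x => 0 < x -> davg g0 q x \is a fin_num) := hfin.
have /nbhs_ballP[n2 /= n20 H2] : nbhs (0 : R) (fun x => 0 < x -> `|0 - fine (davg g0 q x)| < e * pi).
  exact: hlt.
pose n := Num.min n1 n2; have n0 : 0 < n by rewrite lt_min n10.
exists (n / 2); first by rewrite divr_gt0.
move=> p pp pn.
have [pn1 pn2] : p < n1 /\ p < n2.
  have : p < n by lra.
  by rewrite lt_min => /andP.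
have pb (k : R) : p < k -> ball (0 : R) k p by move=> pk; rewrite /ball /= sub0r normrN gtr0_norm.
have := H1 p (pb _ pn1) pp; have := H2 p (pb _ pn2) pp; rewrite sub0r normrN.
have p2 : 0 < p *+ 2 by rewrite mulrn_wgt0.
pose X := (\int[mu]_(y in ball q p) `|(g0 y - g0 q)%:E|)%E.
have -> : davg g0 q p = ((p *+ 2)^-1%:E * X)%E.
  by rewrite /davg /iavg lebesgue_measure_ball ?ltW // inver gt_eqF.
move=> Dlt Dfin.
have X0 : (0 <= X)%E by exact: integral_ge0.
have Xlt : (X <= (e * pi * (p *+ 2))%:E)%E.
  have -> : X = ((p *+ 2)%:E * ((p *+ 2)^-1%:E * X))%E.
    by rewrite muleA -EFinM mulfV ?mul1e // gt_eqF.
  rewrite -[((p *+ 2)^-1%:E * X)%E]fineK // -EFinM lee_fin mulrC ler_pM2r //.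
  by apply: le_trans (ltW Dlt); exact: ler_norm.
have inear : ri (fun s => `|g s - g q| * (`|s - q| < p)%R%:R) by exact: ri_near.
rewrite -lee_fin /RI /Rintegral fineK; last first.
  exact: (integrable_fin_num measurableT inear).
rewrite (integral_uniform (two_pi_gt0 R)); last 2 first.
- by apply/measurable_EFinP; exact: (ri_meas inear).
- by move=> x; rewrite lee_fin mulr_ge0.
rewrite subr0; apply: (@le_trans _ _ ((2 * pi)^-1%:E * X)%E); last first.
  apply: (@le_trans _ _ ((2 * pi)^-1%:E * (e * pi * (p *+ 2))%:E)%E).
    by apply: lee_wpmul2l => //; rewrite lee_fin invr_ge0 ltW.
  rewrite -EFinM lee_fin le_eqVlt; apply/orP; left; apply/eqP.
  have -> : e * pi * (p *+ 2) = 2 * pi * (e * p) by rewrite -mulr_natl; ring.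
  by rewrite mulKf // gt_eqF.
apply: lee_wpmul2l; first by rewrite lee_fin invr_ge0 ltW.
have mg0 : measurable_fun setT g0.
  by apply/(measurable_restrictT _ _).1 => //; exact: measurable_funTS.
rewrite /X integral_mkcond [leRHS]integral_mkcond; apply: ge0_le_integral => //.
- by move=> x _; apply: erestrict_ge0 => y _; rewrite lee_fin mulr_ge0.
- apply/(measurable_restrictT _ _).1 => //; apply: measurable_funTS.
  by apply/measurable_EFinP; exact: (ri_meas inear).
- apply/(measurable_restrictT _ _).1; first exact: measurable_ball.
  apply: measurable_funTS; apply: measurableT_comp => //; apply/measurable_EFinP.
  exact: measurable_funB.
move=> x _; rewrite !patchE; case: ifPn => [|_]; last first.
  by case: ifPn => // _; rewrite lee_fin.
rewrite inE /= in_itv /= => hx.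
have [xb|xb] := ltP `|x - q| p.
  rewrite ifT; last by rewrite inE /ball /= distrC.
  by rewrite mulr1 g0q /g0 patchE mem_set //= in_itv.
by rewrite mulr0; case: ifPn => // _; rewrite lee_fin.
Qed.

End PoissonFatou.

(** * Riesz-Fischer theorem and radial limits of power series in H^2 *)

Section RieszFischer.
Variable R : realType.
Local Notation C := (Cplx R).
Local Notation re := (@complex.Re R).
Local Notation im := (@complex.Im R).
Local Notation m := (uniform_prob (two_pi_gt0 R)).
Implicit Types (a b : nat -> C) (z w : C) (u h g : R -> C).

Lemma norm_half_lt1 : `|1 / 2 : R| < 1. Proof. by rewrite ger0_norm; lra. Qed.
Lemma eighth_small (e : R) : 0 < e -> exists n, forall k, (n <= k)%N -> (1 / 8) ^+ k < e.
Proof.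
move=> e0; have h8 : `|1 / 8 : R| < 1 by rewrite ger0_norm; lra.
have /cvgrPdist_lt /(_ _ e0) [n _ Hn] := @cvg_geometric R 1 (1 / 8) h8.
exists n => k /Hn; rewrite /geometric /= sub0r normrN (mul1r (_ ^+ _)).
by apply: le_lt_trans; exact: ler_norm.
Qed.

Definition cmeas u := measurable_fun setT (fun t => re (u t)) /\ measurable_fun setT (fun t => im (u t)).
Definition csq u := ri (fun t => cmod (u t) ^+ 2).

Lemma cmeas_cmod u : cmeas u -> measurable_fun setT (fun t => cmod (u t)).
Proof. by case; exact: measurable_cmod. Qed.

Lemma csq_cint u : cmeas u -> csq u -> cint u.
Proof.
move=> [m1 m2] h; apply: (@cint_le _ _ (fun t => 1 + cmod (u t) ^+ 2)) => //.
  by move=> t; exact: sqr_le1.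
by apply: riD => //; exact: ri_cst.
Qed.

Lemma cmeasD u h : cmeas u -> cmeas h -> cmeas (fun t => u t + h t).
Proof.
move=> [u1 u2] [h1 h2]; split; [under eq_fun do rewrite reD|under eq_fun do rewrite imD];
  exact: measurable_funD.
Qed.
Lemma cmeasM u h : cmeas u -> cmeas h -> cmeas (fun t => u t * h t).
Proof.
move=> [u1 u2] [h1 h2]; split; [under eq_fun do rewrite reM|under eq_fun do rewrite imM].
  by apply: measurable_funB; exact: measurable_funM.
by apply: measurable_funD; exact: measurable_funM.
Qed.
Lemma cmeas_ccont u : ccont u -> cmeas u.
Proof. by move=> h; split; apply: continuous_measurable_fun; [exact: ccont_re|exact: ccont_im]. Qed.
Lemma cmeas_cj u : cmeas u -> cmeas (fun t => cj (u t)).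
Proof.
move=> [u1 u2]; split; [under eq_fun do rewrite re_cj|under eq_fun do rewrite im_cj] => //.
by apply: measurableT_comp => //; exact: u2.
Qed.
Lemma cmeasN u : cmeas u -> cmeas (fun t => - u t).
Proof.
by move=> h; under eq_fun do rewrite -mulN1r; apply: cmeasM => //; apply: cmeas_ccont; exact: ccont_cst.
Qed.

Lemma csq_le u (f : R -> R) : cmeas u -> (forall t, cmod (u t) ^+ 2 <= f t) -> ri f -> csq u.
Proof.
move=> hu h hf; apply: ri_le hf; first by apply: measurable_funX; exact: cmeas_cmod.
by move=> t; rewrite ger0_norm ?sqr_ge0.
Qed.
Lemma cmod_sqD z w : cmod (z + w) ^+ 2 <= 2 * (cmod z ^+ 2 + cmod w ^+ 2).
Proof.
apply: (@le_trans _ _ ((cmod z + cmod w) ^+ 2)).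
  by rewrite ler_pXn2r ?nnegrE ?addr_ge0 ?cmod_ge0 // cmodD.
move: (cmod z) (cmod w) => x y; rewrite -subr_ge0.
have -> : 2 * (x ^+ 2 + y ^+ 2) - (x + y) ^+ 2 = (x - y) ^+ 2 by ring.
exact: sqr_ge0.
Qed.
Lemma csqD u h : cmeas u -> cmeas h -> csq u -> csq h -> csq (fun t => u t + h t).
Proof.
move=> mu mh su sh; apply: (@csq_le _ (fun t => 2 * (cmod (u t) ^+ 2 + cmod (h t) ^+ 2))).
- exact: cmeasD.
- by move=> t; exact: cmod_sqD.
- by apply: riZ; exact: riD.
Qed.
Lemma csqN u : csq u -> csq (fun t => - u t).
Proof. by rewrite /csq; under [X in _ -> ri X]eq_fun do rewrite cmodN. Qed.
Lemma csq_ccont u : ccont u -> csq u.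
Proof.
by move=> h; apply: ri_cont => t; under eq_fun do rewrite expr2; apply: cvgM; apply: ccont_cmod.
Qed.
Lemma cint_mul u h : cmeas u -> cmeas h -> csq u -> csq h -> cint (fun t => u t * h t).
Proof.
move=> mu mh su sh; have [c1 c2] := cmeasM mu mh.
apply: (@cint_le _ _ (fun t => cmod (u t) ^+ 2 + cmod (h t) ^+ 2)) => //; last exact: riD.
move=> t; rewrite cmodM; have := sqr_ge0 (cmod (u t) - cmod (h t)); rewrite sqrrB.
have : 0 <= cmod (u t) * cmod (h t) by rewrite mulr_ge0 ?cmod_ge0.
by rewrite -mulr_natr; lra.
Qed.
Lemma CI_CS u h : cmeas u -> cmeas h -> csq u -> csq h ->
  cmod (CI (fun t => u t * h t)) ^+ 2 <=
  RI (fun t => cmod (u t) ^+ 2) * RI (fun t => cmod (h t) ^+ 2).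
Proof.
move=> mu mh su sh; apply: le_trans (RI_CS (cmeas_cmod mu) (cmeas_cmod mh) su sh).
rewrite ler_pXn2r ?nnegrE ?cmod_ge0 //; last first.
  by apply: RI_ge0 => t; rewrite mulr_ge0 ?cmod_ge0.
apply: le_trans (cmod_CI (cint_mul mu mh su sh)) _.
by rewrite le_eqVlt; apply/orP; left; apply/eqP/eq_RI => t; rewrite cmodM.
Qed.

Definition tpoly a N (t : R) : C := ppart a (expi t) N.

Lemma tpoly_ccont a N : ccont (tpoly a N).
Proof.
rewrite /tpoly /ppart; elim: N => [|N IH].
  by under eq_fun do rewrite big_ord0; exact: ccont_cst.
under eq_fun do rewrite big_ord_recr /=; apply: ccontD => //.
exact/ccontZ/ccontX/ccont_expi.
Qed.

Lemma CI_mul_tpoly u a N : cint u ->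
  CI (fun t => u t * cj (tpoly a N t)) = \sum_(i < N) CI (fun t => u t * cj (expi t) ^+ i) * cj (a i).
Proof.
move=> hu.
have hi i : cint (fun t => u t * cj (expi t) ^+ i).
  apply: (@cint_bounded_mul _ _ _ 1) => //; first exact/ccontX/ccont_cjexpi.
  by move=> t; rewrite cmodX cmod_cj cmod_expi expr1n.
have [_ E] := CI_sum N (fun i => cintZ (cj (a i)) (hi i)).
transitivity (CI (fun t => \sum_(i < N) cj (a i) * (u t * cj (expi t) ^+ i))).
  apply: eq_CI => t; rewrite /tpoly /ppart (big_morph _ (@cjD R) (cj0 R)) mulr_sumr.
  by apply: eq_bigr => i _; rewrite cjM cjX mulrCA.
by rewrite E; apply: eq_bigr => i _; rewrite CIZ // mulrC.
Qed.

Lemma tpoly_coef a N n :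
  CI (fun t => tpoly a N t * cj (expi t) ^+ n) = if (n < N)%N then a n else 0.
Proof.
have hi i : cint (fun t => @expi R t ^+ i * cj (expi t) ^+ n).
  by apply: ccont_cint; apply: ccontM; apply: ccontX; [exact: ccont_expi|exact: ccont_cjexpi].
have [_ E] := CI_sum N (fun i => cintZ (a i) (hi i)).
transitivity (CI (fun t => \sum_(i < N) a i * (expi t ^+ i * cj (expi t) ^+ n))).
  by apply: eq_CI => t; rewrite /tpoly /ppart mulr_suml; apply: eq_bigr => i _; rewrite mulrA.
rewrite E; under eq_bigr do rewrite CIZ // CI_orth.
case: ifPn => [nN|nN].
  rewrite (bigD1 (Ordinal nN)) //= eqxx mulr1 big1 ?addr0 // => i /eqP ni.
  by case: eqP => [in'|_]; rewrite ?mulr0 //; case: ni; exact: val_inj.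
rewrite big1 // => i _; case: eqP => [in'|_]; rewrite ?mulr0 //.
by move: nN; rewrite -in' ltn_ord.
Qed.

Lemma tpoly_neg a N n : CI (fun t => tpoly a N t * expi t ^+ n.+1) = 0.
Proof.
have hi i : cint (fun t => @expi R t ^+ i * expi t ^+ n.+1).
  by apply: ccont_cint; apply: ccontM; apply: ccontX; exact: ccont_expi.
have [_ E] := CI_sum N (fun i => cintZ (a i) (hi i)).
transitivity (CI (fun t => \sum_(i < N) a i * (expi t ^+ i * expi t ^+ n.+1))).
  by apply: eq_CI => t; rewrite /tpoly /ppart mulr_suml; apply: eq_bigr => i _; rewrite mulrA.
rewrite E big1 // => i _; rewrite CIZ //.
under eq_CI do rewrite -exprD; by rewrite CI_expiX addnS mulr0.
Qed.

Definition sqs a N : R := \sum_(i < N) cmod (a i) ^+ 2.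

Lemma RI_tpoly a N : RI (fun t => cmod (tpoly a N t) ^+ 2) = sqs a N.
Proof.
have := CI_mul_tpoly a N (ccont_cint (tpoly_ccont a N)); move/(congr1 re).
rewrite re_CI re_sum => E; transitivity (RI (fun t => re (tpoly a N t * cj (tpoly a N t)))).
  by apply: eq_RI => t; rewrite mul_cj.
by rewrite E; apply: eq_bigr => i _; rewrite tpoly_coef ltn_ord mul_cj.
Qed.

Lemma RI_tpoly_sub a N K : RI (fun t => cmod (tpoly a (N + K) t - tpoly a N t) ^+ 2) =
  sqs a (N + K) - sqs a N.
Proof.
pose b i := if (i < N)%N then 0 else a i.
transitivity (RI (fun t => cmod (tpoly b (N + K) t) ^+ 2)).
  apply: eq_RI => t; congr (cmod _ ^+ 2); rewrite /tpoly /ppart !big_split_ord /= [in LHS]addrAC subrr add0r.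
  rewrite [X in _ = X + _]big1 ?add0r; last by move=> i _; rewrite /b ltn_ord mul0r.
  by apply: eq_bigr => i _; rewrite /b ltnNge leq_addr.
rewrite RI_tpoly /sqs !big_split_ord /= [in RHS]addrAC subrr add0r.
rewrite [X in X + _]big1 ?add0r; last by move=> i _; rewrite /b ltn_ord cmod0 expr0n.
by apply: eq_bigr => i _; rewrite /b ltnNge leq_addr.
Qed.

Lemma sqs_nd a : nondecreasing_seq (sqs a).
Proof. by apply/nondecreasing_seqP => n; rewrite /sqs big_ord_recr /= lerDl sqr_ge0. Qed.

Lemma sqs_cvg a M : sqsum a M -> cvgn (sqs a).
Proof.
move=> h; apply: nondecreasing_is_cvgn; first exact: sqs_nd.
by exists M => _ [n _ <-]; exact: h.
Qed.

Lemma sqs_le_lim a M n : sqsum a M -> sqs a n <= limn (sqs a).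
Proof. by move=> h; apply: nondecreasing_cvgn_le; [exact: sqs_nd|exact: sqs_cvg h]. Qed.

(** Along such indices the blocks of the Fourier series have squared norms at most [(1 / 8) ^+ k],
    fast enough for convergence almost everywhere. *)
Lemma sqs_fast a M : sqsum a M -> exists N : nat -> nat, [/\ nondecreasing_seq N,
  forall k, (k <= N k)%N & forall k, limn (sqs a) - sqs a (N k) <= (1 / 8) ^+ k].
Proof.
move=> h; have [nu Hnu] : {nu : nat -> nat & forall k n, (nu k <= n)%N -> limn (sqs a) - sqs a n <= (1 / 8) ^+ k}.
  apply: (@choice _ _ (fun k N => forall n, (N <= n)%N -> limn (sqs a) - sqs a n <= (1 / 8) ^+ k)) => k.
  have e0 : 0 < (1 / 8 : R) ^+ k by rewrite exprn_gt0 // divr_gt0.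
  have /cvgrPdist_le /(_ _ e0) [N _ HN] := sqs_cvg h.
  by exists N => n /HN; apply: le_trans; exact: ler_norm.
(* Cumulative sums are monotone in [k] and exceed both [k] and [nu k]. *)
exists (fun k => (\sum_(i < k.+1) (nu i).+1)%N); split.
- by apply/nondecreasing_seqP => n; rewrite [in leRHS]big_ord_recr /= leEnat leq_addr.
- elim=> [|k IH]; first by [].
  by rewrite big_ord_recr /= (leq_ltn_trans IH) // addnS ltnS leq_addr.
- move=> k; apply: Hnu; rewrite big_ord_recr /=; apply: leq_trans (leqnSn _) _; exact: leq_addl.
Qed.

(** [h] is the L^2 function on the circle with Fourier series [sum a_n e^(int)]; it will be the
    boundary function of [psum a]. *)
Definition bfun a h := [/\ cmeas h /\ csq h, forall n, CI (fun t => h t * cj (expi t) ^+ n) = a n,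
  forall n, CI (fun t => h t * expi t ^+ n.+1) = 0 &
  sqs a N @[N --> \oo] --> RI (fun t => cmod (h t) ^+ 2)].

Lemma bessel_identity h N : cmeas h -> csq h ->
  let a n := CI (fun t => h t * cj (expi t) ^+ n) in
  RI (fun t => cmod (h t - tpoly a N t) ^+ 2) = RI (fun t => cmod (h t) ^+ 2) - sqs a N.
Proof.
move=> mh sh a; have hi := csq_cint mh sh.
pose p := tpoly a N; have cp : ccont p := tpoly_ccont a N.
have E : CI (fun t => h t * cj (p t)) = rc (sqs a N).
  rewrite CI_mul_tpoly // /sqs (big_morph (@rc R) (@rcD R) (rc0 R)).
  by apply: eq_bigr => i _; rewrite -mul_cj.
have i1 : cint (fun t => h t * cj (p t)).
  apply: cint_mul => //; [exact/cmeas_cj/cmeas_ccont|].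
  rewrite /csq; under eq_fun do rewrite cmod_cj; exact: csq_ccont.
have i3 := csq_ccont cp.
transitivity (RI (fun t => (cmod (h t) ^+ 2 + - 2 * re (h t * cj (p t))) + cmod (p t) ^+ 2)).
  by apply: eq_RI => t; rewrite !cmod_sqE !reimE; ring.
have i2 : ri (fun t => - 2 * re (h t * cj (p t))) by apply: riZ; case: i1.
rewrite RID //; last exact: riD.
rewrite RID // RIZ; last by case: i1.
by rewrite -re_CI E re_rc RI_tpoly; ring.
Qed.

(** The partial sums along [N] converge almost everywhere, and Fatou's lemma upgrades this to
    convergence in L^2. *)
Lemma riesz_fischer a M : sqsum a M -> exists h, bfun a h.
Proof.
move=> hM; have [N [Nnd Nk Nfast]] := sqs_fast hM; set L := limn (sqs a) in Nfast.
pose p k t := tpoly a (N k) t.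
have psub j k : (j <= k)%N -> RI (fun t => cmod (p k t - p j t) ^+ 2) <= (1 / 8) ^+ j.
  move=> /Nnd jk; apply: le_trans (Nfast j); rewrite /p -(subnKC jk) RI_tpoly_sub subnKC //.
  by rewrite lerD2r; exact: sqs_le_lim hM.
pose b k t := p k.+1 t - p k t.
have cb k : ccont (b k).
  apply: ccontD; first exact: tpoly_ccont.
  by under eq_fun do rewrite -mulN1r; apply: ccontZ; exact: tpoly_ccont.
(* The weight [4 ^+ k] leaves integrals at most [(1 / 2) ^+ k], so the sum [D] is integrable;
   conversely a finite [D t] forces [|b k t|] to decay like [(1 / 2) ^+ k]. *)
pose w k t := 4 ^+ k * cmod (b k t) ^+ 2.
have wi k : ri (w k) by apply: riZ; exact: csq_ccont (cb k).
have w0 k t : 0 <= w k t by rewrite /w mulr_ge0 ?exprn_ge0 ?cmod_ge0.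
pose D t := (\sum_(0 <= k <oo) (w k t)%:E)%E.
have mw k : measurable_fun setT (EFin \o w k) by apply/measurable_EFinP; exact: ri_meas (wi k).
have mD : measurable_fun setT D.
  have w0E k (t : R) : setT t -> true -> (0 <= (w k t)%:E)%E by rewrite lee_fin.
  have H := @ge0_emeasurable_sum _ _ R setT (fun k t => (w k t)%:E) xpredT w0E (fun k _ => mw k).
  exact: H.
have Dfin : (\int[m]_t D t < +oo)%E.
  rewrite /D integral_nneseries //; last by move=> n x _; rewrite lee_fin.
  apply: (@le_lt_trans _ _ (\sum_(0 <= k <oo) ((1 / 2) ^+ k)%:E)%E); last first.
    have h := @cvg_geometric_series R 1 (1 / 2) norm_half_lt1.
    have -> : (\sum_(0 <= k <oo) ((1 / 2 : R) ^+ k)%:E)%E = (1 * (1 - 1 / 2)^-1)%:E.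
      apply/cvg_lim => //; under eq_fun do rewrite sumEFin.
      apply: cvg_EFin; first by near=> n.
      move: h; apply: cvg_trans; apply: near_eq_cvg; near=> n.
      by rewrite /series /= /geometric /=; apply: eq_bigr => i _; exact: mul1r.
    exact: ltry.
  apply: lee_nneseries => [k _ _|k _]; first by apply: integral_ge0 => t _; rewrite lee_fin.
  rewrite -[X in (X <= _)%E]fineK; last exact: (integrable_fin_num measurableT (wi k)).
  rewrite lee_fin -/(Rintegral m setT (w k)) -/(RI (w k)) /w RIZ; last exact: csq_ccont (cb k).
  apply: (@le_trans _ _ (4 ^+ k * (1 / 8) ^+ k)); first by rewrite ler_pM2l ?exprn_gt0 // psub.
  by rewrite -exprMn (_ : 4 * (1 / 8) = 1 / 2 :> R) //; field.
have D0 t : (0 <= D t)%E by apply: nneseries_ge0 => n _ _; rewrite lee_fin.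
have Di : m.-integrable setT D.
  apply/integrableP; split => //; under eq_integral do rewrite gee0_abs //.
  exact: Dfin.
pose E := [set t | D t \is a fin_num].
have mE : measurable E by have := emeasurable_fin_num measurableT mD; rewrite setTI.
have Eae : \forall t \ae m, E t.
  by apply: aeS (integrable_ae measurableT Di) => t; apply.
have bE k t : E t -> cmod (b k t) <= (1 + fine (D t)) * (1 / 2) ^+ k.
  move=> Et.
  have wD : w k t <= fine (D t).
    rewrite -lee_fin fineK // /D; have := @nneseries_lim_ge R (fun k => (w k t)%:E) xpredT 0 k.+1.
    move=> h; apply: le_trans (h _); last by move=> n _ _; rewrite lee_fin.
    by rewrite big_nat_recr //= leeDr // sume_ge0 // => i _; rewrite lee_fin.
  have e2 : (0 : R) < (1 / 2) ^+ k by rewrite exprn_gt0 // divr_gt0.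
  rewrite -ler_pdivrMr //; apply: le_trans (sqr_le1 _) _; rewrite lerD2l.
  apply: le_trans wD; rewrite /w le_eqVlt; apply/orP; left; apply/eqP.
  by rewrite div1r exprVn invrK exprMn -exprM mulnC exprM mulrC; congr (_ ^+ _ * _); ring.
have pE k t : p k t = p 0%N t + \sum_(i < k) b i t.
  elim: k => [|k IH]; first by rewrite big_ord0 addr0.
  by rewrite big_ord_recr /= addrA -IH /b addrC subrK.
(* Cutting off outside [E] makes the sequence converge everywhere, so that its limit [h] is
   measurable. *)
pose H k t := rc (\1_E t) * p k t.
have Hcv (f : C -> R) t : (forall x y, f (x + y) = f x + f y) -> f 0 = 0 ->
    (forall x, `|f x| <= cmod x) -> cvgn (fun k => f (H k t)).
  move=> fD f0 fle.
  have f_sum k (F : nat -> C) : f (\sum_(i < k) F i) = \sum_(i < k) f (F i).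
    elim: k => [|k IH]; rewrite ?big_ord0 ?f0 // !big_ord_recr /= fD IH //.
  have [Et|nE] := pselect (E t); last first.
    have -> : (fun k => f (H k t)) = fun=> 0; last exact: is_cvg_cst.
    by apply/funext => k; rewrite /H indicE memNset // rc0 mul0r f0.
  have -> : (fun k => f (H k t)) = (fun k => f (p 0%N t) + series (fun i => f (b i t)) k).
    apply/funext => k; rewrite /H indicE mem_set // rc1 mul1r pE fD (f_sum k (fun i => b i t)).
    by rewrite /series /= big_mkord.
  apply: is_cvgD; first exact: is_cvg_cst.
  apply: normed_cvg; apply: (@series_le_cvg _ _ (geometric (1 + fine (D t)) (1 / 2))).
  - by move=> n /=.
  - by move=> n; rewrite /geometric /= mulr_ge0 ?exprn_ge0 ?divr_ge0 // addr_ge0 // fine_ge0.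
  - by move=> n; apply: le_trans (fle _) (bE n t Et).
  - by apply: is_cvg_geometric_series; exact: norm_half_lt1.
pose h t : C := (limn (fun k => re (H k t)) +i* limn (fun k => im (H k t)))%C.
have Hh t : clim (fun k => H k t) (h t).
  apply: cvg_clim => /=.
    by apply: Hcv => //; [exact: reD|exact: abs_re].
  by apply: Hcv => //; [exact: imD|exact: abs_im].
have mp k : cmeas (p k) by apply: cmeas_ccont; exact: tpoly_ccont.
have mH k : cmeas (H k).
  apply: cmeasM => //; split; last exact: measurable_cst.
  exact: measurable_indic.
have mh : cmeas h.
  split; [apply: (@measurable_fun_cvg _ _ _ _ (fun k t => re (H k t))) => [k|t _]
         |apply: (@measurable_fun_cvg _ _ _ _ (fun k t => im (H k t))) => [k|t _]].
  - by case: (mH k).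
  - by case: (clim_cvg (Hh t)).
  - by case: (mH k).
  - by case: (clim_cvg (Hh t)).
have mhp k : cmeas (fun t => h t - p k t) by apply: cmeasD => //; exact: cmeasN.
(* Fatou's lemma in [j], applied to [|p (k + j) - p k|^2], whose integrals are at most
   [(1 / 8) ^+ k] by [psub]. *)
have fat k : (\int[m]_t (cmod (h t - p k t) ^+ 2)%:E <= ((1 / 8) ^+ k)%:E)%E.
  pose f j t := (cmod (p (k + j)%N t - p k t) ^+ 2)%:E.
  have mf j : measurable_fun setT (f j).
    by apply/measurable_EFinP; apply: measurable_funX; apply: cmeas_cmod; apply: cmeasD => //; exact: cmeasN.
  have f0 j t : (0 <= f j t)%E by rewrite lee_fin sqr_ge0.
  have -> : (\int[m]_t (cmod (h t - p k t) ^+ 2)%:E = \int[m]_t limn_einf (f^~ t))%E.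
    apply: integral_ae; apply: aeS Eae => t Et.
    apply/esym; apply: (cvg_limn_einf_sup _).1.
    have cl : clim (fun j => p (k + j)%N t - p k t) (h t - p k t).
      apply: climD; last exact: clim_cst.
      move=> e /(Hh t)[n Hn]; exists n => j nj; have := Hn (k + j)%N (leq_trans nj (leq_addl _ _)).
      by rewrite /H indicE mem_set // rc1 mul1r.
    apply: cvg_EFin; first by near=> j.
    have [c1 c2] := clim_cvg cl.
    have -> : (fine \o f^~ t) = (fun j => re (p (k + j)%N t - p k t) ^+ 2 + im (p (k + j)%N t - p k t) ^+ 2).
      by apply/funext => j; rewrite /= cmod_sqE.
    rewrite cmod_sqE; apply: cvgD; under eq_fun do rewrite expr2; exact: cvgM.
  apply: le_trans (fatou m measurableT mf (fun j t _ => f0 j t)) _.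
  rewrite limn_einf_lim; apply: lime_le; first exact: is_cvg_einfs.
  apply: nearW => j; apply: (@le_trans _ _ (\int[m]_t f j t)%E).
    by apply: ereal_inf_lbound; exists j => //=.
  rewrite -[X in (X <= _)%E]fineK.
    by rewrite lee_fin; apply: psub; rewrite leq_addr.
  apply: (integrable_fin_num measurableT); apply: csq_ccont.
  apply: ccontD; first exact: tpoly_ccont.
  by under eq_fun do rewrite -mulN1r; apply: ccontZ; exact: tpoly_ccont.
have shp k : csq (fun t => h t - p k t).
  apply/integrableP; split.
    by apply/measurable_EFinP; apply: measurable_funX; exact: cmeas_cmod.
  under eq_integral do rewrite gee0_abs ?lee_fin ?sqr_ge0 //.
  exact: le_lt_trans (fat k) (ltry _).
have fatR k : RI (fun t => cmod (h t - p k t) ^+ 2) <= (1 / 8) ^+ k.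
  by rewrite -lee_fin /RI /Rintegral fineK //; exact: (integrable_fin_num measurableT (shp k)).
have sp k : csq (p k) by apply: csq_ccont; exact: tpoly_ccont.
have sh : csq h.
  have := csqD (mhp 0%N) (mp 0%N) (shp 0%N) (sp 0%N).
  by rewrite /csq; under eq_fun do rewrite subrK.
(* Against a unimodular [v] the coefficients of [p k] are eventually [l], and by Cauchy-Schwarz
   those of [h] differ from them by the L^2 distance at most. *)
have coefE v (l : C) : ccont v -> (forall t, cmod (v t) = 1) ->
    (exists K, forall k, (K <= k)%N -> CI (fun t => p k t * v t) = l) -> CI (fun t => h t * v t) = l.
  move=> cv v1 [K HK]; apply/eqP; rewrite -subr_eq0; apply/negPn/negP => /cmod_gt0 d0.
  set d := cmod _ in d0.
  have sv : csq v by exact: csq_ccont.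
  have mv : cmeas v by exact: cmeas_ccont.
  have [n Hn] := eighth_small (exprn_gt0 2 d0).
  have h1 := Hn (maxn n K) (leq_maxl _ _).
  have := CI_CS (mhp (maxn n K)) mv (shp _) sv.
  have -> : RI (fun t => cmod (v t) ^+ 2) = 1.
    by rewrite -(RI_cst 1); apply: eq_RI => t; rewrite v1 expr1n.
  have -> : CI (fun t => (h t - p (maxn n K) t) * v t) = CI (fun t => h t * v t) - l.
    rewrite -(HK _ (leq_maxr n K)) -CIB; [|exact: cint_mul|exact: cint_mul].
    by apply: eq_CI => t; rewrite mulrBl.
  rewrite -/d mulr1 => h2; have := le_lt_trans (le_trans h2 (fatR _)) h1.
  by rewrite ltxx.
have cf n : CI (fun t => h t * cj (expi t) ^+ n) = a n.
  apply: (coefE (fun t => cj (expi t) ^+ n)).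
  - exact/ccontX/ccont_cjexpi.
  - by move=> t; rewrite cmodX cmod_cj cmod_expi expr1n.
  - by exists n.+1 => k nk; rewrite tpoly_coef (leq_trans nk (Nk k)).
exists h; split => //.
- move=> n; apply: (coefE (fun t => expi t ^+ n.+1)).
  + exact/ccontX/ccont_expi.
  + by move=> t; rewrite cmodX cmod_expi expr1n.
  + by exists 0%N => k _; exact: tpoly_neg.
have aE : (fun n => CI (fun t => h t * cj (expi t) ^+ n)) = a by apply/funext => n; exact: cf.
have id n : RI (fun t => cmod (h t - tpoly a n t) ^+ 2) = RI (fun t => cmod (h t) ^+ 2) - sqs a n.
  by have := bessel_identity n mh sh; rewrite /= aE.
(* By Bessel's identity the squared norm is at least every partial sum, and [fatR] bounds its excess
   over [sqs a (N n)] by [(1 / 8) ^+ n]. *)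
suff -> : RI (fun t => cmod (h t) ^+ 2) = L by exact: sqs_cvg hM.
apply/eqP; rewrite eq_le; apply/andP; split.
  rewrite leNgt; apply/negP => hL.
  have e0 : 0 < RI (fun t => cmod (h t) ^+ 2) - L by rewrite subr_gt0.
  have [n Hn] := eighth_small e0; have := Hn n (leqnn n).
  by have := fatR n; rewrite /p id; have := sqs_le_lim (N n) hM; rewrite -/L; lra.
apply: limr_le; first exact: sqs_cvg hM.
apply: nearW => n; rewrite -subr_ge0 -id; apply: RI_ge0 => t; exact: sqr_ge0.
Unshelve. all: by end_near. Qed.

Definition radial (F : C -> C) (t : R) (l : C) := forall e : R, 0 < e -> exists2 d : R, 0 < d &
  forall r, 1 - d < r -> r < 1 -> cmod (F (rc r * expi t) - l) <= e.

(** [psum a] is the Poisson integral of [h], so [poisson_cvg] applies at the common Lebesgue points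
    of the real and imaginary parts of [h]. *)
Lemma radial_bfun a M h : sqsum a M -> bfun a h -> \forall t \ae m, radial (psum a) t (h t).
Proof.
move=> hM [[mh sh] ha hn _]; have hi := csq_cint mh sh; have [h1 h2] := hi.
have H := aeI (aeI (near_mean_ae h1) (near_mean_ae h2)) (ae_circle R).
apply: aeS H.
move=> t [[n1 n2] /andP[t0 t2]] e e0; have e2 : 0 < e / 2 by rewrite divr_gt0.
have [d1 d10 H1] := poisson_cvg h1 t0 t2 n1 e2.
have [d2 d20 H2] := poisson_cvg h2 t0 t2 n2 e2.
exists (Num.min 1 (Num.min d1 d2)); first by rewrite !lt_min ltr01 d10.
move=> r rd r1.
have [r0 rd1 rd2] : [/\ 0 < r, 1 - d1 < r & 1 - d2 < r].
  have [q1 q2 q3] : [/\ Num.min 1 (Num.min d1 d2) <= 1, Num.min 1 (Num.min d1 d2) <= d1 &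
    Num.min 1 (Num.min d1 d2) <= d2] by split; rewrite !ge_min lexx ?orbT.
  by split; lra.
have z1 : cmod (rc r * expi t : C) < 1 by rewrite cmod_circle // ltW.
have := poisson_formula hi z1 hn.
have -> : (fun n => CI (fun t => h t * cj (expi t) ^+ n)) = a by apply/funext => n; exact: ha.
move=> <-; apply: le_trans (cmod_le _) _; rewrite reD reN imD imN re_CI im_CI.
have -> : RI (fun s => re (h s * rc (pois (rc r * expi t) s))) =
    RI (fun s => re (h s) * pois (rc r * expi t) s).
  by apply: eq_RI => s; rewrite !reimE mulr0 subr0.
have -> : RI (fun s => im (h s * rc (pois (rc r * expi t) s))) =
    RI (fun s => im (h s) * pois (rc r * expi t) s).
  by apply: eq_RI => s; rewrite !reimE mulr0 add0r.
by rewrite [e]splitr; apply: lerD; [exact: H1|exact: H2].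
Qed.

(** By Bessel's identity the partial Fourier sums of [g] converge to it in L^2, and pairing with [h]
    is continuous. *)
Lemma bfun_ip a b h g : bfun a h -> bfun b g ->
  clim (fun N => \sum_(i < N) a i * cj (b i)) (CI (fun t => h t * cj (g t))).
Proof.
move=> [[mh sh] ha _ _] [[mg sg] gb _ gl]; have hi := csq_cint mh sh.
have bE : (fun n => CI (fun t => g t * cj (expi t) ^+ n)) = b by apply/funext => n; exact: gb.
pose X := RI (fun t => cmod (h t) ^+ 2).
have X0 : 0 <= X by apply: RI_ge0 => t; exact: sqr_ge0.
move=> e e0.
have e2 : 0 < e ^+ 2 / (X + 1) by rewrite divr_gt0 ?exprn_gt0 // ltr_wpDl.
have /cvgrPdist_lt /(_ _ e2) [N _ HN] := gl.
exists N => n /HN hn.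
have -> : \sum_(i < n) a i * cj (b i) = CI (fun t => h t * cj (tpoly b n t)).
  by rewrite CI_mul_tpoly //; apply: eq_bigr => i _; rewrite ha.
have cp := tpoly_ccont b n.
have [mp sp] := (cmeas_ccont cp, csq_ccont cp).
have scj u : csq u -> csq (fun t => cj (u t)).
  by rewrite /csq; under [X in _ -> ri X]eq_fun do rewrite cmod_cj.
rewrite cmodBC -CIB; [|by apply: cint_mul => //; [exact: cmeas_cj|exact: scj]..].
have md : cmeas (fun t => g t - tpoly b n t) by apply: cmeasD => //; exact: cmeasN.
have sd : csq (fun t => g t - tpoly b n t) by apply: csqD => //; [exact: cmeasN|exact: csqN].
have := CI_CS mh (cmeas_cj md) sh (scj _ sd).
have -> : CI (fun t => h t * cj (g t - tpoly b n t)) =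
    CI (fun t => h t * cj (g t) - h t * cj (tpoly b n t)).
  by apply: eq_CI => t; rewrite cjD cjN mulrBr.
have -> : RI (fun t => cmod (cj (g t - tpoly b n t)) ^+ 2) =
    RI (fun t => cmod (g t) ^+ 2) - sqs b n.
  have := bessel_identity n mg sg; rewrite /= bE => <-.
  by apply: eq_RI => t; rewrite cmod_cj.
move=> h1; rewrite -(@ltr_pXn2r _ 2) ?nnegrE ?cmod_ge0 ?ltW //.
apply: le_lt_trans h1 _.
apply: (@le_lt_trans _ _ (X * (e ^+ 2 / (X + 1)))).
  by apply: ler_wpM2l => //; apply: le_trans (ltW hn); exact: ler_norm.
rewrite mulrCA gtr_pMr ?exprn_gt0 // ltr_pdivrMr ?ltr_wpDl // mul1r.
by rewrite ltrDl.
Qed.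

End RieszFischer.

(** * Fatou's theorem for H^1 functions *)

Section HardyOne.
Variable R : realType.
Local Notation C := (Cplx R).
Local Notation re := (@complex.Re R).
Local Notation im := (@complex.Im R).
Local Notation m := (uniform_prob (two_pi_gt0 R)).
Implicit Types (a b c : nat -> C) (z w : C) (u h g : R -> C) (F G : C -> C).

(* A cluster point in the product topology (Tychonoff) replaces the diagonal argument. *)
Lemma coord_subseq (x : nat -> bool * nat -> R) (B : R) : (forall j i, `|x j i| <= B) ->
  exists k : nat -> nat, {homo k : p q / (p < q)%N} /\ exists l : bool * nat -> R,
    forall i, x (k p) i @[p --> \oo] --> l i.
Proof.
move=> xB.
have cA := @tychonoff (bool * nat)%type (fun=> R) (fun=> `[- B, B]%classic) (fun=> @segment_compact R _ _).
pose FF := x @ \oo.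
have [|l [_ lcl]] := cA FF _.
  by exists 0%N => // j _ i; rewrite /= in_itv /= -ler_norml.
(* A product neighbourhood constrains finitely many coordinates, here those of index at most [n].
   Taking [n] along the subsequence gives convergence in each coordinate. *)
have nbl n : nbhs l [set f : bool * nat -> R | forall i, (i.2 <= n)%N -> `|l i - f i| < n.+1%:R^-1].
  have e0 : (0 : R) < n.+1%:R^-1 by rewrite invr_gt0.
  have one i : nbhs l [set f : bool * nat -> R | `|l i - f i| < n.+1%:R^-1].
    have pc := @proj_continuous _ (fun _ : bool * nat => R) i l.
    have nb : nbhs (l i) [set y : R | `|l i - y| < n.+1%:R^-1].
      by apply/nbhs_ballP; exists n.+1%:R^-1.
    exact: (pc _ nb).
  have fin N : nbhs l [set f : bool * nat -> R | forall i, (i.2 < N)%N -> `|l i - f i| < n.+1%:R^-1].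
    elim: N => [|N IH]; first by apply: filterS filterT => f _ i.
    apply: filterS (filterI IH (filterI (one (true, N)) (one (false, N)))) => f [h1 [h2 h3]] [b i] /=.
    by rewrite ltnS leq_eqVlt => /orP[/eqP ->|/(h1 (b, i))//]; case: b.
  by apply: filterS (fin n.+1) => f h i ih; apply: h.
have ex N n : exists j, (N <= j)%N /\ forall i, (i.2 <= n)%N -> `|l i - x j i| < n.+1%:R^-1.
  have FA : FF [set f | exists2 j, (N <= j)%N & x j = f] by exists N => // j Nj; exists j.
  by have [f [[j Nj <-] hj]] := lcl _ _ FA (nbl n); exists j.
have [nx Hnx] : {nx : nat * nat -> nat & forall p, (p.1 <= nx p)%N /\
    forall i, (i.2 <= p.2)%N -> `|l i - x (nx p) i| < p.2.+1%:R^-1}.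
  by apply: (@choice _ _ (fun p j => (p.1 <= j)%N /\ forall i, (i.2 <= p.2)%N -> `|l i - x j i| < p.2.+1%:R^-1)) => p.
pose fix k p := if p is q.+1 then nx ((k q).+1, q.+1) else nx (0, 0)%N.
have kS p : (k p < k p.+1)%N by have [] := Hnx ((k p).+1, p.+1).
have kE p i : (i.2 <= p)%N -> `|l i - x (k p) i| < p.+1%:R^-1.
  by case: p => [|p] ip; [have [_ /(_ i ip)] := Hnx (0, 0)%N|have [_ /(_ i ip)] := Hnx ((k p).+1, p.+1)].
exists k; split.
  move=> p q; elim: q => // q IH; rewrite ltnS leq_eqVlt => /orP[/eqP ->|/IH h]; first exact: kS.
  exact: ltn_trans h (kS q).
exists l => i; apply/cvgrPdist_lt => e e0.
have /cvgrPdist_lt /(_ _ e0) [N _ HN] := @cvg_harmonic R.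
exists (maxn N i.2) => // p; rewrite /= geq_max => /andP[/HN h ip].
apply: lt_trans (kE p i ip) _; move: h; rewrite /= sub0r normrN.
by apply: le_lt_trans; exact: ler_norm.
Qed.

Lemma coef_subseq (c : nat -> nat -> C) (B : R) : (forall j, cbounded (c j) B) ->
  exists k : nat -> nat, {homo k : p q / (p < q)%N} /\ exists l : nat -> C,
    forall n, clim (fun p => c (k p) n) (l n).
Proof.
move=> cB; pose x j (i : bool * nat) := if i.1 then re (c j i.2) else im (c j i.2).
have [|k [kh [l Hl]]] := @coord_subseq x B.
  by move=> j [[] i]; apply: le_trans (cB j i); [exact: abs_re|exact: abs_im].
exists k; split => //; exists (fun n => (l (true, n) +i* l (false, n))%C) => n.
by apply: cvg_clim; [exact: (Hl (true, n))|exact: (Hl (false, n))].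
Qed.

Lemma psum_sub_coef a b B B' z : cbounded a B -> cbounded b B' -> cmod z < 1 ->
  psum (fun n => a n - b n) z = psum a z - psum b z.
Proof.
move=> ha hb z1; have := psum_lin (-1) ha hb z1; rewrite mulN1r => <-.
by congr psum; apply/funext => n; rewrite mulN1r.
Qed.

(** The common bound on the coefficients makes the tails uniformly small in [j]; finitely many terms
    remain. *)
Lemma psum_clim (c : nat -> nat -> C) l (B : R) z : (forall j, cbounded (c j) B) ->
  (forall n, clim (fun j => c j n) (l n)) -> cbounded l B -> cmod z < 1 ->
  clim (fun j => psum (c j) z) (psum l z).
Proof.
move=> cB cl lB z1 e e0; have z0 := cmod_ge0 z; have B0 := cbounded_ge0 lB.
have e2 : 0 < e / 2 by rewrite divr_gt0.
have dB j : cbounded (fun n => c j n - l n) (B + B).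
  by move=> n; apply: le_trans (cmodB _ _) _; apply: lerD; [exact: cB|exact: lB].
have [N HN] : exists N, (B + B) * cmod z ^+ N / (1 - cmod z) < e / 2.
  have /cvgrPdist_lt /(_ _ e2) [N _ H] := geo_cvg0 ((B + B) / (1 - cmod z)) z0 z1.
  exists N; have := H N (leqnn N); rewrite sub0r normrN mulrAC; apply: le_lt_trans.
  exact: ler_norm.
have pl : clim (fun j => ppart (fun n => c j n - l n) z N) 0.
  have -> : 0 = \sum_(i < N) 0 :> C by rewrite big1.
  rewrite /ppart; elim: (N) => [|n IH].
    by under eq_fun do rewrite big_ord0; rewrite big_ord0; exact: clim_cst.
  under eq_fun do rewrite big_ord_recr /=; rewrite big_ord_recr /=; apply: climD => //.
  have := climZ (z ^+ n) (climD (cl n) (clim_cst (- l n))); rewrite subrr mulr0.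
  by congr clim; apply/funext => j; rewrite mulrC.
have [J HJ] := pl _ e2; exists J => j /HJ; rewrite subr0 => h.
rewrite -(psum_sub_coef (cB j) lB z1) -(subrK (ppart (fun n => c j n - l n) z N) (psum _ z)).
apply: le_lt_trans (cmodD _ _) _; have := psum_tail N (dB j) z1; lra.
Qed.

Lemma clim_bounded (s : nat -> C) l (B : R) : clim s l -> (forall n, cmod (s n) <= B) -> cmod l <= B.
Proof. by move=> h hB; apply: (clim_le (N := 0%N) h) => n _. Qed.

Lemma ccts_clim F z (s : nat -> C) : ccts F z -> clim s z -> clim (fun n => F (s n)) (F z).
Proof. by move=> hF hs e /hF[d d0 H]; have [N HN] := hs _ d0; exists N => n /HN/H. Qed.

Lemma clim_re_le (s : nat -> C) l (x : nat -> R) : clim s l -> (forall n, x n <= re (s n)) ->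
  forall y, x n @[n --> \oo] --> y -> y <= re l.
Proof.
move=> /clim_cvg[h _] hx y xy; apply: (ler_cvg_to xy h); exact: nearW.
Qed.

Lemma clim_cmod (s : nat -> C) l : clim s l -> cmod (s n) @[n --> \oo] --> cmod l.
Proof.
move=> h; apply/cvgrPdist_lt => e /h[N HN]; exists N => // n /HN; apply: le_lt_trans.
rewrite ler_norml; have := cmodB_ge (s n) l; have := cmodB_ge l (s n); rewrite (cmodBC l); lra.
Qed.

Lemma holo_circle F r : holo F -> 0 < r -> r < 1 -> ccont (fun t => F (rc r * expi t)).
Proof.
by move=> hF r0 r1; apply: ccont_circle => t; apply/cder_ccts/hF; rewrite cmod_circle // ltW.
Qed.

Lemma holo_mean F r : holo F -> 0 < r -> r < 1 -> CI (fun t => F (rc r * expi t)) = F 0.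
Proof.
move=> hF; apply: mean_value0; first by apply/cder_ccts/hF; rewrite cmod0.
by move=> z /andP[_]; exact: hF.
Qed.

Lemma holo_poisson F (M : R) r z : holo F ->
  (forall r, 0 < r -> r < 1 -> RI (fun t => cmod (F (rc r * expi t))) <= M) ->
  0 < r -> r < 1 -> cmod z < 1 ->
  F (rc r * z) = CI (fun t => F (rc r * expi t) * rc (pois z t)).
Proof.
move=> hF hM r0 r1 z1; have [a ab aE] := taylor hF hM.
have rz : cmod (rc r * z) < 1.
  by rewrite cmodM cmod_rc gtr0_norm //; apply: le_lt_trans z1; rewrite ler_piMl ?cmod_ge0 // ltW.
have cF := holo_circle hF r0 r1.
rewrite poisson_formula //; first last.
(* The negative Fourier coefficients on a circle are, up to a power of [r], means of
   [w ^+ n.+1 * F w], which vanishes at 0. *)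
- move=> n; have hG : holo (fun w => w ^+ n.+1 * F w).
    by move=> w w1; apply: cderM; [exact: cderX|exact: hF].
  have := holo_mean hG r0 r1; rewrite expr0n mul0r.
  have -> : CI (fun t => (rc r * expi t) ^+ n.+1 * F (rc r * expi t)) =
      rc r ^+ n.+1 * CI (fun t => F (rc r * expi t) * expi t ^+ n.+1).
    rewrite -CIZ; last by apply: ccont_cint; apply: ccontM => //; exact/ccontX/ccont_expi.
    by apply: eq_CI => t; rewrite exprMn; ring.
  by move/eqP; rewrite mulf_eq0 expf_eq0 (negPf (rc_neq0 r0)) andbF => /eqP.
- exact: ccont_cint.
have -> : (fun n => CI (fun t => F (rc r * expi t) * cj (expi t) ^+ n)) = (fun n => a n * rc r ^+ n).
  have hr : 0 <= r < 1 by rewrite ltW.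
  apply/funext => n; rewrite -(psum_coef n ab hr); apply: eq_CI => t.
  by rewrite aE // circle_lt1.
have -> : F (rc r * z) = psum a (rc r * z).
  apply: aE; rewrite cmodM cmod_rc gtr0_norm //.
  by apply: le_lt_trans z1; rewrite ler_piMl ?cmod_ge0 // (ltW r1).
have rb : cbounded (fun n => a n * rc r ^+ n) M.
  move=> n; rewrite cmodM cmodX cmod_rc gtr0_norm //; apply: le_trans (ab n).
  by rewrite ler_piMr ?cmod_ge0 // exprn_ile1 ?ltW.
apply: (psumP ab rz).
have := psum_lim rb z1; congr clim; apply/funext => n; apply: eq_bigr => i _.
by rewrite exprMn mulrA.
Qed.

(* G is a limit, as r -> 1, of holomorphic functions whose real parts are the Poisson
   integrals of |F| over the circles of radius r. *)
Lemma holo_majorant F (M : R) : holo F ->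
  (forall r, 0 < r -> r < 1 -> RI (fun t => cmod (F (rc r * expi t))) <= M) ->
  exists2 G, holo G & forall z, cmod z < 1 -> cmod (F z) <= re (G z).
Proof.
move=> hF hM.
pose rho k : R := 1 - k.+2%:R^-1.
have rho01 k : 0 < rho k < 1.
  rewrite /rho subr_gt0 gtrBl invr_gt0 ltr0n andbT invf_lt1 ?ltr1n //.
pose u k t : C := rc (cmod (F (rc (rho k) * expi t))).
have cF k : ccont (fun t => F (rc (rho k) * expi t)).
  by have /andP[h1 h2] := rho01 k; exact: holo_circle.
have cu k : ccont (u k) by apply/ccont_rc/ccont_cmod/cF.
pose c k n := CI (fun t => u k t * cj (expi t) ^+ n).
have cb k : cbounded (c k) M.
  move=> n; have hi : cint (fun t => u k t * cj (expi t) ^+ n).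
    by apply: ccont_cint; apply: ccontM => //; exact/ccontX/ccont_cjexpi.
  have /andP[h1 h2] := rho01 k; apply: le_trans (cmod_CI hi) _; apply: le_trans (hM _ h1 h2).
  rewrite le_eqVlt; apply/orP; left; apply/eqP/eq_RI => t.
  by rewrite cmodM cmodX cmod_cj cmod_expi expr1n mulr1 cmod_rc ger0_norm ?cmod_ge0.
have [k [kh [l Hl]]] := coef_subseq cb.
have lb : cbounded l M by move=> n; apply: (clim_bounded (Hl n)) => p; exact: cb.
(* The kernel [pois] is [2 re K - 1], so the Poisson integral of a real function with coefficients
   [c n] is the real part of [2 * psum c z - c 0]. *)
pose G z := 2 * psum l z + - l 0%N.
exists G.
  move=> z z1; apply: cderD; last exact: cder_cst.
  by apply: cderM; [exact: cder_cst|exact: psum_cder lb z1].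
move=> z z1.
have b1 : cbounded (fun=> 1 : C) 1 by move=> n; rewrite cmod1.
have low p : cmod (F (rc (rho (k p)) * z)) <= re (2 * psum (c (k p)) z + - c (k p) 0%N).
  have /andP[h1 h2] := rho01 (k p).
  rewrite (holo_poisson hF hM h1 h2 z1).
  have hi := cint_pois (ccont_cint (cF (k p))) z1.
  apply: le_trans (cmod_CI hi) _; rewrite le_eqVlt; apply/orP; left; apply/eqP.
  have hK := ccont_psum b1 z1.
  have hu := ccont_cint (cu (k p)).
  have -> : psum (c (k p)) z = CI (fun t => u (k p) t * psum (fun=> 1) (z * cj (expi t))).
    by rewrite (CI_psum hu b1 z1); congr psum; apply/funext => n; rewrite mul1r.
  have -> : c (k p) 0%N = CI (u (k p)) by apply: eq_CI => t; rewrite expr0 mulr1.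
  have hm : cint (fun t => u (k p) t * psum (fun=> 1) (z * cj (expi t))).
    by apply: ccont_cint; exact: ccontM.
  rewrite -CIZ // -CIN // -CID; [|exact: cintZ|exact: cintN].
  rewrite re_CI; apply: eq_RI => t; rewrite cmodM cmod_rc (ger0_norm (pois_ge0 t z1)).
  by rewrite /pois /u !reimE /=; ring.
have cl : clim (fun p => 2 * psum (c (k p)) z + - c (k p) 0%N) (G z).
  apply: climD.
    by apply: climZ; apply: psum_clim lb z1 => // p; exact: cb.
  by have := climZ (-1) (Hl 0%N); rewrite mulN1r; congr clim; apply/funext => p; rewrite mulN1r.
apply: (clim_re_le cl low); apply: clim_cmod; apply: ccts_clim.
  exact/cder_ccts/hF.
move=> e e0; have /cvgrPdist_lt /(_ _ e0) [N _ HN] := @cvg_harmonic R.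
have kge p : (p <= k p)%N by elim: p => // p IH; exact: leq_ltn_trans IH (kh _ _ (ltnSn p)).
exists N => p Np; rewrite -{2}(mul1r z) -mulrBl cmodM -rc1 -rcN -rcD cmod_rc /rho.
rewrite addrAC subrr add0r normrN ger0_norm //.
apply: (@le_lt_trans _ _ (k p).+2%:R^-1); first by rewrite ler_piMr // ltW.
have := HN (k p) (leq_trans Np (kge p)); rewrite /= sub0r normrN; apply: le_lt_trans.
rewrite /harmonic /= ger0_norm ?invr_ge0 // lef_pV2 ?posrE ?ltr0n // ler_nat.
exact: leqW.
Qed.

Lemma radialM F G t k l : radial F t k -> radial G t l -> radial (fun z => F z * G z) t (k * l).
Proof.
move=> hF hG e e0; pose M := cmod k + cmod l + 1.
have [k0 l0] := (cmod_ge0 k, cmod_ge0 l).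
have M1 : 0 < M by rewrite /M; lra.
have e2 : 0 < Num.min 1 (e / (2 * M)) by rewrite lt_min ltr01 divr_gt0 //; lra.
have [d d0 H] := hF _ e2; have [d' d0' H'] := hG _ e2.
exists (Num.min d d'); first by rewrite lt_min d0.
move=> r rd r1.
have [rd1 rd2] : 1 - d < r /\ 1 - d' < r.
  have [q1 q2] : Num.min d d' <= d /\ Num.min d d' <= d' by split; rewrite ge_min lexx ?orbT.
  by split; lra.
move: (H r rd1 r1) (H' r rd2 r1); set f := F _; set g := G _.
rewrite !le_min => /andP[h1 h2] /andP[h3 h4].
have -> : f * g - k * l = (f - k) * g + k * (g - l) by ring.
have gw : cmod g <= 1 + cmod l.
  by rewrite -(subrK l g); apply: le_trans (cmodD _ _) _; rewrite lerD2r.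
apply: le_trans (cmodD _ _) _; rewrite !cmodM.
have -> : e = e / (2 * M) * M + M * (e / (2 * M)) by field; rewrite gt_eqF.
apply: lerD; apply: ler_pM; rewrite ?cmod_ge0 //; rewrite /M; lra.
Qed.

Lemma radial_ext F G t l : (forall z, cmod z < 1 -> F z = G z) -> radial F t l -> radial G t l.
Proof.
move=> FG h e /h[d d0 H]; exists (Num.min 1 d); first by rewrite lt_min ltr01.
move=> r rd r1.
have [q1 q2] : Num.min 1 d <= 1 /\ Num.min 1 d <= d by split; rewrite ge_min lexx ?orbT.
by rewrite -FG ?H //; [lra|rewrite cmod_circle //; lra].
Qed.

Lemma fatou2 F (M : R) : holo F ->
  (forall r, 0 < r -> r < 1 -> RI (fun t => cmod (F (rc r * expi t)) ^+ 2) <= M) ->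
  \forall t \ae m, exists l, radial F t l.
Proof.
move=> hF hM; have [a sa aE] := taylor2 hF hM; have [h bh] := riesz_fischer sa.
apply: aeS (radial_bfun sa bh) => t ht; exists (h t); apply: radial_ext ht => z z1.
by rewrite aE.
Qed.

Lemma RI_sqr_le1 F r : holo F -> 0 < r -> r < 1 -> (forall z, cmod z < 1 -> cmod (F z) <= 1) ->
  RI (fun t => cmod (F (rc r * expi t)) ^+ 2) <= 1.
Proof.
move=> hF r0 r1 h; rewrite -[leRHS](RI_cst 1); apply: le_RI; [|exact: ri_cst|move=> t].
  by apply: csq_ccont; exact: holo_circle.
by rewrite exprn_ile1 ?cmod_ge0 // h // cmod_circle // ltW.
Qed.

(* |V| <= 2 Re V, and Re V has mean value Re V(0). *)
Lemma half_plane_sqrt V r : holo V -> (forall z, cmod z < 1 -> `|im (V z)| <= re (V z)) ->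
  0 < r -> r < 1 -> RI (fun t => cmod (V (rc r * expi t))) <= 2 * re (V 0).
Proof.
move=> hV h r0 r1; rewrite -(holo_mean hV r0 r1) re_CI -RIZ; last first.
  by case: (ccont_cint (holo_circle hV r0 r1)).
apply: le_RI => [||t].
- by apply/ri_cmod/ccont_cint/holo_circle.
- by apply: riZ; case: (ccont_cint (holo_circle hV r0 r1)).
- by apply/cmod_re_sqrt2/h; rewrite cmod_circle // ltW.
Qed.

(** With the majorant [G], the quotient [q = F / (1 + G)] is bounded by 1. The square root [V] of
    [1 + G] lies in the sector of [half_plane_sqrt], so [v = csqrt V] is in H^2. Then [F = q * v^4],
    and [fatou2] applies to both factors. *)
Lemma fatou1 F (M : R) : holo F ->
  (forall r, 0 < r -> r < 1 -> RI (fun t => cmod (F (rc r * expi t))) <= M) ->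
  \forall t \ae m, exists l, radial F t l.
Proof.
move=> hF hM; have [G hG FG] := holo_majorant hF hM.
pose K z := 1 + G z.
have hK : holo K by move=> z z1; apply: cderD; [exact: cder_cst|exact: hG].
have reK z : cmod z < 1 -> 1 <= re (K z).
  by move=> z1; rewrite /K reD re1 lerDl; apply: le_trans (FG z z1); exact: cmod_ge0.
have reK0 z : cmod z < 1 -> 0 < re (K z) by move=> /reK; lra.
have K0 z : cmod z < 1 -> K z != 0.
  by move=> /reK0 h; apply/eqP => E; move: h; rewrite E re0 ltxx.
pose V z := csqrt (K z); pose v z := csqrt (V z).
have hV : holo V.
  by move=> z z1; apply: (@cder_comp _ (@csqrt R) K); [exact: hK|exact/cder_csqrt/reK0].
have reV z : cmod z < 1 -> 0 < re (V z) by move=> /reK0/re_csqrt_gt0.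
have hv : holo v.
  by move=> z z1; apply: (@cder_comp _ (@csqrt R) V); [exact: hV|exact/cder_csqrt/reV].
pose q z := F z * (K z)^-1.
have hq : holo q.
  move=> z z1; apply: cderM; first exact: hF.
  by apply: (@cder_comp _ GRing.inv K); [exact: hK|exact/cder_inv/K0].
have q1 z : cmod z < 1 -> cmod (q z) <= 1.
  move=> z1; rewrite cmodM cmodV ler_pdivrMr ?cmod_gt0 ?K0 // mul1r.
  apply: le_trans (FG z z1) _; apply: le_trans (re_le _).
  by rewrite /K reD re1 lerDr.
have radv : \forall t \ae m, exists l, radial v t l.
  apply: (@fatou2 v (2 * re (V 0))) => // r r0 r1.
  have -> : RI (fun t => cmod (v (rc r * expi t)) ^+ 2) = RI (fun t => cmod (V (rc r * expi t))).
    by apply: eq_RI => t; exact: cmod_csqrt.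
  by apply: half_plane_sqrt => // z z1; apply/ltW/im_csqrt_le/reK0.
have radq : \forall t \ae m, exists l, radial q t l.
  by apply: (@fatou2 q 1) => // r r0 r1; exact: RI_sqr_le1.
apply: aeS (aeI radq radv) => t [[k hk] [l hl]].
exists (k * ((l * l) * (l * l))).
apply: (@radial_ext (fun z => q z * ((v z * v z) * (v z * v z)))); last first.
  by apply: radialM => //; apply: radialM; exact: radialM.
move=> z z1; rewrite -!expr2 csqrtK csqrtK /q divfK //; exact: K0.
Qed.

End HardyOne.

Lemma cvg_le_cst (R : realType) (f : nat -> R) l M :
  f n @[n --> \oo] --> l -> (forall n, f n <= M) -> l <= M.
Proof.
move=> fl h; rewrite -(cvg_lim _ fl) //; apply: limr_le; last exact: nearW.
by apply/cvg_ex; exists l.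
Qed.

Lemma cvg_sum_ord (R : realType) (f : nat -> nat -> R) l J :
  (forall i, f i n @[n --> \oo] --> l i) ->
  \sum_(i < J) f i n @[n --> \oo] --> \sum_(i < J) l i.
Proof.
move=> h; elim: J => [|J IH].
  by under eq_fun do rewrite big_ord0; rewrite big_ord0; exact: cvg_cst.
by under eq_fun do rewrite big_ord_recr /=; rewrite big_ord_recr; apply: cvgD.
Qed.

Lemma cvg_sqr0 (R : realType) (f : nat -> R) :
  f n @[n --> \oo] --> 0 -> f n ^+ 2 @[n --> \oo] --> 0.
Proof.
move=> h; have : f n * f n @[n --> \oo] --> (0 : R) * 0 by apply: cvgM.
by rewrite mulr0 (_ : (fun n => f n * f n) = (fun n => f n ^+ 2)) //; apply/funext => n; rewrite expr2.
Qed.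

(** * Hilbert-Schmidt operators and their singular numbers *)

Section HilbertSchmidt.
Variable R : realType.
Local Notation C := (Cplx R).
Local Notation re := (@complex.Re R).
Local Notation im := (@complex.Im R).
Variables (V : lmodType C) (H : set V) (ip : V -> V -> C).
Local Notation N u := (re (ip u u)).
Hypothesis H0 : H 0.
Hypothesis Hlin : forall k u v, H u -> H v -> H (k *: u + v).
Hypothesis ipl : forall k u v w, H u -> H v -> H w -> ip (k *: u + v) w = k * ip u w + ip v w.
Hypothesis ips : forall u v, H u -> H v -> ip v u = cj (ip u v).
Hypothesis N_ge0 : forall u, H u -> 0 <= N u.
Hypothesis N_def : forall u, H u -> N u = 0 -> u = 0.

Let HD u v : H u -> H v -> H (u + v).
Proof. by move=> hu hv; rewrite -[u]scale1r; exact: Hlin. Qed.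
Let HZ k u : H u -> H (k *: u).
Proof. by move=> hu; rewrite -[_ *: _]addr0; exact: Hlin. Qed.
Let HB u v : H u -> H v -> H (u - v).
Proof. by move=> hu hv; rewrite addrC -scaleN1r; exact: Hlin. Qed.
Let Hsum (k : nat -> C) (e : nat -> V) n : (forall i, H (e i)) -> H (\sum_(i < n) k i *: e i).
Proof.
by move=> he; elim: n => [|n IH]; rewrite ?big_ord0 // big_ord_recr; apply/HD/HZ.
Qed.

Let ipDl u v w : H u -> H v -> H w -> ip (u + v) w = ip u w + ip v w.
Proof. by move=> hu hv hw; rewrite -[u in LHS]scale1r ipl // mul1r. Qed.
Let ip0l w : H w -> ip 0 w = 0.
Proof.
move=> hw; have := ipDl H0 H0 hw; rewrite addr0 => h.
by apply: (addrI (ip 0 w)); rewrite -h addr0.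
Qed.
Let ipZl k u w : H u -> H w -> ip (k *: u) w = k * ip u w.
Proof. by move=> hu hw; rewrite -[k *: u]addr0 ipl // ip0l // addr0. Qed.
Let ipBl u v w : H u -> H v -> H w -> ip (u - v) w = ip u w - ip v w.
Proof. by move=> hu hv hw; rewrite addrC -scaleN1r ipl // mulN1r addrC. Qed.
Let ipDr u v w : H u -> H v -> H w -> ip w (u + v) = ip w u + ip w v.
Proof. by move=> hu hv hw; rewrite (ips (HD hu hv) hw) ipDl // cjD -!ips. Qed.
Let ipZr k u w : H u -> H w -> ip w (k *: u) = cj k * ip w u.
Proof. by move=> hu hw; rewrite (ips (HZ k hu) hw) ipZl // cjM -ips. Qed.
Let ip0r w : H w -> ip w 0 = 0.
Proof. by move=> hw; rewrite (ips H0 hw) ip0l // cj0. Qed.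
Let ip_suml (k : nat -> C) (e : nat -> V) n w : (forall i, H (e i)) -> H w ->
  ip (\sum_(i < n) k i *: e i) w = \sum_(i < n) k i * ip (e i) w.
Proof.
move=> he hw; elim: n => [|n IH]; first by rewrite !big_ord0 ip0l.
by rewrite !big_ord_recr /= ipDl // ?IH ?ipZl //; [exact: Hsum|exact: HZ].
Qed.

Lemma ip_norm_lin c u v : H u -> H v ->
  N (u + c *: v) = N u + 2 * re (cj c * ip u v) + cmod c ^+ 2 * N v.
Proof.
move=> hu hv; have hcv := HZ c hv.
rewrite (ipDl hu hcv (HD hu hcv)) !ipDr // ?ipZl // !ipZr // (ips hu hv) mulrA mul_cj !reD.
rewrite [re (rc _ * _)]reM re_rc im_rc mul0r subr0.
have -> : re (c * cj (ip u v)) = re (cj c * ip u v).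
  by rewrite !reM re_cj im_cj re_cj im_cj; ring.
by ring.
Qed.

Lemma ip_normB u v : H u -> H v -> N (u - v) <= 2 * N u + 2 * N v.
Proof.
move=> hu hv; have := N_ge0 (HD hu hv).
rewrite -[X in N (_ + X)]scale1r ip_norm_lin // -[X in _ -> N (_ - X) <= _]scale1r -scaleNr ip_norm_lin //.
by rewrite cjN mulNr reN cmodN cmod1 expr1n !mul1r; lra.
Qed.

Lemma ip_CS u v : H u -> H v -> cmod (ip u v) ^+ 2 <= N u * N v.
Proof.
move=> hu hv; have [v0|v0] := eqVneq (N v) 0.
  by rewrite v0 mulr0 (N_def hv v0) ip0r // cmod0 expr0n.
have vp : 0 < N v by rewrite lt_def v0 N_ge0.
have := N_ge0 (HD hu (HZ (- (ip u v * rc (N v)^-1)) hv)).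
rewrite ip_norm_lin // cmodN cmodM cmod_rc gtr0_norm ?invr_gt0 // cjN cjM cj_rc.
rewrite (_ : - (cj (ip u v) * rc (N v)^-1) * ip u v = - (rc (N v)^-1 * (ip u v * cj (ip u v)))); last by ring.
rewrite mul_cj reN -rcM re_rc => h.
rewrite -ler_pdivrMr //; move: h; rewrite exprMn.
suff -> : cmod (ip u v) ^+ 2 * (N v)^-1 ^+ 2 * N v = cmod (ip u v) ^+ 2 / N v by lra.
by field.
Qed.

(** Zero vectors are allowed because the successive maximization returns 0 once the operator
    vanishes on the remaining orthogonal complement. *)
Definition unit_or_zero (e : nat -> V) := [/\ forall i, H (e i),
  forall i j, (i < j)%N -> ip (e j) (e i) = 0 & forall i, N (e i) = 1 \/ e i = 0].

Lemma bessel_eq (e : nat -> V) u n : unit_or_zero e -> H u ->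
  N (u - \sum_(i < n) ip u (e i) *: e i) = N u - \sum_(i < n) cmod (ip u (e i)) ^+ 2.
Proof.
move=> [he eo e1] hu; elim: n => [|n IH]; first by rewrite !big_ord0 !subr0.
set c := ip u (e n).
have hs : H (u - \sum_(i < n) ip u (e i) *: e i) by apply: HB => //; apply: (Hsum (fun i => ip u (e i))).
have ce : ip (u - \sum_(i < n) ip u (e i) *: e i) (e n) = c.
  rewrite ipBl //; last by apply: (Hsum (fun i => ip u (e i))).
  rewrite (ip_suml (fun i => ip u (e i))) // big1 ?subr0 // => i _.
  by rewrite (ips (he n) (he i)) eo // cj0 mulr0.
rewrite !big_ord_recr /= -/c opprD addrA -scaleNr ip_norm_lin // ce IH cjN mulNr.
rewrite [cj c * c]mulrC mul_cj reN re_rc cmodN.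
have [->|h] := e1 n; first by lra.
have -> : c = 0 by rewrite /c h ip0r.
by rewrite cmod0 expr0n /= mul0r; lra.
Qed.

Lemma bessel_le (e : nat -> V) u n : unit_or_zero e -> H u ->
  \sum_(i < n) cmod (ip u (e i)) ^+ 2 <= N u.
Proof.
move=> he hu; rewrite -subr_ge0 -bessel_eq //; apply/N_ge0/HB => //.
by case: he => he _ _; apply: (Hsum (fun i => ip u (e i))).
Qed.

(** [x] is a Hilbert basis: [parsevalx] says that it is total and [riesz] that the space is
    complete. *)
Variable x : nat -> V.
Hypothesis Hx : forall j, H (x j).
Hypothesis ipx : forall i j, ip (x i) (x j) = (i == j)%:R.
Hypothesis parsevalx : forall u, H u ->
  sqs (fun j => ip u (x j)) n @[n --> \oo] --> N u.
Hypothesis riesz : forall a (M : R), sqsum a M -> exists2 u, H u & forall j, ip u (x j) = a j.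

Let xu : unit_or_zero x.
Proof.
split => // [i j ij|i]; rewrite ipx; first by rewrite gtn_eqF.
by left; rewrite eqxx re1.
Qed.

Definition proj n u := \sum_(i < n) ip u (x i) *: x i.

Let Hproj n u : H (proj n u). Proof. by apply: (Hsum (fun i => ip u (x i))). Qed.

Lemma proj_cvg u : H u -> N (u - proj n u) @[n --> \oo] --> 0.
Proof.
move=> hu; have -> : (fun n => N (u - proj n u)) = (fun n => N u - sqs (fun j => ip u (x j)) n).
  by apply/funext => n; rewrite /proj bessel_eq.
suff : N u - sqs (fun j => ip u (x j)) n @[n --> \oo] --> N u - N u by rewrite subrr.
apply: cvgB; first exact: cvg_cst.
exact: parsevalx.
Qed.

Lemma ip_proj u v n : H u -> H v -> ip (proj n u) v = \sum_(i < n) ip u (x i) * cj (ip v (x i)).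
Proof.
move=> hu hv; rewrite /proj (ip_suml (fun i => ip u (x i))) //.
by apply: eq_bigr => i _; rewrite [ip (x i) v]ips.
Qed.

Lemma ip_small (s : nat -> V) v : H v -> (forall n, H (s n)) ->
  N (s n) @[n --> \oo] --> 0 -> clim (fun n => ip (s n) v) 0.
Proof.
move=> hv hs sN e e0.
have [v0|v0] := eqVneq (N v) 0.
  by exists 0%N => n _; rewrite (N_def hv v0) ip0r // subr0 cmod0.
have vp : 0 < N v by rewrite lt_def v0 N_ge0.
have e2 : 0 < e ^+ 2 / N v by rewrite divr_gt0 // exprn_gt0.
have /cvgrPdist_lt /(_ _ e2) [K _ HK] := sN.
exists K => n /HK /=; rewrite sub0r normrN ger0_norm ?N_ge0 // ltr_pdivlMr // => h.
rewrite subr0 -(@ltr_pXn2r _ 2) ?nnegrE ?cmod_ge0 ?(ltW e0) //.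
exact: le_lt_trans (ip_CS _ _) h.
Qed.

(** A subsequence converges in every coordinate; the limit coordinates are square-summable, so
    [riesz] realizes them by some [u]. To pass from the basis to any [v], approximate [v] by
    [proj J v]. *)
Lemma weak_subseq (s : nat -> V) (M : R) : (forall n, H (s n)) -> (forall n, N (s n) <= M) ->
  exists k : nat -> nat, {homo k : p q / (p < q)%N} /\ exists2 u, H u & N u <= M /\
    forall v, H v -> clim (fun p => ip (s (k p) - u) v) 0.
Proof.
move=> hs sM.
have sq n : sqsum (fun j => ip (s n) (x j)) M.
  by move=> J; apply: le_trans (bessel_le J xu (hs n)) (sM n).
have [k [kh [l kl]]] := @coef_subseq R (fun n j => ip (s n) (x j)) (1 + M) (fun n => sqsum_bounded (sq n)).
have lM : sqsum l M.
  move=> J; have cv : \sum_(i < J) cmod (ip (s (k p)) (x i)) ^+ 2 @[p --> \oo] --> \sum_(i < J) cmod (l i) ^+ 2.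
    apply: (@cvg_sum_ord _ (fun i p => cmod (ip (s (k p)) (x i)) ^+ 2) (fun i => cmod (l i) ^+ 2)) => i; rewrite expr2; under eq_fun do rewrite expr2.
    by apply: cvgM; exact/clim_cmod/kl.
  by apply: cvg_le_cst cv _ => p; exact: sq.
have [u hu ul] := riesz lM; exists k; split=> //; exists u => //.
have NuM : N u <= M.
  have cu := parsevalx hu; apply: cvg_le_cst cu _ => p.
  by rewrite /sqs; under eq_bigr do rewrite ul; exact: lM.
split=> // v hv e e0.
have M0 : 0 <= M := le_trans (N_ge0 (hs 0%N)) (sM 0%N).
(* By Cauchy-Schwarz the squared tail is at most [4 * M * N (v - proj J v)], to be less than
   [(e / 2) ^+ 2]; the 1 covers [M = 0]. *)
pose e' := (e / 2) ^+ 2 / (4 * M + 1).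
have e'0 : 0 < e' by rewrite divr_gt0 ?exprn_gt0 // ?divr_gt0 //; lra.
have /cvgrPdist_lt /(_ _ e'0) [J _ /(_ J (leqnn J)) /=] := proj_cvg hv.
rewrite sub0r normrN ger0_norm ?(N_ge0 (HB hv (Hproj J v))) // => vJ.
have tail p : cmod (ip (s (k p) - u) (v - proj J v)) < e / 2.
  have hd := HB (hs (k p)) hu.
  rewrite -(@ltr_pXn2r _ 2) ?nnegrE ?cmod_ge0 ?divr_ge0 ?(ltW e0) //.
  apply: le_lt_trans (ip_CS hd (HB hv (Hproj J v))) _.
  have dN : N (s (k p) - u) <= 4 * M by have := ip_normB (hs (k p)) hu; have := sM (k p); lra.
  apply: (@le_lt_trans _ _ (4 * M * N (v - proj J v))).
    by apply: ler_wpM2r => //; exact/N_ge0/HB.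
  have h1 : 0 < 4 * M + 1 by lra.
  move: vJ; rewrite /e' ltr_pdivlMr //; have := N_ge0 (HB hv (Hproj J v)).
  by move: (N _) => y y0; nra.
have fin : clim (fun p => ip (s (k p) - u) (proj J v)) 0.
  elim: (J) => [|j IH].
    have -> : (fun p => ip (s (k p) - u) (proj 0 v)) = fun=> 0; last exact: clim_cst.
    by apply/funext => p; rewrite /proj big_ord0 ip0r //; exact: HB.
  have -> : (fun p => ip (s (k p) - u) (proj j.+1 v)) =
      (fun p => ip (s (k p) - u) (proj j v) + cj (ip v (x j)) * (ip (s (k p)) (x j) + (- l j))).
    apply/funext => p; have hd := HB (hs (k p)) hu.
    have -> : proj j.+1 v = proj j v + ip v (x j) *: x j by rewrite /proj big_ord_recr.
    by rewrite (ipDr (Hproj j v) (HZ _ (Hx j)) hd) (ipZr _ (Hx j) hd) (ipBl (hs _) hu (Hx j)) ul.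
  suff : clim (fun p => ip (s (k p) - u) (proj j v) + cj (ip v (x j)) * (ip (s (k p)) (x j) + (- l j)))
      (0 + cj (ip v (x j)) * (l j + (- l j))) by rewrite subrr mulr0 addr0.
  by apply: climD => //; apply: climZ; apply: climD => //; exact: clim_cst.
have e2 : 0 < e / 2 by rewrite divr_gt0.
have [K HK] := fin _ e2; exists K => p /HK; rewrite !subr0 => h.
rewrite -[v](subrK (proj J v)) (ipDr (HB hv (Hproj J v)) (Hproj J v) (HB (hs _) hu)).
by apply: le_lt_trans (cmodD _ _) _; have := tail p; lra.
Qed.

Let NZ c v : H v -> N (c *: v) = cmod c ^+ 2 * N v.
Proof.
move=> hv; rewrite ipZl ?ipZr //; last exact: HZ.
by rewrite mulrA mul_cj reM re_rc im_rc mul0r subr0.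
Qed.

Let ipxx v : H v -> ip v v = rc (N v).
Proof.
move=> hv; apply: cE => //; rewrite im_rc.
have /(congr1 im) := ips hv hv; rewrite im_cj; lra.
Qed.

Let ortho0 (e : nat -> V) i j : unit_or_zero e -> i != j -> ip (e i) (e j) = 0.
Proof.
move=> [he eo _]; rewrite neq_ltn => /orP[ij|/eo//].
by rewrite (ips (he j) (he i)) eo // cj0.
Qed.

Lemma proj_perp (e : nat -> V) v n j : unit_or_zero e -> H v -> (j < n)%N ->
  ip (v - \sum_(i < n) ip v (e i) *: e i) (e j) = 0.
Proof.
move=> ue hv jn; have [he _ e1] := ue.
rewrite ipBl //; last by apply: (Hsum (fun i => ip v (e i))).
rewrite (ip_suml (fun i => ip v (e i))) // (bigD1 (Ordinal jn)) //= big1 ?addr0; last first.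
  by move=> i; rewrite -val_eqE /= => ij; rewrite ortho0 ?mulr0.
rewrite ipxx //; have [->|->] := e1 j; first by rewrite rc1 mulr1 subrr.
by rewrite ip0r // mul0r subrr.
Qed.

Variables (T : V -> V) (C0 : R).
Hypothesis HT : forall u, H u -> H (T u).
Hypothesis Tlin : forall k u v, T (k *: u + v) = k *: T u + T v.
Hypothesis Tx : forall n, \sum_(i < n) N (T (x i)) <= C0.
Hypothesis Tb : forall u, H u -> N (T u) <= C0 * N u.

Let TD u v : T (u + v) = T u + T v.
Proof. by rewrite -[u in LHS]scale1r Tlin scale1r. Qed.
Let T0 : T 0 = 0.
Proof. by have := TD 0 0; rewrite addr0 => h; apply: (addrI (T 0)); rewrite -h addr0. Qed.
Let TZ k u : T (k *: u) = k *: T u.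
Proof. by rewrite -[k *: u]addr0 Tlin T0 addr0. Qed.
Let TB u v : T (u - v) = T u - T v.
Proof. by rewrite TD -scaleN1r TZ scaleN1r. Qed.
Let Tsum (k : nat -> C) (e : nat -> V) n :
  T (\sum_(i < n) k i *: e i) = \sum_(i < n) k i *: T (e i).
Proof. by elim: n => [|n IH]; rewrite ?big_ord0 ?T0 // !big_ord_recr /= TD IH TZ. Qed.

(** The numbers [ip v (T (x n))] are square-summable by [Tx], so [riesz] gives [S v]. The identity
    extends from the basis to every [u] because [T] is bounded. *)
Lemma adjoint_ex : exists S, is_adjoint H ip T S.
Proof.
have one v : exists w, H v -> H w /\ forall n, ip w (x n) = ip v (T (x n)).
  have [hv|nv] := pselect (H v); last by exists 0.
  have sq : sqsum (fun n => ip v (T (x n))) (N v * C0).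
    move=> n; apply: (@le_trans _ _ (\sum_(i < n) N v * N (T (x i)))).
      by apply: ler_sum => i _; apply: ip_CS => //; exact: HT.
    by rewrite -mulr_sumr; apply: ler_wpM2l => //; exact: N_ge0.
  by have [w hw wE] := riesz sq; exists w.
have [S HS] : {S : V -> V & forall v, H v -> H (S v) /\ forall n, ip (S v) (x n) = ip v (T (x n))}.
  exact: (@choice _ _ (fun v w => H v -> H w /\ forall n, ip w (x n) = ip v (T (x n)))).
exists S; split=> [v /HS[]//|u v hu hv]; have [hSv SE] := HS v hv.
have hd n : H (u - proj n u) by apply: HB => //; exact: Hproj.
have c1 : clim (fun n => ip (T (u - proj n u)) v) 0.
  apply: ip_small => // [n|]; first exact: HT.
  apply: (@squeeze_cvgr _ _ _ _ (fun=> 0) (fun n => C0 * N (u - proj n u))).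
  - by apply: nearW => n; rewrite N_ge0 ?Tb //; exact: HT.
  - exact: cvg_cst.
  - by rewrite -(mulr0 C0); apply: cvgM; [exact: cvg_cst|exact: proj_cvg].
have c2 : clim (fun n => ip (u - proj n u) (S v)) 0 by apply: ip_small => //; exact: proj_cvg.
apply/eqP; rewrite -subr_eq0; apply/eqP.
apply: (clim_uniq (clim_cst _)); rewrite -[X in clim _ X]addr0 -[X in clim _ (_ + X)](mulr0 (-1)).
have -> : (fun _ : nat => ip (T u) v - ip u (S v)) =
    (fun n => ip (T (u - proj n u)) v + (-1) * ip (u - proj n u) (S v)).
  apply/funext => n; have hp := Hproj n u.
  rewrite TB (ipBl (HT hu) (HT hp) hv) (ipBl hu hp hSv).
  have -> : ip (T (proj n u)) v = ip (proj n u) (S v).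
    rewrite ip_proj // /proj (Tsum (fun i => ip u (x i))) (@ip_suml (fun i => ip u (x i)) (fun i => T (x i))) //; last by move=> i; exact: HT.
    by apply: eq_bigr => i _; rewrite SE -ips // ; exact: HT.
  by ring.
exact: climD c1 (climZ _ c2).
Qed.

Variable S : V -> V.
Hypothesis adjS : is_adjoint H ip T S.

Let HS v : H v -> H (S v). Proof. by case: adjS => h _; exact: h. Qed.
Let adj u v : H u -> H v -> ip (T u) v = ip u (S v).
Proof. by case: adjS => _ h; exact: h. Qed.

(** Both sides sum the squared entries of the matrix of [T], by columns or by rows. *)
Lemma adjoint_sum J : \sum_(j < J) N (S (x j)) <= C0.
Proof.
apply: (@cvg_le_cst _ (fun L => \sum_(j < J) sqs (fun n => ip (S (x j)) (x n)) L)).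
  by apply: (@cvg_sum_ord _ (fun j L => sqs (fun n => ip (S (x j)) (x n)) L) (fun j => N (S (x j)))) => j; exact/parsevalx/HS.
move=> L; rewrite /sqs exchange_big /=; apply: le_trans (Tx L); apply: ler_sum => n _.
apply: le_trans (bessel_le J xu (HT (Hx n))); apply: ler_sum => j _.
by rewrite adj // (ips (HS (Hx j)) (Hx n)) cmod_cj.
Qed.

(** A second passage through the adjoint replaces the basis [x] by an arbitrary orthogonal
    system. *)
Lemma hilbert_schmidt_sum (e : nat -> V) n : unit_or_zero e -> \sum_(i < n) N (T (e i)) <= C0.
Proof.
move=> ue; have [he _ _] := ue.
apply: (@cvg_le_cst _ (fun J => \sum_(i < n) sqs (fun j => ip (T (e i)) (x j)) J)).
  by apply: (@cvg_sum_ord _ (fun i J => sqs (fun j => ip (T (e i)) (x j)) J) (fun i => N (T (e i)))) => i; exact/parsevalx/HT.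
move=> J; rewrite /sqs exchange_big /=; apply: le_trans (adjoint_sum J); apply: ler_sum => j _.
apply: le_trans (bessel_le n ue (HS (Hx j))); apply: ler_sum => i _.
by rewrite adj // (ips (HS (Hx j)) (he i)) cmod_cj.
Qed.

(** [N (T (d p))] is the sum over [j] of [|ip (d p) (S (x j))|^2]. Finitely many terms tend to 0,
    and the others are at most [M] times a tail of the convergent sum of [N (S (x j))]. *)
Lemma weak_null_image (d : nat -> V) (M : R) : (forall p, H (d p)) -> (forall p, N (d p) <= M) ->
  (forall v, H v -> clim (fun p => ip (d p) v) 0) -> N (T (d p)) @[p --> \oo] --> 0.
Proof.
move=> hd dM wd; pose sg J := \sum_(j < J) N (S (x j)).
have M0 : 0 <= M := le_trans (N_ge0 (hd 0%N)) (dM 0%N).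
have sgn : nondecreasing_seq sg.
  by apply/nondecreasing_seqP => n; rewrite /sg big_ord_recr /= lerDl N_ge0 //; exact: HS.
have sgc : cvgn sg.
  apply: nondecreasing_is_cvgn => //; exists C0 => _ [n _ <-]; exact: adjoint_sum.
apply/cvgrPdist_lt => e e0.
have e'0 : 0 < e / 2 / (M + 1) by rewrite !divr_gt0 //; lra.
have /cvgrPdist_lt /(_ _ e'0) [J _ /(_ J (leqnn J)) /=] := sgc.
rewrite ger0_norm; last by rewrite subr_ge0; exact: nondecreasing_cvgn_le.
move=> sJ.
have fin : \sum_(j < J) cmod (ip (d p) (S (x j))) ^+ 2 @[p --> \oo] --> \sum_(j < J) (0 : R).
  apply: (@cvg_sum_ord _ (fun j p => cmod (ip (d p) (S (x j))) ^+ 2) (fun=> 0)) => j.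
  have h := clim_cmod (wd _ (HS (Hx j))); rewrite cmod0 in h.
  exact: cvg_sqr0 h.
have e2 : 0 < e / 2 by rewrite divr_gt0.
move/cvgrPdist_lt: fin => /(_ _ e2) [K _ HK]; exists K => // p /HK /=.
rewrite big1 // !sub0r !normrN (ger0_norm (N_ge0 (HT (hd p)))) ger0_norm; last first.
  by apply: sumr_ge0 => j _; rewrite exprn_ge0 // cmod_ge0.
move=> h; apply: (@le_lt_trans _ _ (\sum_(j < J) cmod (ip (d p) (S (x j))) ^+ 2 + M * (limn sg - sg J))).
  apply: (cvg_le_cst (parsevalx (HT (hd p)))) => n.
  apply: (@le_trans _ _ (sqs (fun j => ip (T (d p)) (x j)) (J + n))); first exact/sqs_nd/leq_addl.
  rewrite /sqs big_split_ord /=; apply: lerD.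
    by apply: ler_sum => j _; rewrite adj.
  apply: (@le_trans _ _ (\sum_(j < n) M * N (S (x (J + j)%N)))).
    apply: ler_sum => j _; rewrite adj //; apply: le_trans (ip_CS (hd p) (HS (Hx _))) _.
    by apply: ler_wpM2r => //; exact/N_ge0/HS.
  rewrite -mulr_sumr; apply: ler_wpM2l => //.
  have := nondecreasing_cvgn_le sgn sgc (J + n); rewrite /sg big_split_ord /=; lra.
have h1 : M * (limn sg - sg J) <= e / 2.
  have M1 : 0 < M + 1 by lra.
  move: sJ; rewrite ltr_pdivlMr // => sJ.
  have : 0 <= limn sg - sg J by rewrite subr_ge0; exact: nondecreasing_cvgn_le.
  by nra.
lra.
Qed.

(* A maximizing sequence converges weakly, and T makes the convergence strong. *)
Lemma maximal_vector (l : seq V) : (forall i, (i < size l)%N -> H (nth 0 l i)) ->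
  exists u, [/\ H u, forall i, (i < size l)%N -> ip u (nth 0 l i) = 0, N u = 1 \/ u = 0 &
    forall v, H v -> (forall i, (i < size l)%N -> ip v (nth 0 l i) = 0) -> N (T v) <= N (T u) * N v].
Proof.
move=> hl; pose perp v := forall i, (i < size l)%N -> ip v (nth 0 l i) = 0.
pose A := [set y | exists v, [/\ H v, perp v, N v <= 1 & y = N (T v)]].
have perp0 : perp 0 by move=> i il; rewrite ip0l //; exact: hl.
have N0 : N (0 : V) = 0 by rewrite ip0l.
have A0 : A 0 by exists 0; split=> //; rewrite ?N0 // T0 N0.
have C00 : 0 <= C0 by have := Tx 0; rewrite big_ord0.
have Aub : has_ubound A.
  exists C0 => _ [v [hv _ v1 ->]]; apply: le_trans (Tb hv) _.
  by rewrite -[leRHS]mulr1; exact: ler_wpM2l.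
have Asup : has_sup A by split=> //; exists 0.
have [s Hs] : {s : nat -> V & forall n, [/\ H (s n), perp (s n), N (s n) <= 1 &
    sup A - n.+1%:R^-1 < N (T (s n))]}.
  apply: (@choice _ _ (fun n v => [/\ H v, perp v, N v <= 1 & sup A - n.+1%:R^-1 < N (T v)])) => n.
  have n0 : (0 : R) < n.+1%:R^-1 by rewrite invr_gt0.
  by have [_ [v [hv pv v1 ->]] h] := sup_adherent n0 Asup; exists v.
have hs n : H (s n) by case: (Hs n).
have sM n : N (s n) <= 1 by case: (Hs n).
have [k [kh [u hu [u1 wu]]]] := weak_subseq hs sM.
have hd p : H (s (k p) - u) := HB (hs _) hu.
have pu : perp u.
  move=> i il; apply/eqP; rewrite -oppr_eq0; apply/eqP.
  apply: (clim_uniq (clim_cst _)); have := wu _ (hl i il); congr clim; apply/funext => p.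
  by rewrite (ipBl (hs _) hu (hl i il)); case: (Hs (k p)) => _ -> // _ _; rewrite sub0r.
have TN : N (T (s (k p))) @[p --> \oo] --> N (T u).
  have -> : (fun p => N (T (s (k p)))) = (fun p => N (T u) + 2 * re (ip (s (k p) - u) (S (T u))) + N (T (s (k p) - u))).
    apply/funext => p.
    have -> : N (T (s (k p))) = N (T u + 1 *: T (s (k p) - u)) by rewrite scale1r -TD addrC subrK.
    rewrite (ip_norm_lin 1 (HT hu) (HT (hd p))) cmod1 expr1n mul1r; congr (_ + 2 * _ + _).
    have -> : ip (s (k p) - u) (S (T u)) = cj (ip (T u) (T (s (k p) - u))).
      by rewrite -(adj (hd p) (HT hu)) (ips (HT hu) (HT (hd p))).
    have c1 : cj (1 : C) = 1 by exact: cj_rc.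
    by rewrite re_cj c1 mul1r.
  suff : N (T u) + 2 * re (ip (s (k p) - u) (S (T u))) + N (T (s (k p) - u)) @[p --> \oo] -->
      N (T u) + 2 * 0 + 0 by rewrite mulr0 !addr0.
  apply: cvgD; first apply: cvgD; first exact: cvg_cst.
    apply: cvgM; first exact: cvg_cst.
    by have [h _] := clim_cvg (wu _ (HS (HT hu))).
  (* [N (s (k p))] and [N u] are at most 1, and [ip_normB] doubles both. *)
  apply: (@weak_null_image _ 4) => // p.
  by have := ip_normB (hs (k p)) hu; have := sM (k p); lra.
have kp p : (p <= k p)%N by elim: p => // p IH; apply: leq_ltn_trans IH (kh _ _ _).
have supu : sup A <= N (T u).
  rewrite -subr_le0; apply: (@cvg_le_cst _ (fun p => sup A - N (T (s (k p))) - p.+1%:R^-1)).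
    suff : sup A - N (T (s (k p))) - p.+1%:R^-1 @[p --> \oo] --> sup A - N (T u) - 0 by rewrite subr0.
    apply: cvgB; last exact: cvg_harmonic.
    by apply: cvgB => //; exact: cvg_cst.
  move=> p; have [_ _ _ h] := Hs (k p).
  have : (k p).+1%:R^-1 <= p.+1%:R^-1 :> R by rewrite lef_pV2 ?posrE // ler_nat ltnS.
  by move: h; move: (k p).+1%:R^-1 p.+1%:R^-1 => y z; lra.
have best v : H v -> perp v -> N (T v) <= N (T u) * N v.
  move=> hv pv; have [v0|v0] := eqVneq (N v) 0.
    by rewrite (N_def hv v0) T0 N0 mulr0.
  have vp : 0 < N v by rewrite lt_def v0 N_ge0.
  pose c : C := rc (Num.sqrt (N v))^-1.
  have c2 : cmod c ^+ 2 = (N v)^-1 by rewrite cmod_rc normr_sq exprVn sqr_sqrtr // (ltW vp).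
  rewrite -ler_pdivrMr //; apply: le_trans supu; apply: ub_le_sup => //.
  exists (c *: v); split; [exact: HZ| | |].
  - by move=> i il; rewrite (ipZl _ hv (hl i il)) pv // mulr0.
  - by rewrite NZ // c2 mulVf.
  - by rewrite TZ (NZ c (HT hv)) c2 mulrC.
(* If the maximum is 0, then [T] vanishes on the complement and the zero vector is returned.
   Otherwise [best] applied to [u] itself forces [N u = 1]. *)
have [u0|u0] := eqVneq (N (T u)) 0.
  exists 0; split=> //; first by right.
  by move=> v hv pv; have := best v hv pv; rewrite u0 T0 N0 !mul0r.
have up : 0 < N (T u) by rewrite lt_def u0 N_ge0 //; exact: HT.
exists u; split=> //; left; apply/eqP; rewrite eq_le u1 /=.
by have := best u hu pu; rewrite -[leLHS]mulr1 ler_pM2l.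
Qed.

(** A choice function on lists gives the next vector from all previous ones. [P] is conditional so
    that the choice is defined on every list. *)
Lemma singular_vectors : exists e, unit_or_zero e /\ forall n v, H v ->
  (forall i, (i < n)%N -> ip v (e i) = 0) -> N (T v) <= N (T (e n)) * N v.
Proof.
pose P (l : seq V) u := (forall i, (i < size l)%N -> H (nth 0 l i)) ->
  [/\ H u, forall i, (i < size l)%N -> ip u (nth 0 l i) = 0, N u = 1 \/ u = 0 &
    forall v, H v -> (forall i, (i < size l)%N -> ip v (nth 0 l i) = 0) -> N (T v) <= N (T u) * N v].
have [F HF] : {F : seq V -> V & forall l, P l (F l)}.
  apply: (@choice _ _ P) => l; rewrite /P.
  have [hl|nl] := pselect (forall i, (i < size l)%N -> H (nth 0 l i)); last by exists 0.
  by have [u hu] := maximal_vector hl; exists u.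
pose build := fix b n := if n is k.+1 then rcons (b k) (F (b k)) else [::].
pose e n := F (build n).
have bE n : build n = mkseq e n by elim: n => // n IH; rewrite mkseqS -IH.
have he n : H (e n).
  elim/ltn_ind: n => n IH; have [] // := HF (build n).
  by move=> i; rewrite bE size_mkseq => il; rewrite nth_mkseq //; exact: IH.
have Pe n : [/\ H (e n), forall i, (i < n)%N -> ip (e n) (e i) = 0, N (e n) = 1 \/ e n = 0 &
    forall v, H v -> (forall i, (i < n)%N -> ip v (e i) = 0) -> N (T v) <= N (T (e n)) * N v].
  have [] := HF (build n).
    by move=> i; rewrite bE size_mkseq => il; rewrite nth_mkseq.
  rewrite -/(e n) bE size_mkseq => h1 h2 h3 h4; split=> // [i il|v hv pv].
    by have := h2 i il; rewrite nth_mkseq.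
  by apply: h4 => // i il; rewrite nth_mkseq //; exact: pv.
exists e; split; last by move=> n; case: (Pe n).
split=> // [i j ij|i]; first by have [_ h _ _] := Pe j; exact: h.
by case: (Pe i).
Qed.

(* The first-order condition at the maximum e n. *)
Lemma singular_orthogonal (e : nat -> V) n v : unit_or_zero e ->
  (forall w, H w -> (forall i, (i < n)%N -> ip w (e i) = 0) -> N (T w) <= N (T (e n)) * N w) ->
  H v -> (forall i, (i < n)%N -> ip v (e i) = 0) ->
  ip (T (e n)) (T v) = rc (N (T (e n))) * ip (e n) v.
Proof.
move=> [he eo e1] best hv pv; set u := e n in best *; set la := N (T u) in best *.
have hu : H u by exact: he.
have uN : la * N u = la.
  by have [->|h] := e1 n; rewrite ?mulr1 // /la /u h T0 ip0l // mulr0.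
pose D := ip (T u) (T v) - rc la * ip u v; pose Q := la * N v - N (T v).
(* Compares [u] with [u + s D v]. The choice of [D] as the factor makes the first-order term
   [2 s |D|^2], real and positive unless [D = 0]. *)
have key s : 0 < s -> 2 * s * cmod D ^+ 2 <= s ^+ 2 * cmod D ^+ 2 * Q.
  move=> s0; pose c : C := rc s * D.
  have hw : H (u + c *: v) by exact/HD/HZ.
  have := best _ hw _; rewrite TD TZ (ip_norm_lin c (HT hu) (HT hv)) (ip_norm_lin c hu hv) -/la.
  have -> : cmod c ^+ 2 = s ^+ 2 * cmod D ^+ 2 by rewrite cmodM cmod_rc exprMn normr_sq.
  have -> : re (cj c * ip (T u) (T v)) = s * cmod D ^+ 2 + la * re (cj c * ip u v).
    have -> : ip (T u) (T v) = D + rc la * ip u v by rewrite /D subrK.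
    rewrite mulrDr reD {1}/c cjM cj_rc -mulrA [cj D * D]mulrC mul_cj -rcM re_rc.
    by rewrite [rc s * cj D * (rc la * _)]mulrCA [re (rc la * _)]reM re_rc im_rc mul0r subr0.
  move=> /(_ _)/[dup] _ H1; have {H1} : la + 2 * (s * cmod D ^+ 2 + la * re (cj c * ip u v)) +
      s ^+ 2 * cmod D ^+ 2 * N (T v) <= la * (N u + 2 * re (cj c * ip u v) + s ^+ 2 * cmod D ^+ 2 * N v).
    apply: H1 => i il; rewrite (ipDl hu (HZ c hv) (he i)) (ipZl c hv (he i)) pv // mulr0 addr0.
    exact: eo.
  rewrite !mulrDr uN /Q; move: (s ^+ 2 * _) (re _) => y z; lra.
suff D0 : D = 0 by apply/eqP; rewrite -subr_eq0 -/D D0.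
apply: cmod_eq0; apply/eqP; rewrite -[_ == 0]negbK; apply/negP => Dn.
have D2 : 0 < cmod D ^+ 2 by rewrite exprn_even_gt0.
have Q1 : 0 < `|Q| + 1 by rewrite ltr_wpDl.
(* This [s] gives [s * Q <= 1], whereas [key] would give [2 <= s * Q]. *)
have s0 : 0 < (`|Q| + 1)^-1 by rewrite invr_gt0.
have := key _ s0; move: (cmod D ^+ 2) D2 => E E0; set s := _^-1 in s0 * => k1.
have k2 : 2 <= s * Q.
  by rewrite -(ler_pM2l (mulr_gt0 s0 E0)); apply: le_trans (le_trans k1 _); rewrite le_eqVlt; apply/orP; left; apply/eqP; ring.
have k3 : s * (`|Q| + 1) = 1 by rewrite mulVf // gt_eqF.
have : s * Q <= s * (`|Q| + 1) by apply: ler_wpM2l; [exact: ltW|have := ler_norm Q; lra].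
lra.
Qed.

(** The weak form [main] of the eigenvalue equation holds for [v] orthogonal to the earlier vectors
    by the first-order condition at [e n]. For [v = e i] with [i < n] both sides vanish, by the
    condition at [e i]. *)
Lemma singular_eigen (e : nat -> V) n : unit_or_zero e ->
  (forall n v, H v -> (forall i, (i < n)%N -> ip v (e i) = 0) -> N (T v) <= N (T (e n)) * N v) ->
  S (T (e n)) = rc (N (T (e n))) *: e n.
Proof.
move=> ue best; have [he eo e1] := ue; set la := N _.
have hST : H (S (T (e n))) by exact/HS/HT.
apply/eqP; rewrite -subr_eq0; apply/eqP; set w := _ - _.
have hw : H w by apply/HB => //; exact: HZ.
apply: N_def => //.
have main v : H v -> ip (T (e n)) (T v) = rc la * ip (e n) v.
  move=> hv; set q := \sum_(i < n) ip v (e i) *: e i.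
  have hq : H q by apply: (Hsum (fun i => ip v (e i))).
  have hvq := HB hv hq.
  rewrite -[v](subrK q) TD (ipDr (HT hvq) (HT hq) (HT (he n))) (ipDr hvq hq (he n)).
  have -> : ip (T (e n)) (T q) = 0.
    rewrite (ips (HT hq) (HT (he n))) /q (Tsum (fun i => ip v (e i))).
    rewrite (@ip_suml (fun i => ip v (e i)) (fun i => T (e i))); [|by move=> i; exact: HT|exact: HT].
    rewrite big1 ?cj0 // => i _.
    rewrite (singular_orthogonal ue (best i) (he n)); last first.
      by move=> j ji; apply: eo; exact: ltn_trans (ltn_ord i).
    by rewrite ortho0 ?mulr0 // ltn_eqF.
  have -> : ip (e n) q = 0.
    rewrite (ips hq (he n)) /q (@ip_suml (fun i => ip v (e i)) e) // big1 ?cj0 // => i _.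
    by rewrite ortho0 ?mulr0 // ltn_eqF.
  rewrite !addr0 (singular_orthogonal ue (best n) hvq) // => i il.
  exact: proj_perp.
rewrite {1}/w (ipBl hST (HZ (rc la) (he n)) hw) (ipZl _ (he n) hw) -main //.
by rewrite (ips hw hST) -(adj hw (HT (he n))) -(ips (HT hw) (HT (he n))) subrr.
Qed.

(** The values [la n] have bounded sums, so only indices below some [K] reach [t ^+ 2]. An
    eigenvector [v] is orthogonal to each [e n] with another eigenvalue. Removing its components on
    the first [K] vectors leaves an eigenvector on which [T] is too small, hence 0. *)
Lemma singular_dim (e : nat -> V) (t : R) : unit_or_zero e -> 0 < t ->
  (forall n v, H v -> (forall i, (i < n)%N -> ip v (e i) = 0) -> N (T v) <= N (T (e n)) * N v) ->
  (forall n, N (T (e n.+1)) <= N (T (e n))) ->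
  exists d, has_dim (eigenspace_in H (S \o T) (rc (t ^+ 2))) d /\
    ([set n | N (T (e n)) = t ^+ 2] #= `I_d)%card.
Proof.
move=> ue t0 best mono; have [he eo e1] := ue; pose la n := N (T (e n)).
have t2 : 0 < t ^+ 2 by rewrite exprn_gt0.
have [K laK] : exists K, la K < t ^+ 2.
  apply: contrapT => /forallNP big.
  have [n Hn] : exists n : nat, C0 / t ^+ 2 < n%:R by exists (Num.trunc (C0 / t ^+ 2)).+1; exact: truncnS_gt.
  have := hilbert_schmidt_sum n ue.
  have : \sum_(i < n) t ^+ 2 <= \sum_(i < n) la i.
    by apply: ler_sum => i _; rewrite leNgt; apply/negP/big.
  rewrite sumr_const card_ord -[t ^+ 2 *+ n]mulr_natr mulrC.
  by move: Hn; rewrite ltr_pdivrMr // /la; lra.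
have laK' n : la n = t ^+ 2 -> (n < K)%N.
  move=> lan; rewrite ltnNge; apply/negP => Kn; move: laK; rewrite -lan ltNge => /negP[].
  by move: n Kn {lan}; apply: (@homo_leq _ la (fun y z => z <= y)) => // y z w yz zw; exact: le_trans zw yz.
pose l := [seq n <- iota 0 K | la n == t ^+ 2].
have lP n : (n \in l) = (la n == t ^+ 2).
  rewrite mem_filter mem_iota add0n /=; case: eqP => //= h.
  by apply: laK'.
have lu : uniq l by rewrite filter_uniq // iota_uniq.
pose f (i : 'I_(size l)) := nth 0%N l i.
have lf i : la (f i) = t ^+ 2 by apply/eqP; rewrite -lP mem_nth.
have Nf i : N (e (f i)) = 1.
  have [//|e0] := e1 (f i); have := lf i.
  by rewrite /la e0 T0 ip0l // => h; move: t2; rewrite -h ltxx.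
exists (size l); split; last first.
  have <- : nth 0%N l @` `I_(size l) = [set n | N (T (e n)) = t ^+ 2].
    apply/seteqP; split=> [_ [i il <-]|n /= /eqP]; first exact: (lf (Ordinal il)).
    by rewrite -lP => nl; exists (index n l); rewrite ?nth_index //= index_mem.
  apply: inj_card_eq => i j; rewrite !inE /= => il jl /eqP.
  by rewrite nth_uniq // => /eqP.
exists (fun i => e (f i)); split=> [i|c c0 j|v [hv /= Ev]].
- split=> //=; rewrite (@singular_eigen e (f i) ue best); congr (rc _ *: _); exact: lf.
- have := congr1 (fun w => ip w (e (f j))) c0; rewrite ip0l //.
  have -> : ip (\sum_(i < size l) c i *: e (f i)) (e (f j)) = \sum_(i < size l) c i * ip (e (f i)) (e (f j)).
    suff [] : H (\sum_(i < size l) c i *: e (f i)) /\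
      ip (\sum_(i < size l) c i *: e (f i)) (e (f j)) = \sum_(i < size l) c i * ip (e (f i)) (e (f j)) by [].
    apply: (big_ind2 (fun w z => H w /\ ip w (e (f j)) = z)) => [|w z w' z' [hw <-] [hw' <-]|i _].
    - by rewrite ip0l.
    - by rewrite ipDl //; split=> //; exact: HD.
    - by rewrite ipZl //; split=> //; exact: HZ.
  rewrite (bigD1 j) //= big1 ?addr0; last first.
    move=> i ij; rewrite ortho0 ?mulr0 //; apply: contra ij => /eqP h.
    by rewrite -val_eqE /= -(nth_uniq 0%N _ _ lu) //; apply/eqP.
  by rewrite ipxx // Nf rc1 mulr1.
- have vperp n : la n != t ^+ 2 -> ip v (e n) = 0.
    move=> ln; have h : rc (la n) * ip (e n) v = rc (t ^+ 2) * ip (e n) v.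
      rewrite -(ipZl _ (he n) hv) -(@singular_eigen e (n) ue best) (ips hv (HS (HT (he n)))).
      rewrite -(adj hv (HT (he n))) -(ips (HT hv) (HT (he n))) (adj (he n) (HT hv)).
      by rewrite Ev (ipZr _ hv (he n)) cj_rc.
    rewrite (ips (he n) hv); apply/eqP; rewrite -(inj_eq (can_inj (@cjK R))) cjK cj0.
    have : rc (la n - t ^+ 2) * ip (e n) v = 0 by rewrite rcD rcN mulrBl h subrr.
    move/eqP; rewrite mulf_eq0 => /orP[/eqP /(congr1 re)|//]; rewrite re_rc => /eqP.
    by rewrite subr_eq0 (negPf ln).
  set q := \sum_(i < K) ip v (e i) *: e i.
  have hq : H q by apply: (Hsum (fun i => ip v (e i))).
  have hvq := HB hv hq.
  have Eq : S (T q) = rc (t ^+ 2) *: q.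
    have hSq : H (S (T q)) by exact/HS/HT.
    have Hsub := HB hSq (HZ (rc (t ^+ 2)) hq).
    apply/eqP; rewrite -subr_eq0; apply/eqP/N_def => //.
    set w := _ - _ in Hsub *.
    rewrite {1}/w (ipBl hSq (HZ _ hq) Hsub) (ipZl _ hq Hsub) (ips Hsub hSq) -(adj Hsub (HT hq)) -(ips (HT Hsub) (HT hq)).
    rewrite /q (Tsum (fun i => ip v (e i))) (@ip_suml (fun i => ip v (e i)) (fun i => T (e i))); [|by move=> i; exact: HT|exact: HT].
    rewrite (@ip_suml (fun i => ip v (e i)) e) // mulr_sumr -sumrB big1 // => i _.
    have [li|/vperp ->] := eqVneq (la i) (t ^+ 2); last by rewrite !mul0r mulr0 subrr.
    rewrite (ips (HT Hsub) (HT (he i))) (adj Hsub (HT (he i))) -(ips Hsub (HS (HT (he i)))).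
    rewrite (@singular_eigen e (i) ue best) -/(la i) li (ipZl _ (he i) Hsub).
    by rewrite mulrCA subrr.
  (* On [v - q] one has both [N (T (v - q)) = t ^+ 2 * N (v - q)] and the bound [la K * N (v - q)]
     with [la K < t ^+ 2]. *)
  have v0 : v - q = 0.
    apply: N_def => //; have := best K _ hvq (fun i iK => proj_perp ue hv iK).
    have tr w : H w -> S (T w) = rc (t ^+ 2) *: w -> ip (T w) (T (v - q)) = rc (t ^+ 2) * ip w (v - q).
      move=> hw Ew; rewrite (ips (HT hvq) (HT hw)) (adj hvq (HT hw)) Ew (ipZr _ hw hvq).
      by rewrite cjM !cj_rc -(ips hvq hw).
    have -> : N (T (v - q)) = t ^+ 2 * N (v - q).
      rewrite {1}TB (ipBl (HT hv) (HT hq) (HT hvq)) (tr _ hv Ev) (tr _ hq Eq) -mulrBr -(ipBl hv hq hvq).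
      by rewrite reM re_rc im_rc mul0r subr0.
    have := N_ge0 hvq; rewrite le_eqVlt => /orP[/eqP <- //|p0].
    by rewrite ler_pM2r // => h; move: laK; rewrite ltNge h.
  exists (fun i => ip v (e (f i))).
  rewrite -[LHS](subrK q) v0 add0r /q -(big_mkord xpredT (fun i => ip v (e i) *: e i)) /index_iota subn0.
  rewrite (bigID (fun i => la i == t ^+ 2)) /= [X in _ + X]big1 ?addr0; last first.
    by move=> i /vperp ->; rewrite scale0r.
  by rewrite -big_filter -/l (big_nth 0%N) big_mkord.
Qed.

Lemma hilbert_schmidt_schatten (nrm : V -> \bar R) (p : R) :
  (forall v, H v -> nrm v = (Num.sqrt (N v))%:E) -> 2 <= p -> schatten H ip nrm p T.
Proof.
move=> nrmE p2; split.
  move=> f hf [M fM].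
  have M0 : 0 <= M.
    by rewrite -lee_fin; apply: le_trans (fM 0%N); rewrite nrmE // lee_fin sqrtr_ge0.
  have fN n : N (f n) <= M ^+ 2.
    have := fM n; rewrite nrmE // lee_fin => h.
    by rewrite -(sqr_sqrtr (N_ge0 (hf n))) ler_pXn2r ?nnegrE ?sqrtr_ge0.
  have [k [kh [u hu [uM wu]]]] := weak_subseq hf fN.
  exists k; split=> //; exists (T u); split; first exact: HT.
  have hd q : H (f (k q) - u) := HB (hf _) hu.
  have TN : N (T (f (k q) - u)) @[q --> \oo] --> 0.
    apply: (@weak_null_image _ (4 * M ^+ 2)) => // q.
    by have := ip_normB (hf (k q)) hu; have := fN (k q); lra.
  have -> : (fun n => nrm (T (f (k n)) - T u)) = (fun n => (Num.sqrt (N (T (f (k n) - u))))%:E).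
    by apply/funext => n; rewrite -TB nrmE //; exact: HT.
  apply: cvg_EFin; first exact: nearW.
  rewrite -[X in _ --> X]sqrtr0; apply: continuous_cvg => //; exact: sqrt_continuous.
have [e [ue best]] := singular_vectors; have [he eo e1] := ue.
pose la n := N (T (e n)); have la0 n : 0 <= la n by exact/N_ge0/HT.
have N1 n : N (e n) <= 1 by have [->//|->] := e1 n; rewrite ip0l.
have mono n : la n.+1 <= la n.
  apply: le_trans (best n _ (he n.+1) _) _; first by move=> i il; apply: eo; exact: ltnW.
  exact: (ler_piMr (la0 n) (N1 n.+1)).
pose s n := Num.sqrt (la n).
have s0 n : 0 <= s n by exact: sqrtr_ge0.
have sn : nonincreasing_seq s.
  by apply/nonincreasing_seqP => n; rewrite ler_sqrt.
exists s; split.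
  split=> //; exists S; split=> // t t0.
  have [d [hd card]] := singular_dim ue t0 best mono; exists d; split=> //.
  have -> // : [set n | s n = t] = [set n | N (T (e n)) = t ^+ 2].
  apply/seteqP; split=> n /=; first by move=> <-; rewrite sqr_sqrtr // la0.
  by rewrite /s /la => ->; rewrite sqrtr_sqr gtr0_norm.
(* As [p >= 2] and [s] decreases, the powers beyond the second are absorbed by [s 0]; the squares
   sum to at most [C0]. *)
have sp n : s n `^ p <= s 0%N `^ (p - 2) * la n.
  have [z|nz] := eqVneq (s n) 0.
    rewrite z powR0 ?mulr_ge0 ?powR_ge0 //; lra.
  have -> : s n `^ p = s n `^ (p - 2) * la n.
    have -> : la n = s n `^ 2 by rewrite powR_mulrn // sqr_sqrtr // la0.
    by rewrite -powRD ?nz ?implybT // subrK.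
  apply: ler_wpM2r => //; apply: ge0_ler_powR; rewrite ?nnegrE //; first lra.
  exact: sn.
apply: (@le_lt_trans _ _ (s 0%N `^ (p - 2) * C0)%:E); last exact: ltry.
apply: lime_le; first by apply: is_cvg_nneseries => n _ _; rewrite lee_fin powR_ge0.
apply: nearW => n; rewrite sumEFin lee_fin big_mkord.
apply: (@le_trans _ _ (\sum_(i < n) s 0%N `^ (p - 2) * la i)); first exact: ler_sum.
rewrite -mulr_sumr; apply: ler_wpM2l; first exact: powR_ge0.
exact: hilbert_schmidt_sum.
Qed.

End HilbertSchmidt.

(** * H^2 as a space of coefficient sequences, and composition operators on it *)

Section HardySpaces.
Variable R : realType.
Local Notation C := (Cplx R).
Local Notation re := (@complex.Re R).
Local Notation im := (@complex.Im R).
Local Notation m := (uniform_prob (two_pi_gt0 R)).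
Implicit Types (a b c : nat -> C) (z w : C) (u h : R -> C) (F G : C -> C) (f g : disk R -> C).

Lemma rc_le (x y : R) : ((rc x : C) <= rc y) = (x <= y).
Proof. by rewrite /rc lecR. Qed.

Lemma disk_lt (z : disk R) : cmod (val z) < 1.
Proof. by case: z => y y1 /=; rewrite -rc_lt rc1 -norm_cmod. Qed.

Lemma disk_norm_lt z : cmod z < 1 -> `|z| < 1.
Proof. by rewrite norm_cmod (rc_lt _ 1). Qed.

Lemma disk_ex z : cmod z < 1 -> exists y : disk R, val y = z.
Proof. by move=> /disk_norm_lt z1; exists (exist _ z z1). Qed.

Lemma ext_val f (z : disk R) : ext f (val z) = f z.
Proof. by rewrite /ext valK. Qed.

Definition res F : disk R -> C := fun z : disk R => F (val z).

Lemma ext_res F z : cmod z < 1 -> ext (res F) z = F z.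
Proof. by move=> /disk_ex[y <-]; rewrite ext_val. Qed.

Lemma analytic_holo f : analytic f -> holo (ext f).
Proof. by move=> hf z /disk_ex[y <-]; exact/derivable_cder/hf. Qed.

Lemma holo_ext F G : (forall z, cmod z < 1 -> F z = G z) -> holo F -> holo G.
Proof.
move=> FG hF z z1; apply: (@cder_near _ F _ _ (1 - cmod z)); [by rewrite subr_gt0| |exact: hF].
by move=> w wz; apply: FG; have := cmodD (w - z) z; rewrite subrK; lra.
Qed.

Lemma holo_analytic F : holo F -> analytic (res F).
Proof.
move=> hF z; apply: cder_derivable; apply: holo_ext hF _ (disk_lt z) => w w1.
by rewrite ext_res.
Qed.

Let circle_cont F r : holo F -> 0 <= r < 1 -> ccont (fun t => F (rc r * expi t)).
Proof.
by move=> hF r01; apply: ccont_circle => t; exact/cder_ccts/hF/circle_lt1.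
Qed.

Lemma RI_EFin (x : R -> R) : ri x -> (\int[m]_t (x t)%:E = (RI x)%:E)%E.
Proof. by move=> rx; rewrite /RI /Rintegral fineK //; exact: integrable_fin_num. Qed.

Lemma hardy_mean1E f r : analytic f -> 0 <= r < 1 ->
  hardy_mean 1 f r = (RI (fun t => cmod (ext f (rc r * expi t))))%:E.
Proof.
move=> hf r01; rewrite /hardy_mean Lnorm1 -RI_EFin; last first.
  by apply/ri_cmod/ccont_cint/circle_cont => //; exact: analytic_holo.
by apply: eq_integral => t _; rewrite gee0_abs // lee_fin cmod_ge0.
Qed.

Lemma hardy_mean2E f r : analytic f -> 0 <= r < 1 ->
  hardy_mean 2 f r = (Num.sqrt (RI (fun t => cmod (ext f (rc r * expi t)) ^+ 2)))%:E.
Proof.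
move=> hf r01; rewrite /hardy_mean unlock.
have -> : (\int[m]_t (`|(cmod (ext f (rc r * expi t)))%:E| `^ 2) =
    (RI (fun t => cmod (ext f (rc r * expi t)) ^+ 2))%:E)%E.
  rewrite -RI_EFin; last by apply: csq_ccont; apply: circle_cont => //; exact: analytic_holo.
  by apply: eq_integral => t _; rewrite /= ger0_norm ?cmod_ge0 // powR_mulrn ?cmod_ge0.
by rewrite poweR_EFin powR12_sqrt // RI_ge0 // => t; exact: sqr_ge0.
Qed.

Let in01 (r : R) : 0 <= r < 1 -> r \in `[0, 1[.
Proof. by rewrite in_itv. Qed.

Lemma hardy_norm_fin p f : hardy p f -> exists M : R, forall r, 0 <= r < 1 -> (hardy_mean p f r <= M%:E)%E.
Proof.
move=> [hf]; have : forall r, 0 <= r < 1 -> (hardy_mean p f r <= hardy_norm p f)%E.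
  by move=> r r01; apply: ereal_sup_ubound; exists r => //; exact: in01.
case: (hardy_norm p f) => [M|//|]; first by move=> h _; exists M.
by move=> h _; exists 0 => r r01; apply: le_trans (h r r01) (leNye _).
Qed.

Lemma hardy1_mean f : hardy 1 f ->
  exists M : R, forall r, 0 < r -> r < 1 -> RI (fun t => cmod (ext f (rc r * expi t))) <= M.
Proof.
move=> hf; have [M hM] := hardy_norm_fin hf; exists M => r r0 r1; have [af _] := hf.
have r01 : 0 <= r < 1 by rewrite (ltW r0).
by have := hM r r01; rewrite hardy_mean1E.
Qed.

Lemma hardy_mean2_le f (M : R) r : analytic f -> 0 <= r < 1 -> (hardy_mean 2 f r <= M%:E)%E ->
  RI (fun t => cmod (ext f (rc r * expi t)) ^+ 2) <= M ^+ 2.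
Proof.
move=> af r01; rewrite hardy_mean2E // lee_fin => h.
have I0 : 0 <= RI (fun t => cmod (ext f (rc r * expi t)) ^+ 2) by apply: RI_ge0 => t; exact: sqr_ge0.
rewrite -(sqr_sqrtr I0) ler_pXn2r ?nnegrE ?sqrtr_ge0 //.
by apply: le_trans h; exact: sqrtr_ge0.
Qed.

Lemma hardy2_coef f : hardy 2 f -> exists a M, sqsum a M /\ f = res (psum a).
Proof.
move=> hf; have [M hM] := hardy_norm_fin hf; have [af _] := hf.
have [a aM aE] := @taylor2 _ _ (M ^+ 2) (analytic_holo af) (fun r r0 r1 =>
  hardy_mean2_le af (introT andP (conj (ltW r0) r1)) (hM r (introT andP (conj (ltW r0) r1)))).
by exists a, (M ^+ 2); split=> //; apply/funext => z; rewrite /res -aE ?ext_val //; exact: disk_lt.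
Qed.

Lemma psum_holo a (M : R) : sqsum a M -> holo (psum a).
Proof. by move=> aM z; exact: psum_cder (sqsum_bounded aM). Qed.

Lemma hardy_norm2_le a (M : R) : sqsum a M -> (hardy_norm 2 (res (psum a)) <= (Num.sqrt M)%:E)%E.
Proof.
move=> aM; apply: ge_ereal_sup => _ [r /= r01 <-]; rewrite in_itv /= in r01.
rewrite hardy_mean2E //; last exact/holo_analytic/(psum_holo aM).
rewrite lee_fin ler_sqrt ?(sqsum_ge0 aM) //; apply: le_trans (parseval_le (sqsum_bounded aM) aM r01).
by rewrite le_eqVlt; apply/orP; left; apply/eqP; apply: eq_RI => t; rewrite ext_res // circle_lt1.
Qed.

Lemma coef_hardy2 a (M : R) : sqsum a M -> hardy 2 (res (psum a)).
Proof.
move=> aM; split; first exact/holo_analytic/(psum_holo aM).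
exact: le_lt_trans (hardy_norm2_le aM) (ltry _).
Qed.

Lemma hardy_norm2E a (M : R) : sqsum a M ->
  hardy_norm 2 (res (psum a)) = (Num.sqrt (limn (sqs a)))%:E.
Proof.
move=> aM; have aL : sqsum a (limn (sqs a)) by move=> N; exact: sqs_le_lim.
apply/le_anti; rewrite hardy_norm2_le //=.
have af := holo_analytic (psum_holo aM).
have mle r : 0 <= r < 1 -> (hardy_mean 2 (res (psum a)) r <= hardy_norm 2 (res (psum a)))%E.
  by move=> r01; apply: ereal_sup_ubound; exists r => //; exact: in01.
have r00 : 0 <= (0 : R) < 1 by rewrite lexx ltr01.
have := mle 0 r00; have := hardy_norm2_le aL.
case: (hardy_norm 2 _) mle => [x|//|] mle; last by rewrite hardy_mean2E.
rewrite hardy_mean2E // !lee_fin => _ x0.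
have x0' : 0 <= x by apply: le_trans x0; exact: sqrtr_ge0.
rewrite -(ger0_norm x0') -sqrtr_sqr ler_sqrt ?sqr_ge0 //.
have ax : sqsum a (x ^+ 2).
  apply: (parseval_ge (sqsum_bounded aM)) => r r0 r1; have r01 : 0 <= r < 1 by rewrite (ltW r0).
  have := hardy_mean2_le af r01 (mle r r01); congr (_ <= _); apply: eq_RI => t.
  by rewrite ext_res // circle_lt1.
by apply: limr_le; [exact: sqs_cvg aM|apply: nearW => n; exact: ax].
Qed.

Lemma radial_boundary f t l : radial (ext f) t l -> boundary f t = l.
Proof.
move=> h; apply: cvg_lim => //; apply/cvgrPdist_le => e /gt0_rc[x x0 ->].
have [d d0 H] := h x x0.
near=> r; rewrite norm_cmod cmodBC rc_le; apply: H; near: r; [apply: nbhs_left_gt; lra|exact: nbhs_left_lt].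
Unshelve. all: by end_near.
Qed.

Lemma boundary_bfun a (M : R) h : sqsum a M -> bfun a h ->
  \forall t \ae m, boundary (res (psum a)) t = h t.
Proof.
move=> aM ah; apply: aeS (radial_bfun aM ah) => t H; apply: radial_boundary.
by apply: radial_ext H => z z1; rewrite ext_res.
Qed.

(** The inner product is defined through boundary functions, which equal the Riesz-Fischer functions
    almost everywhere. *)
Lemma hardy2_ip_clim a b (M M' : R) : sqsum a M -> sqsum b M' ->
  clim (fun N => \sum_(i < N) a i * cj (b i)) (hardy2_ip (res (psum a)) (res (psum b))).
Proof.
move=> aM bM; have [h ah] := riesz_fischer aM; have [g bg] := riesz_fischer bM.
have -> : hardy2_ip (res (psum a)) (res (psum b)) = CI (fun t => h t * cj (g t)).
  apply: CI_ae; apply: aeS (aeI (boundary_bfun aM ah) (boundary_bfun bM bg)) => t [-> ->] //.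
exact: bfun_ip.
Qed.

Definition monom n : disk R -> C := res (fun z : C => z ^+ n).

Let delta_sq n : sqsum (fun k => (k == n)%:R : C) 1.
Proof.
move=> N; have [nN|Nn] := ltnP n N.
  rewrite (bigD1 (Ordinal nN)) //= eqxx cmod1 expr1n big1 ?addr0 // => i.
  by rewrite -val_eqE /= => /negPf ->; rewrite cmod0 expr0n.
by rewrite big1 // => i _; rewrite ltn_eqF ?cmod0 ?expr0n //; exact: leq_trans Nn.
Qed.

Let monomE n : monom n = res (psum (fun k => (k == n)%:R)).
Proof.
apply/funext => z; rewrite /monom /res -[LHS]mul1r -(psum_delta 1 n (disk_lt z)).
by congr psum; apply/funext => k; rewrite mulr1.
Qed.

Lemma monom_hardy n : hardy 2 (monom n).
Proof. by rewrite monomE; exact: coef_hardy2 (delta_sq n). Qed.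

Lemma ip_monom a (M : R) n : sqsum a M -> hardy2_ip (res (psum a)) (monom n) = a n.
Proof.
move=> aM; rewrite monomE; apply: (clim_uniq (hardy2_ip_clim aM (delta_sq n))) => e e0.
exists n.+1 => N nN; rewrite (bigD1 (Ordinal nN)) //= eqxx big1.
  by rewrite cj_rc mulr1 addr0 subrr cmod0.
by move=> i; rewrite -val_eqE /= => /negPf ->; rewrite cj0 mulr0.
Qed.

Lemma hardy2_lin k f g : hardy 2 f -> hardy 2 g -> exists a b Ma Mb,
  [/\ sqsum a Ma, sqsum b Mb, f = res (psum a), g = res (psum b) &
   k *: f + g = res (psum (fun n => b n + k * a n)) /\ exists M, sqsum (fun n => b n + k * a n) M].
Proof.
move=> /hardy2_coef[a [Ma [aM ->]]] /hardy2_coef[b [Mb [bM ->]]].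
exists a, b, Ma, Mb; split=> //; split.
  apply/funext => z; rewrite /res (psum_lin k (sqsum_bounded bM) (sqsum_bounded aM) (disk_lt z)).
  by rewrite addrC.
exists (2 * (Mb + cmod k ^+ 2 * Ma)) => N.
apply: (@le_trans _ _ (\sum_(i < N) 2 * (cmod (b i) ^+ 2 + cmod k ^+ 2 * cmod (a i) ^+ 2))).
  by apply: ler_sum => i _; rewrite -exprMn -cmodM; exact: cmod_sqD.
rewrite -mulr_sumr big_split -mulr_sumr /=; apply: ler_wpM2l => //; apply: lerD; first exact: bM.
by apply: ler_wpM2l; [exact: sqr_ge0|exact: aM].
Qed.

Lemma hardy2_N a (M : R) : sqsum a M -> hardy2_ip (res (psum a)) (res (psum a)) = rc (limn (sqs a)).
Proof.
move=> aM; apply: (clim_uniq (hardy2_ip_clim aM aM)); apply: cvg_clim.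
  rewrite re_rc; have -> : (fun n => re (\sum_(i < n) a i * cj (a i))) = sqs a; last exact: sqs_cvg aM.
  by apply/funext => N; rewrite re_sum; apply: eq_bigr => i _; rewrite mul_cj.
rewrite im_rc; have -> : (fun n => im (\sum_(i < n) a i * cj (a i))) = fun=> 0; last exact: cvg_cst.
by apply/funext => N; rewrite im_sum big1 // => i _; rewrite mul_cj.
Qed.

Section CompositionSchatten.
Variables (phi : disk R -> disk R) (P : C -> C) (C0 : R).
Hypothesis hP : holo P.
Hypothesis P1 : forall z, cmod z < 1 -> cmod (P z) < 1.
Hypothesis phiE : forall z : disk R, val (phi z) = P (val z).
Hypothesis P_mean : forall r, 0 < r -> r < 1 ->
  RI (fun t => (1 - cmod (P (rc r * expi t)) ^+ 2)^-1) <= C0.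

Let T := comp_op phi.

Let den z : cmod z < 1 -> 0 < 1 - cmod (P z) ^+ 2.
Proof. by move=> z1; rewrite subr_gt0 expr_lt1 ?cmod_ge0 ?P1. Qed.

Lemma den_ri r : 0 < r -> r < 1 -> ri (fun t => (1 - cmod (P (rc r * expi t)) ^+ 2)^-1).
Proof.
move=> r0 r1; apply: ri_cont => t.
have c1 := ccont_cmod (holo_circle hP r0 r1) (x := t).
have d0 : 1 - cmod (P (rc r * expi t)) ^+ 2 != 0 by rewrite gt_eqF // den // cmod_circle // ltW.
apply: cvgV => //; apply: cvgB; first exact: cvg_cst.
have -> : (fun s => cmod (P (rc r * expi s)) ^+ 2) = (fun s => cmod (P (rc r * expi s)) * cmod (P (rc r * expi s))).
  by apply/funext => s; rewrite expr2.
by rewrite expr2; apply: cvgM.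
Qed.

(** [|f(P)|^2 <= M / (1 - |P|^2)] by the evaluation bound, so [P_mean] gives boundedness on H^2 as
    well. *)
Lemma comp_coef a (M : R) : sqsum a M ->
  exists2 b, sqsum b (M * C0) & T (res (psum a)) = res (psum b).
Proof.
move=> aM; have hF : holo (fun z => psum a (P z)).
  by move=> z z1; apply: cder_comp; [exact: hP|exact/(psum_holo aM)/P1].
have [r r0 r1|b bM bE] := taylor2 (M := M * C0) hF; last first.
  exists b; [exact: bM|apply/funext => z].
  by rewrite -[LHS]/(psum a (val (phi z))) phiE (bE _ (disk_lt z)).
have rz t : cmod (rc r * expi t : C) < 1 by rewrite cmod_circle // ltW.
apply: (@le_trans _ _ (RI (fun t => M * (1 - cmod (P (rc r * expi t)) ^+ 2)^-1))).
  apply: le_RI; [exact: csq_ccont (holo_circle hF r0 r1)|exact/riZ/den_ri|].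
  by move=> t; apply: psum_le_sq => //; exact: P1.
by rewrite RIZ ?den_ri //; apply: ler_wpM2l (P_mean r0 r1); exact: sqsum_ge0 aM.
Qed.

Lemma comp_monom n : exists2 b, sqsum b (1 * C0) & T (monom n) = res (psum b).
Proof. by rewrite monomE; exact: comp_coef (delta_sq n). Qed.

(** The image of the i-th monomial is [P ^+ i], and the integrand of [P_mean] is the geometric
    series of the [|P| ^ (2 i)]. *)
Lemma comp_monom_sum n : \sum_(i < n) re (hardy2_ip (T (monom i)) (T (monom i))) <= C0.
Proof.
have [b Hb] : {b : nat -> nat -> C & forall i, sqsum (b i) (1 * C0) /\ T (monom i) = res (psum (b i))}.
  apply: (@choice _ _ (fun i b => sqsum b (1 * C0) /\ T (monom i) = res (psum b))) => i.
  by have [b h1 h2] := comp_monom i; exists b.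
have bE i z : cmod z < 1 -> psum (b i) z = P z ^+ i.
  move=> /disk_ex[y <-]; have [_ h] := Hb i.
  by rewrite -[LHS]/(res (psum (b i)) y) -h -[LHS]/(val (phi y) ^+ i) phiE.
apply: (@cvg_le_cst _ (fun J => \sum_(i < n) sqs (b i) J)).
  apply: (@cvg_sum_ord _ (fun i J => sqs (b i) J) (fun i => re (hardy2_ip (T (monom i)) (T (monom i))))) => i; have [bi ->] := Hb i.
  by rewrite (hardy2_N bi) re_rc; exact: sqs_cvg bi.
(* For [j < J] the weight [(r ^+ j) ^+ 2] is at least [r ^+ J.*2], so the bound at radius [r] passes
   to the coefficients as [r] tends to 1. *)
move=> J; apply: (@pow_limit _ _ _ (J.*2)); first by apply: sumr_ge0 => i _; apply: sumr_ge0 => j _; exact: sqr_ge0.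
move=> r r0 r1; have r01 : 0 <= r < 1 by rewrite (ltW r0).
have rz t : cmod (rc r * expi t : C) < 1 by rewrite cmod_circle // ltW.
apply: le_trans (P_mean r0 r1); rewrite mulr_suml.
have sri i : ri (fun t => cmod (psum (b i) (rc r * expi t)) ^+ 2).
  have [bi _] := Hb i; exact/ri_cont/(ri_sqr_psum (sqsum_bounded bi)).
apply: (@le_trans _ _ (\sum_(i < n) RI (fun t => cmod (psum (b i) (rc r * expi t)) ^+ 2))).
  apply: ler_sum => i _; have [bi _] := Hb i.
  have pl := parseval_lim (sqsum_bounded bi) r01.
  have nd : nondecreasing_seq (fun N => \sum_(j < N) cmod (b i j) ^+ 2 * (r ^+ j) ^+ 2).
    by apply/nondecreasing_seqP => N; rewrite big_ord_recr /= lerDl mulr_ge0 ?sqr_ge0.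
  rewrite -(cvg_lim _ pl) //; apply: le_trans (nondecreasing_cvgn_le nd _ J); last by apply/cvg_ex; eexists; exact: pl.
  rewrite mulr_suml; apply: ler_sum => j _; apply: ler_wpM2l; first exact: sqr_ge0.
  rewrite -exprM; apply: ler_wiXn2l; [exact: ltW|exact: ltW|].
  by rewrite muln2 leq_double ltnW.
have [s1 <-] := RI_sum n sri; apply: le_RI => //; first exact: den_ri.
move=> t; under eq_bigr do rewrite bE // cmodX -exprM mulnC exprM.
have d0 := den (rz t); rewrite subr_gt0 in d0.
exact: geo_le (sqr_ge0 _) d0.
Qed.

Lemma comp_schatten p : 2 <= p -> schatten (hardy 2) (@hardy2_ip R) (hardy_norm 2) p T.
Proof.
move=> p2.
have Hlin (k : C) f g : hardy 2 f -> hardy 2 g -> hardy 2 (k *: f + g).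
  by move=> hf hg; have [a [b [Ma [Mb [_ _ _ _ [-> [M h]]]]]]] := hardy2_lin k hf hg; exact: coef_hardy2 h.
have H0 : hardy 2 (0 : disk R -> C).
  by have := Hlin (-1) _ _ (monom_hardy 0) (monom_hardy 0); rewrite scaleN1r addNr.
have ipl (k : C) f g (w : disk R -> C) : hardy 2 f -> hardy 2 g -> hardy 2 w ->
    hardy2_ip (k *: f + g) w = k * hardy2_ip f w + hardy2_ip g w.
  move=> hf hg /hardy2_coef[c [Mc [cM ->]]].
  have [a [b [Ma [Mb [aM bM -> -> [-> [M h]]]]]]] := hardy2_lin k hf hg.
  apply: (clim_uniq (hardy2_ip_clim h cM)); rewrite addrC.
  have -> : (fun N => \sum_(i < N) (b i + k * a i) * cj (c i)) =
      (fun N => \sum_(i < N) b i * cj (c i) + k * (\sum_(i < N) a i * cj (c i))).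
    apply/funext => N; rewrite mulr_sumr -big_split; apply: eq_bigr => i _ /=.
    by rewrite mulrDl mulrA.
  exact: climD (hardy2_ip_clim bM cM) (climZ k (hardy2_ip_clim aM cM)).
have ips f g : hardy 2 f -> hardy 2 g -> hardy2_ip g f = cj (hardy2_ip f g).
  move=> /hardy2_coef[a [Ma [aM ->]]] /hardy2_coef[b [Mb [bM ->]]].
  apply: (clim_uniq (hardy2_ip_clim bM aM)).
  have -> : (fun N => \sum_(i < N) b i * cj (a i)) = (fun N => cj (\sum_(i < N) a i * cj (b i))).
    apply/funext => N; apply: cE; rewrite ?re_cj ?im_cj ?re_sum ?im_sum -?sumrN; apply: eq_bigr => i _;
      rewrite ?reM ?imM ?re_cj ?im_cj; ring.
  exact: clim_cj (hardy2_ip_clim aM bM).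
have lim0 a (M : R) : sqsum a M -> 0 <= limn (sqs a).
  by move=> aM; apply: le_trans (sqs_le_lim 0 aM); rewrite /sqs big_ord0.
have N_ge0 f : hardy 2 f -> 0 <= re (hardy2_ip f f).
  by move=> /hardy2_coef[a [Ma [aM ->]]]; rewrite (hardy2_N aM) re_rc (lim0 _ _ aM).
have N_def f : hardy 2 f -> re (hardy2_ip f f) = 0 -> f = 0.
  move=> /hardy2_coef[a [Ma [aM ->]]]; rewrite (hardy2_N aM) re_rc => a0.
  have an n : a n = 0.
    have := sqs_le_lim n.+1 aM; rewrite a0 /sqs big_ord_recr /= => h.
    have h2 : 0 <= \sum_(i < n) cmod (a i) ^+ 2 by apply: sumr_ge0 => i _; exact: sqr_ge0.
    apply: cmod_eq0; apply/eqP; rewrite -sqrf_eq0 eq_le sqr_ge0 andbT; lra.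
  apply/funext => z; rewrite /res; apply: (psumP (sqsum_bounded aM) (disk_lt z)).
  have -> : ppart a (val z) = fun=> 0; last exact: clim_cst.
  by apply/funext => N; rewrite /ppart big1 // => i _; rewrite an mul0r.
have ipx i j : hardy2_ip (monom i) (monom j) = (i == j)%:R.
  by rewrite {1}monomE (ip_monom j (delta_sq i)) eq_sym.
have parsevalx f : hardy 2 f ->
    sqs (fun j => hardy2_ip f (monom j)) n @[n --> \oo] --> re (hardy2_ip f f).
  move=> /hardy2_coef[a [Ma [aM ->]]]; rewrite (hardy2_N aM) re_rc.
  have -> : (fun j => hardy2_ip (res (psum a)) (monom j)) = a; last exact: sqs_cvg aM.
  by apply/funext => j; exact: ip_monom aM.
have riesz a (M : R) : sqsum a M -> exists2 u, hardy 2 u & forall j, hardy2_ip u (monom j) = a j.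
  by move=> aM; exists (res (psum a)); [exact: coef_hardy2 aM|move=> j; exact: ip_monom aM].
have HT f : hardy 2 f -> hardy 2 (T f).
  by move=> /hardy2_coef[a [Ma [aM ->]]]; have [b bM ->] := comp_coef aM; exact: coef_hardy2 bM.
have Tlin (k : C) f g : T (k *: f + g) = k *: T f + T g by [].
have Tb f : hardy 2 f -> re (hardy2_ip (T f) (T f)) <= C0 * re (hardy2_ip f f).
  move=> /hardy2_coef[a [Ma [aM ->]]].
  have aL : sqsum a (limn (sqs a)) by move=> n; exact: sqs_le_lim aM.
  have [b bM ->] := comp_coef aL; rewrite (hardy2_N bM) (hardy2_N aM) !re_rc mulrC.
  by apply: limr_le; [exact: sqs_cvg bM|apply: nearW => n; exact: bM].
have nrmE f : hardy 2 f -> hardy_norm 2 f = (Num.sqrt (re (hardy2_ip f f)))%:E.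
  by move=> /hardy2_coef[a [Ma [aM ->]]]; rewrite (hardy_norm2E aM) (hardy2_N aM).
have [S adjS] := adjoint_ex H0 Hlin ipl ips N_ge0 N_def monom_hardy ipx parsevalx riesz HT Tlin comp_monom_sum Tb.
exact: (hilbert_schmidt_schatten H0 Hlin ipl ips N_ge0 N_def monom_hardy ipx parsevalx riesz HT Tlin comp_monom_sum Tb adjS nrmE p2).
Qed.

End CompositionSchatten.

End HardySpaces.

(** * The symbol and the test functions *)

Section Symbol.
Variable R : realType.
Local Notation C := (Cplx R).
Local Notation re := (@complex.Re R).
Local Notation im := (@complex.Im R).
Local Notation m := (uniform_prob (two_pi_gt0 R)).
Implicit Types (z w : C) (F G : C -> C).

Definition sym z : C := 1 - rc 2^-1 * csqrt (1 - z).

Lemma re_1sub_gt0 z : cmod z < 1 -> 0 < re (1 - z).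
Proof. by move=> z1; rewrite reD reN re1 subr_gt0; apply: le_lt_trans (re_le z) z1. Qed.

Lemma cmod_1sub_le2 z : cmod z <= 1 -> cmod (1 - z) <= 2.
Proof. by move=> z1; have := cmodB 1 z; rewrite cmod1; lra. Qed.

Lemma re_1sub_expi_gt0 (t : R) : 0 < t -> t < 2 * pi -> 0 < re (1 - expi t).
Proof.
move=> t0 t2; have [k k0 H] := cos_low t0 t2; rewrite reD reN re1 re_expi.
by apply: lt_le_trans (H t _); rewrite ?gtr0_norm // mulr_gt0 // exprn_gt0.
Qed.

Lemma cder_1sub z : cder (fun w => 1 - w) z.
Proof. by exists (fun=> -1); [exact: ccts_cst|move=> w; ring]. Qed.

Lemma cder_sym z : 0 < re (1 - z) -> cder sym z.
Proof.
move=> z0; rewrite /sym.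
apply: cderD; first exact: cder_cst.
have -> : (fun w : C => - (rc 2^-1 * csqrt (1 - w))) = (fun w => (- rc 2^-1) * csqrt (1 - w)).
  by apply/funext => w; rewrite mulNr.
apply: cderM; first exact: cder_cst.
exact: (cder_comp (F := @csqrt R) (cder_1sub z) (cder_csqrt z0)).
Qed.

(** With [w] the root, [|w|^2 = |1 - z| <= 2] settles the case [re w >= 1]. Otherwise the sector
    gives [|w|^2 <= 2 (re w)^2 <= 2 re w]. *)
Lemma csqrt_sq_bound z : 0 < re (1 - z) -> cmod (1 - z) <= 2 ->
  cmod (csqrt (1 - z)) ^+ 2 <= 2 * re (csqrt (1 - z)).
Proof.
move=> z0 z2; have := cmod_csqrt (1 - z); have := im_csqrt_le z0; have := re_csqrt_gt0 z0.
set w := csqrt _ => w0 wi wc; have wc' := wc; rewrite cmod_sqE in wc'; rewrite wc.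
have i2 : im w ^+ 2 <= re w ^+ 2 by rewrite -normr_sq ler_pXn2r ?nnegrE ?normr_ge0 ?ltW.
have [x1|x1] := leP 1 (re w); first by lra.
by rewrite -wc'; move: i2 x1 w0; move: (re w) (im w ^+ 2) => x y; nra.
Qed.

(** [1 - |1 - w / 2|^2 = re w - |w|^2 / 4], and [csqrt_sq_bound] absorbs half of [re w]. The
    hypotheses also admit the points of the circle other than 1. *)
Lemma sym_defect z : 0 < re (1 - z) -> cmod (1 - z) <= 2 ->
  re (csqrt (1 - z)) / 2 <= 1 - cmod (sym z) ^+ 2.
Proof.
move=> z0 z2; have := csqrt_sq_bound z0 z2; rewrite /sym; set w := csqrt _.
rewrite !cmod_sqE !reD !reN !imD !imN re1 im1 !reM !imM re_rc im_rc.
by move: (re w) (im w) => x y h; lra.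
Qed.

Lemma sym_lt1 z : 0 < re (1 - z) -> cmod (1 - z) <= 2 -> cmod (sym z) < 1.
Proof.
move=> z0 z2; have := sym_defect z0 z2; have := re_csqrt_gt0 z0 => w0 h.
by rewrite -(@expr_lt1 _ 2) ?cmod_ge0 //; lra.
Qed.

Lemma holo_sym : holo sym.
Proof. by move=> z z1; apply/cder_sym/re_1sub_gt0. Qed.

Lemma sym_disk z : cmod z < 1 -> cmod (sym z) < 1.
Proof. by move=> z1; apply: sym_lt1; [exact: re_1sub_gt0|exact/cmod_1sub_le2/ltW]. Qed.

Lemma sym_mean (r : R) : 0 < r -> r < 1 ->
  RI (fun t => (1 - cmod (sym (rc r * expi t)) ^+ 2)^-1) <= 8.
Proof.
move=> r0 r1; pose W z : C := (csqrt (1 - z))^-1.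
have w0 z : cmod z < 1 -> csqrt (1 - z) != 0.
  move=> z1; apply/eqP => /(congr1 re) h.
  by have := re_csqrt_gt0 (re_1sub_gt0 z1); rewrite h ltxx.
have hW : holo W.
  move=> z z1; apply: (cder_comp (F := GRing.inv)); last exact/cder_inv/w0.
  exact: (cder_comp (F := @csqrt R) (cder_1sub z) (cder_csqrt (re_1sub_gt0 z1))).
have WE z : cmod z < 1 -> W z = rc (cmod (csqrt (1 - z)) ^- 2) * cj (csqrt (1 - z)).
  move=> z1; have c0 := cmod_gt0 (w0 z z1).
  rewrite /W; apply: (mulfI (w0 z z1)); rewrite mulfV ?w0 // mulrCA mul_cj -rcM mulVf ?rc1 //.
  by rewrite gt_eqF // exprn_gt0.
have Wim z : cmod z < 1 -> `|im (W z)| <= re (W z).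
  move=> z1; have c0 := cmod_gt0 (w0 z z1).
  rewrite WE // reM imM re_rc im_rc re_cj im_cj !mul0r subr0 addr0 normrM normrN.
  have k0 : 0 < cmod (csqrt (1 - z)) ^- 2 by rewrite invr_gt0 exprn_gt0.
  by rewrite gtr0_norm // ler_pM2l // ltW //; exact/im_csqrt_le/re_1sub_gt0.
have rz t : cmod (rc r * expi t : C) < 1 by rewrite cmod_circle // ltW.
have W0 : re (W 0) <= 1.
  apply: le_trans (re_le _) _; rewrite cmodV subr0.
  have := cmod_csqrt (1 : C); rewrite cmod1 => /eqP.
  by rewrite sqrp_eq1 ?cmod_ge0 // => /eqP ->; rewrite invr1.
have Wr := ri_cmod (ccont_cint (holo_circle hW r0 r1)).
(* The defect is at least [re w / 2] and [|w| <= 2 re w], hence the 4; [half_plane_sqrt] bounds the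
   mean of [|W|] by 2, which makes 8. *)
apply: (@le_trans _ _ (RI (fun t => 4 * cmod (W (rc r * expi t))))); last first.
  by rewrite RIZ //; have := half_plane_sqrt hW Wim r0 r1; lra.
have bnd t : (1 - cmod (sym (rc r * expi t)) ^+ 2)^-1 <= 4 * cmod (W (rc r * expi t)).
  have z0 := re_1sub_gt0 (rz t); have z2 := cmod_1sub_le2 (ltW (rz t)).
  have := sym_defect z0 z2; have := re_csqrt_gt0 z0; rewrite /W cmodV.
  have := cmod_re_sqrt2 (ltW (im_csqrt_le z0)); have := cmod_gt0 (w0 _ (rz t)).
  move: (csqrt _) => w c0 c1 x0 d.
  have d0 : 0 < 1 - cmod (sym (rc r * expi t)) ^+ 2 by lra.
  by rewrite -ler_pdivrMl // -invfM lef_pV2 ?posrE ?mulr_gt0 //; lra.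
apply: le_RI => //; last exact: riZ.
exact: (den_ri holo_sym sym_disk).
Qed.

Definition tst (h : R) z : C := (rc h / (1 - rc (1 - h) * z)) ^+ 2.

Lemma tst_den (h : R) z : 0 < h -> h <= 1 / 2 -> cmod z <= 1 -> h <= cmod (1 - rc (1 - h) * z).
Proof.
move=> h0 h1 z1; have := cmodB_ge 1 (rc (1 - h) * z); rewrite cmod1 cmodM cmod_rc gtr0_norm; last by lra.
have := ler_wpM2l (_ : 0 <= 1 - h) z1; lra.
Qed.

Lemma cmod_tst (h : R) z : 0 < h -> h <= 1 / 2 ->
  cmod (tst h z) = h ^+ 2 / cmod (1 - rc (1 - h) * z) ^+ 2.
Proof. by move=> h0 h1; rewrite /tst cmodX cmodM cmodV cmod_rc gtr0_norm // expr_div_n. Qed.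

Lemma tst_le1 (h : R) z : 0 < h -> h <= 1 / 2 -> cmod z <= 1 -> cmod (tst h z) <= 1.
Proof.
move=> h0 h1 z1; have d := tst_den h0 h1 z1; have d0 := lt_le_trans h0 d.
by rewrite cmod_tst // ler_pdivrMr ?exprn_gt0 // mul1r ler_pXn2r ?nnegrE ?(ltW h0) ?(ltW d0).
Qed.

Lemma cder_tst (h : R) z : 0 < h -> h <= 1 / 2 -> cmod z <= 1 -> cder (tst h) z.
Proof.
move=> h0 h1 z1; have d0 := lt_le_trans h0 (tst_den h0 h1 z1).
have dn : 1 - rc (1 - h) * z != 0 by apply/eqP => e; move: d0; rewrite e cmod0 ltxx.
rewrite /tst; apply: (cder_comp (F := fun w : C => w ^+ 2)); last exact: cderX.
apply: cderM; first exact: cder_cst.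
apply: (cder_comp (F := GRing.inv) (G := fun w => 1 - rc (1 - h) * w)); last exact: cder_inv.
have -> : (fun w : C => 1 - rc (1 - h) * w) = (fun w => 1 + (- rc (1 - h)) * w).
  by apply/funext => w; rewrite mulNr.
by apply: cderD; [exact: cder_cst|apply: cderM; [exact: cder_cst|exact: cder_id]].
Qed.

Lemma ccont_tst (h : R) : 0 < h -> h <= 1 / 2 -> ccont (fun t => tst h (expi t)).
Proof.
move=> h0 h1; apply: (ccont_ccts (u := @expi R)); first exact: ccont_expi.
by move=> t; apply/cder_ccts/(cder_tst h0 h1); rewrite cmod_expi.
Qed.

(** The square in [tst] makes its modulus comparable to a Poisson kernel: at the point [1 - h] the
    kernel has numerator [h * (2 - h) >= h] over the same denominator, so [|tst h|] is at most [h]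
    times it. *)
Lemma tst_mean (h : R) : 0 < h -> h <= 1 / 2 -> RI (fun t => cmod (tst h (expi t))) <= h.
Proof.
move=> h0 h1; have z1 : cmod (rc (1 - h)) < 1 by rewrite cmod_rc gtr0_norm; lra.
apply: (@le_trans _ _ (RI (fun t => h * pois (rc (1 - h)) t))); last first.
  by rewrite RIZ ?RI_pois ?mulr1 //; exact/ri_cont/pois_continuous.
apply: le_RI; [exact/ri_cmod/ccont_cint/(ccont_tst h0 h1)|exact/riZ/ri_cont/pois_continuous|].
move=> t; rewrite cmod_tst // poisE //.
have -> : cmod (1 - rc (1 - h) * cj (expi t)) = cmod (1 - rc (1 - h) * expi t).
  by rewrite -cmod_cj cjD cjN cjM cjK !cj_rc.
have d0 := lt_le_trans h0 (tst_den (z := expi t) h0 h1 (eq_ind_r (fun x => x <= 1) (lexx _) (cmod_expi t))).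
rewrite mulrA ler_pM2r ?invr_gt0 ?exprn_gt0 // cmod_rc gtr0_norm; last by lra.
by nra.
Qed.

Lemma tst_sym_den (h : R) z : 1 - rc (1 - h) * sym z = rc h + rc ((1 - h) / 2) * csqrt (1 - z).
Proof.
have e : rc h + rc (1 - h) = 1 by rewrite -rcD addrC subrK rc1.
rewrite /sym.
have -> : rc (1 - h) = 1 - rc h :> C by rewrite rcD rcN rc1.
have -> : rc ((1 - h) / 2) = (1 - rc h) * rc 2^-1 :> C by rewrite rcM rcD rcN rc1.
by ring.
Qed.

(** With [q = h + (1 - h) w / 2], the inequality [(a + b)^2 >= 4 a b] bounds [|q|^2] below by a
    multiple of [h * re w], while [|1 - z| = |w|^2 <= 2 re w]. So the composed test function is of
    order [h] away from 1. *)
Lemma tst_sym_upper (h : R) z : 0 < h -> h <= 1 / 2 -> 0 < re (1 - z) -> cmod (1 - z) <= 2 ->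
  cmod (tst h (sym z)) * cmod (1 - z) <= 4 * h.
Proof.
move=> h0 h1 z0 z2; rewrite cmod_tst // tst_sym_den.
have wb := csqrt_sq_bound z0 z2; have w0 := re_csqrt_gt0 z0.
rewrite -(cmod_csqrt (1 - z)); set w := csqrt _ in wb w0 *.
set q := rc h + _; have qr : re q = h + (1 - h) / 2 * re w.
  by rewrite reD reM !re_rc !im_rc mul0r subr0.
have k0 : 0 < (1 - h) / 2 * re w by apply: mulr_gt0 => //; lra.
have q0 : 0 < re q by rewrite qr; lra.
have q2 : h * re w / 2 <= cmod q ^+ 2.
  apply: (@le_trans _ _ (re q ^+ 2)); last by rewrite ler_pXn2r ?nnegrE ?cmod_ge0 ?re_le ?ltW.
  rewrite qr; have := sqr_ge0 (h - (1 - h) / 2 * re w).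
  have : h * re w * (1 / 2) <= h * re w * (1 - h) by apply: ler_wpM2l; [rewrite mulr_ge0 ?ltW|lra].
  nra.
have Q0 : 0 < cmod q ^+ 2 by rewrite exprn_gt0 // (lt_le_trans q0 (re_le q)).
rewrite mulrAC ler_pdivrMr //.
have h2 : 0 <= h ^+ 2 by exact: sqr_ge0.
have : h ^+ 2 * cmod w ^+ 2 <= h ^+ 2 * (2 * re w) by apply: (ler_wpM2l h2).
have : 4 * h * (h * re w / 2) <= 4 * h * cmod q ^+ 2 by apply: ler_wpM2l; [lra|].
lra.
Qed.

(** The root sends the window of size [4 h^2] at 1 to [|w| <= 2 h]; then [|q| <= 2 h] and the
    modulus is at least [h^2 / (2 h)^2]. *)
Lemma tst_sym_lower (h : R) z : 0 < h -> h <= 1 / 2 -> cmod (1 - z) <= 4 * h ^+ 2 -> 1 / 4 <= cmod (tst h (sym z)).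
Proof.
move=> h0 h1 zh; rewrite cmod_tst // tst_sym_den; set w := csqrt _.
have wh : cmod w <= 2 * h.
  rewrite -(@ler_pXn2r _ 2) ?nnegrE ?cmod_ge0 //; last by lra.
  by rewrite cmod_csqrt exprMn; lra.
set q := rc h + _; have qh : cmod q <= 2 * h.
  apply: le_trans (cmodD _ _) _; rewrite cmodM !cmod_rc !gtr0_norm //; last by lra.
  have : (1 - h) / 2 * cmod w <= 1 / 2 * cmod w by apply: ler_wpM2r; [exact: cmod_ge0|lra].
  lra.
have q0 : 0 < cmod q.
  apply: lt_le_trans (re_le q); rewrite reD reM !re_rc !im_rc mul0r subr0.
  have : 0 <= (1 - h) / 2 * re w by apply: mulr_ge0; [lra|exact: re_csqrt_ge0].
  lra.
have q2 : cmod q ^+ 2 <= 4 * h ^+ 2.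
  by rewrite (_ : 4 * h ^+ 2 = (2 * h) ^+ 2) ?ler_pXn2r ?nnegrE ?cmod_ge0 //; [lra|ring].
by rewrite ler_pdivlMr ?exprn_gt0 //; lra.
Qed.

Lemma expi_near0 : exists2 d : R, 0 < d & forall t, `|t| < d -> cmod (1 - expi t : C) <= 2 * `|t|.
Proof.
have [d d0 H] := polar_small (ltr01 : (0 : R) < 1); exists d => // t td.
have := H 0 t _ td; rewrite normr0 d0 expR0 rc1 mul1r add0r mul1r => /(_ isT) h.
have : cmod (0 +i* t : C)%C = `|t|.
  by apply/eqP; rewrite -(@eqrXn2 _ 2) ?cmod_ge0 // cmod_sqE /= expr0n add0r normr_sq.
have := cmodD (expi t - 1 - (0 +i* t)%C) (0 +i* t)%C; rewrite subrK cmodBC; lra.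
Qed.

End Symbol.

(** * Markov's inequality up to null sets *)

Section Markov.
Context d (T : measurableType d) (R : realType) (m : {measure set T -> \bar R}).
Local Open Scope ereal_scope.

(** Meant for [Psi] of a boundary function, whose values are known almost everywhere only. *)
Lemma markov_ae (f : T -> \bar R) (S : set T) (v : R) : measurable S -> (0 <= v)%R ->
  (forall x, 0 <= f x) -> (\forall x \ae m, S x -> v%:E <= f x) ->
  v%:E * m S <= \int[m]_x f x.
Proof.
move=> mS v0 f0 [N [mN N0 Ns]]; rewrite -(integral_cst _ mS) integral_mkcond.
have v0' : 0 <= v%:E by rewrite lee_fin.
apply: (@le_integral_off_null _ _ _ _ _ _ N) => // x.
  by rewrite patchE; case: ifP.
move=> Nx; rewrite patchE; case: ifPn => [xS|//]; apply: contrapT => h; apply: Nx.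
by apply: Ns => /= H; apply: h; apply: H; rewrite inE in xS.
Qed.

End Markov.

(** * Orlicz functions and the heights of the test functions *)

Section OrliczFunctions.
Variables (R : realType) (Psi : \bar R -> \bar R).
Hypothesis hPsi : orlicz_function Psi.

Definition psi (x : R) : R := fine (Psi x%:E).

(** The strict convexity inequality between 0 and [2 * x] puts [Psi x] strictly below some extended
    real, hence below [+oo]. *)
Lemma orlicz_fin x : 0 <= x -> Psi x%:E = (psi x)%:E.
Proof.
move=> x0; rewrite /psi fineK // ge0_fin_numE; last by apply: (orlicz_ge0 hPsi); rewrite lee_fin.
have [->|xn] := eqVneq x 0; first by rewrite (orlicz_0 hPsi) ltry.
have xp : 0 < x by rewrite lt_def xn.
have x2 : 0 <= x * 2 by rewrite mulr_ge0.
have x2n : x * 2 != 0 by rewrite mulf_neq0.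
have t01 : 0 < (1 / 2 : R) < 1 by apply/andP; split; lra.
have := orlicz_strictly_convex hPsi x2 (lexx 0) x2n t01.
rewrite mulr0 addr0 (_ : 1 / 2 * (x * 2) = x); last by field.
by move=> h; apply: (lt_le_trans h); exact: leey.
Qed.

Lemma psi_ge0 x : 0 <= x -> 0 <= psi x.
Proof. by move=> x0; apply/fine_ge0/(orlicz_ge0 hPsi); rewrite lee_fin. Qed.

Lemma psi_gt0 x : 0 < x -> 0 < psi x.
Proof.
move=> x0; have t01 : 0 < (1 / 2 : R) < 1 by apply/andP; split; lra.
have := orlicz_strictly_convex hPsi (ltW x0) (lexx 0) (lt0r_neq0 x0) t01.
rewrite mulr0 addr0 (orlicz_0 hPsi) mule0 adde0 !orlicz_fin ?(ltW x0) //; last first.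
  by rewrite mulr_ge0 // ltW.
rewrite -EFinM lte_fin; have : 0 <= psi (1 / 2 * x) by apply: psi_ge0; rewrite mulr_ge0 // ltW.
lra.
Qed.

Lemma psi_scale (s x : R) : 0 <= s <= 1 -> 0 <= x -> psi (s * x) <= s * psi x.
Proof.
move=> s01 x0; have s0 : 0 <= s by case/andP: s01.
have x0' : (0 <= x%:E)%E by rewrite lee_fin.
have := orlicz_convex hPsi x0' (lexx 0%E) s01.
by rewrite mule0 adde0 (orlicz_0 hPsi) mule0 adde0 -EFinM !orlicz_fin // ?mulr_ge0.
Qed.

Lemma psi_super (K : R) : exists2 X, 0 < X & forall x, X <= x -> K * x <= psi x.
Proof.
have /cvgeyPge /(_ K) [X [_ HX]] := orlicz_superlinear hPsi.
exists (Num.max 1 (X + 1)); first by rewrite lt_max ltr01.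
move=> x; rewrite ge_max => /andP[x1 xX]; have x0 : 0 < x by lra.
have Xx : X < x by lra.
have := HX x Xx; rewrite orlicz_fin ?(ltW x0) // inver gt_eqF // -EFinM lee_fin.
by rewrite ler_pdivlMr.
Qed.

Lemma limsup_scale (A : R) : 1 < A ->
  (0 < limf_esup (fun x : R => Psi (A * x)%:E / (Psi x%:E) ^+ 2) (pinfty_nbhs R))%E ->
  exists2 dl : R, 0 < dl & forall X, exists2 y, X < y & dl * psi y ^+ 2 <= psi (A * y).
Proof.
move=> A1; set L := limf_esup _ _ => L0.
have [dl d0 dL] : exists2 dl : R, 0 < dl & (dl%:E < L)%E.
  case: (L) L0 => [l|_|//]; last by exists 1 => //; exact: ltry.
  by rewrite lte_fin => l0; exists (l / 2); [rewrite divr_gt0|rewrite lte_fin; lra].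
exists dl => // X; pose V := [set x : R | Num.max X 0 < x].
have FV : pinfty_nbhs R V by exists (Num.max X 0); split=> //; exact: num_real.
have LV : (L <= ereal_sup [set (Psi (A * x)%:E / (Psi x%:E) ^+ 2)%E | x in V])%E.
  by apply: ereal_inf_lbound; exists V.
have [_ [y Vy <-] h] := ereal_sup_gt (lt_le_trans dL LV).
move: Vy; rewrite /V /= gt_max => /andP[Xy y0].
exists y => //; have p0 := psi_gt0 y0.
move: h; rewrite !orlicz_fin ?(ltW y0) // ?mulr_ge0 ?(ltW y0) //; last by lra.
rewrite -EFin_expe inver gt_eqF ?exprn_gt0 // -EFinM lte_fin ltr_pdivlMr ?exprn_gt0 //.
exact: ltW.
Qed.

(** With [h = 1 / psi y], the bound 2 gives [h <= 1 / 2], the next one lets [h] tend to 0, and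
    superlinear growth makes [y * h] tend to 0, so that the composed test functions vanish in the
    limit away from 1. *)
Lemma test_heights (A dl : R) : (forall X, exists2 y, X < y & dl * psi y ^+ 2 <= psi (A * y)) ->
  exists y : nat -> R, forall n, [/\ 0 < y n, 2 <= psi (y n), n.+1%:R <= psi (y n),
    n.+1%:R * y n <= psi (y n) & dl * psi (y n) ^+ 2 <= psi (A * y n)].
Proof.
move=> H; suff /choice [y Hy] : forall n, exists y, [/\ 0 < y, 2 <= psi y, n.+1%:R <= psi y,
    n.+1%:R * y <= psi y & dl * psi y ^+ 2 <= psi (A * y)] by exists y.
move=> n; have [X X0 HX] := psi_super n.+1%:R.
have [y] := H (Num.max X 2); rewrite gt_max => /andP[Xy y2] Ay.
have n1 : (1 : R) <= n.+1%:R by rewrite ler1n.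
have h := HX y (ltW Xy); exists y; split=> //; first by lra.
- by move: h n1; move: (n.+1%:R : R) => k h k1; nra.
- by move: h n1; move: (n.+1%:R : R) => k h k1; nra.
Qed.

End OrliczFunctions.

(** * Failure of compactness on the Hardy-Orlicz space *)

Section Noncompactness.
Variable R : realType.
Local Notation C := (Cplx R).
Local Notation re := (@complex.Re R).
Local Notation im := (@complex.Im R).
Local Notation m := (uniform_prob (two_pi_gt0 R)).
Implicit Types (F G : C -> C).

Lemma radialB F G t k l : radial F t k -> radial G t l -> radial (fun z => F z - G z) t (k - l).
Proof.
move=> hF hG e e0; have e2 : 0 < e / 2 by rewrite divr_gt0.
have [d d0 H] := hF _ e2; have [d' d0' H'] := hG _ e2.
exists (Num.min d d'); first by rewrite lt_min d0.
move=> r rd r1.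
have [dl dr] : Num.min d d' <= d /\ Num.min d d' <= d' by rewrite !ge_min !lexx orbT.
have h := H r; have h' := H' r.
have -> : F (rc r * expi t) - G (rc r * expi t) - (k - l) =
    (F (rc r * expi t) - k) - (G (rc r * expi t) - l) by ring.
apply: le_trans (cmodB _ _) _; rewrite [e]splitr; apply: lerD; [apply: h|apply: h'] => //; lra.
Qed.

Lemma radial_ccts F t : ccts F (expi t) -> radial F t (F (expi t)).
Proof.
move=> hF e e0; have [d d0 H] := hF e e0; exists d => // r rd r1; apply/ltW/H.
have -> : rc r * expi t - expi t = rc (r - 1) * expi t by rewrite rcD rcN rc1 mulrBl mul1r.
by rewrite cmodM cmod_expi mulr1 cmod_rc ltr0_norm; lra.
Qed.

Lemma hardy1_bounded F (B : R) : holo F -> (forall z, cmod z < 1 -> cmod (F z) <= B) -> hardy 1 (res F).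
Proof.
move=> hF FB; have af := holo_analytic hF; split=> //.
apply: (@le_lt_trans _ _ B%:E); last exact: ltry.
apply: ge_ereal_sup => _ [r /= r01 <-]; rewrite in_itv /= in r01.
have rz t : cmod (rc r * expi t : C) < 1 by exact: circle_lt1.
rewrite hardy_mean1E // lee_fin -[leRHS](RI_cst B); apply: le_RI.
- apply/ri_cmod/ccont_cint/ccont_circle => t; exact/cder_ccts/(analytic_holo af).
- exact: ri_cst.
- by move=> t; rewrite ext_res //; exact: FB.
Qed.

Lemma arc_measure (s : R) : 0 <= s -> s <= 2 * pi -> m `[0, s]%classic = (s / (2 * pi))%:E.
Proof.
move=> s0 s2; have mS : measurable (`[0, s]%classic : set R) by exact: measurable_itv.
have -> : m `[0, s]%classic = (\int[m]_t (\1_(`[0, s]%classic) t)%:E)%E.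
  by rewrite integral_indic // setIT.
rewrite integral_uniform; last 2 first.
- by apply/measurable_EFinP; exact: measurable_indic.
- by move=> t; rewrite lee_fin.
rewrite integral_indic // subr0 (_ : `[0, s] `&` `[0, (2 * pi)] = `[0, s]%classic).
  have ls : lebesgue_measure (`[0, s]%classic : set R) = s%:E.
    rewrite lebesgue_measure_itv /= lte_fin; case: ltP => [_|s0']; first by rewrite sube0.
    by congr EFin; apply/le_anti; rewrite s0 s0'.
  by transitivity ((2 * pi)^-1%:E * s%:E)%E; [congr (_ * _)%E; exact: ls|rewrite -EFinM mulrC].
apply/seteqP; split=> t /=; rewrite !in_itv /=; first by case.
by move=> /andP[t0 ts]; rewrite t0 ts (le_trans ts).
Qed.

Lemma sym_not_compact (Psi : \bar R -> \bar R) (A : R) (phi : disk R -> disk R) :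
  orlicz_function Psi -> 1 < A ->
  (0 < limf_esup (fun x : R => Psi (A * x)%:E / (Psi x%:E) ^+ 2) (pinfty_nbhs R))%E ->
  (forall z : disk R, val (phi z) = sym (val z)) ->
  ~ compact_operator (hardy_orlicz Psi) (hardy_orlicz_norm Psi) (comp_op phi).
Proof.
move=> hPsi A1 L0 phiE comp.
have [dl dl0 Hdl] := limsup_scale hPsi A1 L0.
have [y Hy] := test_heights hPsi Hdl.
have A0 : 0 < A by lra.
pose ps := psi Psi; pose h n := (ps (y n))^-1.
have y0 n : 0 < y n by case: (Hy n).
have ps2 n : 2 <= ps (y n) by case: (Hy n).
have psn n : n.+1%:R <= ps (y n) by case: (Hy n).
have psy n : n.+1%:R * y n <= ps (y n) by case: (Hy n).
have psA n : dl * ps (y n) ^+ 2 <= ps (A * y n) by case: (Hy n).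
have ps0 n : 0 < ps (y n) by have := ps2 n; lra.
have hp n : h n * ps (y n) = 1 by rewrite mulVf // gt_eqF.
have h0 n : 0 < h n by rewrite invr_gt0.
have h1 n : h n <= 1 / 2 by rewrite mul1r lef_pV2 ?posrE.
have hn n : h n <= n.+1%:R^-1 by rewrite lef_pV2 ?posrE.
have yh n : y n * h n <= n.+1%:R^-1.
  by rewrite /h ler_pdivrMr // ler_pdivlMl.
(* |tst h| <= 1 has mean at most h, so psi (y |tst h|) <= |tst h| psi y has mean at most
   h psi y = 1. *)
pose F n z := rc (y n) * tst (h n) z : C; pose f n := res (F n).
have dF n z : cmod z <= 1 -> cder (F n) z.
  by move=> z1; apply: cderM; [exact: cder_cst|exact: cder_tst].
have holoF n : holo (F n) by move=> z z1; apply/dF/ltW.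
have cF n z : cmod (F n z) = y n * cmod (tst (h n) z) by rewrite cmodM cmod_rc gtr0_norm.
have F1 n z : cmod z <= 1 -> cmod (F n z) <= y n.
  by move=> z1; rewrite cF; apply: ler_piMr; [exact: ltW|exact: tst_le1].
have bf n t : boundary (f n) t = F n (expi t).
  apply: radial_boundary; apply: (@radial_ext _ (F n)); first by move=> z z1; rewrite ext_res.
  by apply/radial_ccts/cder_ccts/dF; rewrite cmod_expi.
have ccF n : ccont (fun t => F n (expi t)) by exact/ccontZ/ccont_tst.
have mod1 n : (modular Psi 1 (boundary (f n)) <= 1)%E.
  apply: (@le_trans _ _ (\int[m]_t (ps (y n) * cmod (tst (h n) (expi t)))%:E)%E).
    apply: (@le_integral_off_null _ _ _ _ _ _ set0) => //.
    - by move=> t; apply: (orlicz_ge0 hPsi); rewrite lee_fin divr1 cmod_ge0.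
    - by move=> t; rewrite lee_fin mulr_ge0 ?cmod_ge0 ?(ltW (ps0 n)).
    move=> t _; rewrite divr1 bf orlicz_fin ?cmod_ge0 // lee_fin cF mulrC [ps _ * _]mulrC.
    apply: psi_scale => //; last exact: ltW.
    by rewrite cmod_ge0 tst_le1 // cmod_expi.
  have rt : ri (fun t => cmod (tst (h n) (expi t))) by apply/ri_cmod/ccont_cint/ccont_tst.
  rewrite RI_EFin; last exact: riZ.
  rewrite RIZ // lee_fin -[leRHS](hp n) mulrC; apply: ler_wpM2r; first exact: ltW.
  exact: tst_mean.
have Hf n : hardy_orlicz Psi (f n).
  split; first by apply: (@hardy1_bounded _ (y n)) => // z z1; exact/F1/ltW.
  have -> : boundary (f n) = (fun t => F n (expi t)) by apply/funext => t; exact: bf.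
  have [m1 m2] := cmeas_ccont (ccF n); split=> //; exists 1; split=> //.
  have -> : (fun t => F n (expi t)) = boundary (f n) by apply/funext => t; rewrite bf.
  by apply: le_lt_trans (mod1 n) _; exact: ltry.
have fN n : (hardy_orlicz_norm Psi (f n) <= 1%:E)%E by apply: ereal_inf_lbound; exists 1.
have [k [kh [g [[hg [gm1 gm2 _]] cvg0]]]] := comp f Hf (ex_intro _ 1 fN).
have kn n : (n <= k n)%N by elim: n => // n IH; apply: leq_ltn_trans IH (kh _ _ _).
pose u n := comp_op phi (f (k n)) - g.
pose D n := boundary (u n); pose bg := boundary g.
(* Radial limits subtract only where both exist: for [g] this is [fatou1], for the composed test
   function it is differentiability of [sym] at points of the circle other than 1. *)
have aeD n : \forall t \ae m, 0 < t < 2 * pi /\ D n t = F (k n) (sym (expi t)) - bg t.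
  have [M HM] := hardy1_mean hg; have [ag _] := hg.
  apply: aeS (aeI (ae_circle R) (fatou1 (analytic_holo ag) HM)) => t [t02 [l hl]]; split=> //.
  have /andP[t0 t2] := t02; have z0 := re_1sub_expi_gt0 t0 t2.
  have z2 : cmod (1 - expi t) <= 2 :> R by apply: cmod_1sub_le2; rewrite cmod_expi.
  rewrite /bg (radial_boundary hl); apply: radial_boundary.
  apply: (@radial_ext _ (fun z => F (k n) (sym z) - ext g z)).
    move=> z /disk_ex[w <-]; rewrite !ext_val.
    by rewrite -[RHS]/(F (k n) (val (phi w)) - g w) phiE.
  apply: radialB hl; apply: (@radial_ccts (fun z => F (k n) (sym z))).
  apply: (ccts_comp (F := F (k n)) (G := @sym R)); first exact/cder_ccts/cder_sym.
  by apply/cder_ccts/dF; exact/ltW/sym_lt1.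
(* The Luxemburg norm is an infimum, so once it is below [c] some [c' < c] has modular at most 1. *)
have small c : 0 < c -> exists n0, forall n, (n0 <= n)%N -> exists c', [/\ 0 < c', c' < c & (modular Psi c' (D n) <= 1)%E].
  move=> c0; have /fine_cvgP[[n1 _ fin1] /cvgrPdist_lt /(_ c c0) [n2 _ lt2]] := cvg0.
  exists (maxn n1 n2) => n; rewrite geq_max => /andP[/fin1 fn /lt2 /=].
  rewrite sub0r normrN => /(le_lt_trans (ler_norm _)) fc.
  have /ereal_inf_lt[_ [c' [c'0 mc'] <-]] : (hardy_orlicz_norm Psi (u n) < c%:E)%E.
    by rewrite -(fineK fn) lte_fin.
  by rewrite lte_fin => c'c; exists c'.
have pos c t n : 0 < c -> (0 <= (cmod (D n t) / c)%:E)%E.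
  by move=> c0; rewrite lee_fin divr_ge0 ?cmod_ge0 ?ltW.
have cwt : continuous (fun t => cmod (1 - expi t : C)).
  by apply: ccont_cmod; apply: (ccont_ccts (F := fun z => 1 - z) (@ccont_expi R)) => t; exact/cder_ccts/cder_1sub.
have mw : measurable_fun setT (fun t => cmod (bg t) * cmod (1 - expi t)).
  apply: measurable_funM; first exact: measurable_cmod.
  exact: continuous_measurable_fun.
(* With the weight |1 - e^(it)| the functions f (k n) \o sym tend to 0 uniformly, so the
   boundary function of the limit g vanishes almost everywhere. *)
have null e : 0 < e -> \forall t \ae m, cmod (bg t) * cmod (1 - expi t) < 2 * e.
  move=> e0; pose S := [set t | 2 * e <= cmod (bg t) * cmod (1 - expi t)].
  have mS : measurable S.
    have := mw measurableT _ (measurable_itv `[2 * e, +oo[); rewrite setTI.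
    by congr measurable; apply/seteqP; split=> t /=; rewrite in_itv /= andbT.
  suff S0 : m S = 0 by exists S; split=> // t /= /negP; rewrite -leNgt.
  have Sfin : m S \is a fin_num by exact: fin_num_measure.
  have bnd X : 0 < X -> ((ps X)%:E * m S <= 1)%E.
    (* On [S] the weighted modulus of [bg] is at least [2 * e] and that of the test function at most
       [e]. As the weight is at most 2, this leaves [|D n| >= e / 2 = X * c]. *)
    move=> X0; pose c := e / (2 * X).
    have c0 : 0 < c by rewrite divr_gt0 // mulr_gt0.
    have [n0 Hn0] := small c c0.
    pose n := maxn n0 (Num.trunc (4 / e)).
    have [c' [c'0 c'c mc']] := Hn0 n (leq_maxl _ _).
    have ne : (k n).+1%:R^-1 * 4 <= e.
      rewrite mulrC ler_pdivrMr ?ltr0n // -ler_pdivrMl // mulrC.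
      apply: le_trans (ltW (truncnS_gt (4 / e))) _; rewrite ler_nat ltnS.
      exact: leq_trans (leq_maxr n0 _) (kn n).
    have mk := markov_ae (m := m) (f := fun t => Psi (cmod (D n t) / c')%:E) mS
      (psi_ge0 hPsi (ltW X0)) (fun t => orlicz_ge0 hPsi (pos c' t n c'0)).
    apply: (le_trans (mk _) mc').
    apply: aeS (aeD n) => t [/andP[t0 t2] DE] St.
    have z0 := re_1sub_expi_gt0 t0 t2.
    have z2 : cmod (1 - expi t) <= 2 :> R by apply: cmod_1sub_le2; rewrite cmod_expi.
    rewrite -(orlicz_fin hPsi (ltW X0)); apply: (orlicz_nondecreasing hPsi); first by rewrite lee_fin ltW.
    rewrite lee_fin ler_pdivlMr //.
    have Xc : X * c' <= e / 2.
      have -> : e / 2 = X * c by rewrite /c; field; rewrite gt_eqF.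
      by rewrite ler_pM2l // ltW.
    have up := tst_sym_upper (h0 (k n)) (h1 (k n)) z0 z2.
    have FW : cmod (F (k n) (sym (expi t))) * cmod (1 - expi t) <= e.
      rewrite cF -mulrA; apply: le_trans ne.
      apply: (@le_trans _ _ (y (k n) * (4 * h (k n)))); first by rewrite ler_pM2l.
      by rewrite mulrCA mulrC ler_pM2r.
    have tri : cmod (bg t) <= cmod (F (k n) (sym (expi t))) + cmod (D n t).
      have -> : bg t = F (k n) (sym (expi t)) - D n t by rewrite DE; ring.
      exact: cmodB.
    apply: le_trans Xc _; have := St; rewrite /S /=.
    have := ler_wpM2r (cmod_ge0 (1 - expi t)) tri.
    have := ler_wpM2l (cmod_ge0 (D n t)) z2.
    by rewrite mulrDl; lra.
  have mS0 : (0 <= m S)%E by exact: measure_ge0.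
  have [X1 X10 HX1] := psi_super hPsi 1.
  (* [psi] is unbounded, so the estimate [bnd] for all [X] leaves no positive measure; [X] is taken
     with [psi X * m S >= 2]. *)
  rewrite -(fineK Sfin); congr EFin; apply/eqP; rewrite eq_le fine_ge0 // andbT leNgt.
  apply/negP => p0; pose X := Num.max X1 (2 / fine (m S)).
  have X0 : 0 < X by rewrite lt_max X10.
  have := bnd X X0; rewrite -(fineK Sfin) -EFinM lee_fin leNgt => /negP; apply.
  have : 1 * X <= ps X by apply: HX1; rewrite le_max lexx.
  have : 2 / fine (m S) <= X by rewrite le_max lexx orbT.
  rewrite ler_pdivrMr // mul1r => h2 h3.
  have : X * fine (m S) <= ps X * fine (m S) by rewrite ler_pM2r.
  lra.
have bg0 : \forall t \ae m, bg t = 0.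
  have i0 n : (0 : R) < n.+1%:R^-1 by rewrite invr_gt0.
  (* The countably many values [e = 1 / (n + 1)] share one null set. The weight is positive for
     [0 < t < 2 * pi], so [bg t = 0]. *)
  apply: aeS (aeI (ae_circle R) (ae_foralln (fun n => null _ (i0 n)))) => t [/andP[t0 t2] H].
  have w0 : 0 < cmod (1 - expi t : C) by apply: lt_le_trans (re_1sub_expi_gt0 t0 t2) (re_le _).
  apply: cmod_eq0; apply/eqP; rewrite eq_le cmod_ge0 andbT leNgt; apply/negP => b0.
  have p0 : 0 < cmod (bg t) * cmod (1 - expi t) by exact: mulr_gt0.
  have := H (Num.trunc (2 / (cmod (bg t) * cmod (1 - expi t)))).
  rewrite ltNge => /negP; apply.
  rewrite ler_pdivrMr ?ltr0n // -ler_pdivrMl // mulrC.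
  exact/ltW/truncnS_gt.
(* The contradiction will be [B * dl / pi = 1 + dl / pi > 1]. Since [|D n| >= y / 4] on the arc, the
   scale [c = 1 / (4 * (B * A))] makes the argument of [Psi] at least [B * A * y]. *)
pose B : R := 1 + pi / dl.
have pi0 : 0 < pi :> R := pi_gt0 R.
have B1 : 1 <= B by rewrite /B lerDl divr_ge0 ?ltW.
have B0 : 0 < B by lra.
pose c := (4 * (B * A))^-1.
have BA : 0 < 4 * (B * A) by rewrite !mulr_gt0.
have c0 : 0 < c by rewrite invr_gt0.
have [n0 Hn0] := small c c0.
have [d d0 Hd] := expi_near0 R.
pose n := maxn n0 (Num.trunc d^-1).
have [c' [c'0 c'c mc']] := Hn0 n (leq_maxl _ _).
have hd : h (k n) < d.
  apply: le_lt_trans (hn (k n)) _; rewrite -[d]invrK ltf_pV2 ?posrE ?invr_gt0 ?ltr0n //.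
  apply: lt_le_trans (truncnS_gt d^-1) _; rewrite ler_nat ltnS.
  exact: leq_trans (leq_maxr n0 _) (kn n).
(* For [t <= s] one has [|1 - e^(it)| <= 2 * t <= 4 * hk ^+ 2], the window of [tst_sym_lower]. *)
pose hk := h (k n); pose s := 2 * hk ^+ 2.
have hk0 : 0 < hk := h0 (k n); have hk1 : hk <= 1 / 2 := h1 (k n).
have s0 : 0 <= s by rewrite mulr_ge0 ?sqr_ge0.
have sh : s <= hk by rewrite /s; nra.
have s2 : s <= 2 * pi by have := pi_ge2 R; lra.
have Ay0 : 0 <= A * y (k n) by rewrite mulr_ge0 ?ltW.
have BAy0 : 0 <= B * (A * y (k n)) by rewrite mulr_ge0 // ltW.
have := markov_ae (m := m) (f := fun t => Psi (cmod (D n t) / c')%:E) (S := `[0, s]%classic) (v := ps (B * (A * y (k n)))).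
move=> /(_ (measurable_itv _) (psi_ge0 hPsi BAy0)) /(_ (fun t => orlicz_ge0 hPsi (pos c' t n c'0))).
move=> mk.
have low_ae : \forall t \ae m, `[0, s]%classic t ->
    ((ps (B * (A * y (k n))))%:E <= Psi (cmod (D n t) / c')%:E)%E.
  apply: aeS (aeI (aeD n) bg0) => t [[/andP[t0 t2] DE] bt].
  rewrite /= in_itv /= => /andP[_ ts].
  rewrite -(orlicz_fin hPsi BAy0); apply: (orlicz_nondecreasing hPsi); first by rewrite lee_fin.
  rewrite lee_fin ler_pdivlMr // DE bt subr0 cF.
  have low : 1 / 4 <= cmod (tst hk (sym (expi t))).
    apply: tst_sym_lower => //; apply: le_trans (Hd t _) _; rewrite gtr0_norm //; first by have hkd : hk < d := hd; lra.
    by rewrite /s in ts; lra.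
  apply: (@le_trans _ _ (y (k n) * (1 / 4))); last by rewrite ler_pM2l.
  apply: (@le_trans _ _ (B * (A * y (k n)) * c)); first by apply: ler_wpM2l => //; exact: ltW.
  by rewrite /c le_eqVlt; apply/orP; left; apply/eqP; field; rewrite !gt_eqF.
have : ((ps (B * (A * y (k n))))%:E * (s / (2 * pi))%:E <= 1)%E.
  by rewrite -(arc_measure s0 s2); exact: le_trans (mk low_ae) mc'.
rewrite -EFinM lee_fin leNgt => /negP; apply.
(* Convexity converts the factor [B] inside [psi] into a factor [B] outside, and [psA] then brings
   in [psi (y) ^+ 2], which cancels the [hk ^+ 2] of the arc. *)
have sc : ps (A * y (k n)) <= B^-1 * ps (B * (A * y (k n))).
  rewrite -[X in ps X <= _](mulKf (lt0r_neq0 B0)); apply: psi_scale => //.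
  by rewrite invr_ge0 (ltW B0) /= invf_le1.
have sc2 : B * (dl * ps (y (k n)) ^+ 2) <= ps (B * (A * y (k n))).
  by rewrite -ler_pdivlMl //; apply: le_trans (psA (k n)) sc.
have hk2 : hk ^+ 2 * ps (y (k n)) ^+ 2 = 1 by rewrite -exprMn hp expr1n.
have sp0 : 0 < s / (2 * pi) by rewrite divr_gt0 ?mulr_gt0 ?exprn_gt0.
apply: (@lt_le_trans _ _ (B * (dl * ps (y (k n)) ^+ 2) * (s / (2 * pi)))); last by rewrite ler_pM2r.
have -> : B * (dl * ps (y (k n)) ^+ 2) * (s / (2 * pi)) = B * dl / pi * (hk ^+ 2 * ps (y (k n)) ^+ 2).
  have pn : pi != 0 :> R by rewrite gt_eqF.
  by rewrite /s; move: (B) (ps _) (hk) (pi : R) pn => b1 b2 b3 q qn; field.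
rewrite hk2 mulr1 ltr_pdivlMr // mul1r /B mulrDl divfK ?gt_eqF //; lra.
Qed.

End Noncompactness.

Unset Implicit Arguments.
Set Strict Implicit.

Theorem proposition3p4 (R : realType) (Psi : \bar R -> \bar R)
    (hPsi : orlicz_function Psi)
    (hlimsup : exists A : R, 1 < A /\
       (0 < limf_esup (fun x : R => Psi (A * x)%:E / (Psi x%:E) ^+ 2)
              (pinfty_nbhs R))%E)
    (p : R) (hp : 2 < p) :
  exists phi : disk R -> disk R,
    [/\ analytic (fun z => val (phi z)),
        schatten (@hardy R 2) (@hardy2_ip R) (@hardy_norm R 2) p (comp_op phi)
      & ~ compact_operator (hardy_orlicz Psi) (hardy_orlicz_norm Psi)
            (comp_op phi)].
Proof.
pose phi (z : disk R) : disk R := exist _ (sym (val z)) (disk_norm_lt (sym_disk (disk_lt z))).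
have phiE z : val (phi z) = sym (val z) by [].
have [A [A1 L0]] := hlimsup; exists phi; split.
- exact: holo_analytic (@holo_sym R).
- exact: comp_schatten (@holo_sym R) (@sym_disk R) phiE (@sym_mean R) _ (ltW hp).
- exact: sym_not_compact hPsi A1 L0 phiE.
Qed.
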